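(* Let $\kappa\ge0$. Consider the system $$i\partial_tu=\Pi(|v|^2u),\qquad i\partial_tv=-\Pi(|u|^2v),\qquad u(0)=u_0,\ v(0)=v_0,\qquad(t,z)\in\mathbb{R}\times\mathbb{C}.$$ (i) If $(u_0,v_0)\in\mathcal{X}^\kappa_{\mathcal E}\times\mathcal{X}^\kappa_{\mathcal E}$, then the corresponding solution satisfies $(u,v)\in\mathcal{C}^\infty(\mathbb{R},\mathcal{X}^\kappa_{\mathcal E}\times\mathcal{X}^\kappa_{\mathcal E})$. Moreover, for every $t\in\mathbb{R}$, $$\|e^{\kappa|z|}u(t)\|_{L^2(\mathbb{C})}\le\|e^{\kappa|z|}u_0\|_{L^2(\mathbb{C})}\,e^{c_\kappa\|v_0\|_{L^2}^2|t|},\qquad \|e^{\kappa|z|}v(t)\|_{L^2(\mathbb{C})}\le\|e^{\kappa|z|}v_0\|_{L^2(\mathbb{C})}\,e^{c_\kappa\|u_0\|_{L^2}^2|t|},$$ where the constant $c_\kappa$ depends only on $\kappa$ (with $c_\kappa>0$ for $\kappa>0$, and $c_0=0$). (ii) There is a constant $c_\kappa>0$ depending only on $\kappa$ such that, for any two solutions $(u,v),(\widetilde u,\widetilde v)\in\mathcal{C}^\infty(\mathbb{R},\mathcal{X}^\kappa_{\mathcal E}\times\mathcal{X}^\kappa_{\mathcal E})$ of the system, with initial data $(u_0,v_0)$ and $(\widetilde u_0,\widetilde v_0)$, and for all $t\in\mathbb{R}$, $$\|e^{\kappa|z|}(u(t)-\widetilde u(t))\|_{L^2}^2+\|e^{\kappa|z|}(v(t)-\widetilde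 v(t))\|_{L^2}^2\le\Big(\|e^{\kappa|z|}(u_0-\widetilde u_0)\|_{L^2}^2+\|e^{\kappa|z|}(v_0-\widetilde v_0)\|_{L^2}^2\Big)e^{c_\kappa(\|u_0\|_{L^2}^2+\|\widetilde u_0\|_{L^2}^2+\|v_0\|_{L^2}^2+\|\widetilde v_0\|_{L^2}^2)|t|}.$$
   Context: $\mathcal{E}=\{u(z)=e^{-|z|^2/2}f(z):\ f\text{ entire holomorphic}\}\cap L^2(\mathbb{C})$ is the Bargmann-Fock space, and $\Pi$ is the orthogonal projection onto $\mathcal{E}$, given by $[\Pi u](z)=\frac1\pi e^{-|z|^2/2}\int_{\mathbb{C}}e^{\overline wz-|w|^2/2}u(w)\,dL(w)$, with $L$ Lebesgue measure on $\mathbb{C}$. For every $(u_0,v_0)\in\mathcal{E}\times\mathcal{E}$ the system has a unique global solution in $\mathcal{C}^\infty(\mathbb{R},\mathcal{E}\times\mathcal{E})$ (known); this is ''the corresponding solution''. For $\kappa\ge0$, $\mathcal{X}^\kappa_{\mathcal E}=\{u\in\mathscr{S}'(\mathbb{C}):\ e^{\kappa|z|}u\in L^2(\mathbb{C})\}\cap\mathcal{E}$, with norm $\|e^{\kappa|z|}u\|_{L^2(\mathbb{C})}$. *)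

(* Defs.v *)
From HB Require Import structures.
From mathcomp Require Import all_boot all_order all_algebra.
From mathcomp Require Import all_classical all_reals all_analysis.
From mathcomp Require Import complex.

Set Implicit Arguments.
Unset Strict Implicit.
Unset Printing Implicit Defensive.

Import Order.TTheory GRing.Theory Num.Theory.
Import numFieldNormedType.Exports.

Local Open Scope classical_set_scope.
Local Open Scope ring_scope.
Local Open Scope complex_scope.

Notation normc := ComplexField.Normc.normc.

(* The complex plane is R[i] algebraically; integration over it is carried out
   on R * R with the product Lebesgue measure, through (x, y) |-> x + iy. *)
Definition plane (R : realType) (p : R * R) : R[i] := p.1 +i* p.2.

Notation leb2 R := (@lebesgue_measure R \x @lebesgue_measure R)%E.

Definition Cintegral (R : realType) (g : R[i] -> R[i]) : R[i] :=
  (\int[leb2 R]_p complex.Re (g (plane p))) +i*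
  (\int[leb2 R]_p complex.Im (g (plane p))).

Definition Cexp (R : realType) (z : R[i]) : R[i] :=
  (expR (complex.Re z) * cos (complex.Im z)) +i*
  (expR (complex.Re z) * sin (complex.Im z)).

(* R[i]^o is the complex field as a normed module over itself, so this is
   complex differentiability at every point. *)
Definition entire (R : realType) (f : R[i] -> R[i]) : Prop :=
  forall z : R[i], derivable (f : R[i]^o -> R[i]^o) z 1.

Definition L2enorm (R : realType) (g : R[i] -> R[i]) : \bar R :=
  Lnorm (leb2 R) 2%:E (fun p => (normc (g (plane p)))%:E).

Definition inL2 (R : realType) (g : R[i] -> R[i]) : Prop :=
  [/\ measurable_fun [set: R * R] (fun p => complex.Re (g (plane p))),
      measurable_fun [set: R * R] (fun p => complex.Im (g (plane p))) &
      (L2enorm g < +oo)%E].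

(* Real-valued norm, only meaningful on square-integrable functions. *)
Definition L2norm (R : realType) (g : R[i] -> R[i]) : R := fine (L2enorm g).

(* The Bargmann-Fock space; its elements are genuine (continuous) functions,
   so no quotient by almost everywhere equality is needed. *)
Definition fock (R : realType) : set (R[i] -> R[i]) :=
  [set u | (exists2 f : R[i] -> R[i], entire f &
              forall z, u z = (expR (- (normc z ^+ 2 / 2)))%:C * f z)
           /\ inL2 u].

Definition expweight (R : realType) (kappa : R) (u : R[i] -> R[i]) :
    R[i] -> R[i] :=
  fun z => (expR (kappa * normc z))%:C * u z.

(* For kappa >= 0; elements of fock are square-integrable functions, hence
   tempered distributions, so that requirement is not repeated. *)
Definition Xfock (R : realType) (kappa : R) : set (R[i] -> R[i]) :=
  [set u | inL2 (expweight kappa u)] `&` @fock R.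

Definition Xnorm (R : realType) (kappa : R) (u : R[i] -> R[i]) : R :=
  L2norm (expweight kappa u).

Definition fockproj (R : realType) (u : R[i] -> R[i]) : R[i] -> R[i] :=
  fun z => (pi^-1 * expR (- (normc z ^+ 2 / 2)))%:C *
    Cintegral (fun w =>
      Cexp (conjc w * z - (normc w ^+ 2 / 2)%:C) * u w).

(* du is the derivative of the curve u : R -> S for the norm N; S is a linear
   space of functions on which N is a norm. *)
Definition curve_derivative (R : realType) (S : set (R[i] -> R[i]))
    (N : (R[i] -> R[i]) -> R) (u du : R -> R[i] -> R[i]) : Prop :=
  forall t : R, [/\ S (u t), S (du t) &
    N (fun z => (h^-1)%:C * (u (t + h) z - u t z) - du t z)
      @[h --> 0^'] --> 0].

Definition smooth_curve (R : realType) (S : set (R[i] -> R[i]))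
    (N : (R[i] -> R[i]) -> R) (u : R -> R[i] -> R[i]) : Prop :=
  exists2 D : nat -> R -> R[i] -> R[i],
    D 0%N = u & forall n, curve_derivative S N (D n) (D n.+1).

(* A curve into a product space is smooth when both components are. *)
Definition smooth_pair (R : realType) (S : set (R[i] -> R[i]))
    (N : (R[i] -> R[i]) -> R) (u v : R -> R[i] -> R[i]) : Prop :=
  smooth_curve S N u /\ smooth_curve S N v.

Definition sqmod_mul (R : realType) (v u : R[i] -> R[i]) : R[i] -> R[i] :=
  fun z => (normc (v z) ^+ 2)%:C * u z.

(* (u, v) in C^oo(R, E * E) with initial data (u0, v0) and
   i u' = Pi(|v|^2 u), i v' = - Pi(|u|^2 v), where u', v' are derivatives
   of E-valued curves. *)
Definition fock_solution (R : realType) (u0 v0 : R[i] -> R[i])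
    (u v : R -> R[i] -> R[i]) : Prop :=
  [/\ smooth_pair (@fock R) (@L2norm R) u v,
      exists2 du, curve_derivative (@fock R) (@L2norm R) u du &
        forall t z, 'i%C * du t z = fockproj (sqmod_mul (v t) (u t)) z,
      exists2 dv, curve_derivative (@fock R) (@L2norm R) v dv &
        forall t z, 'i%C * dv t z = - fockproj (sqmod_mul (u t) (v t)) z,
      u 0 = u0 &
      v 0 = v0].

(* Main.v *)
Require Import Defs.
From HB Require Import structures.
From mathcomp Require Import all_boot all_order all_algebra.
From mathcomp Require Import all_classical all_reals all_analysis.
From mathcomp Require Import complex.
From mathcomp Require Import measurable_realfun ring lra.

(* The kernel of [Pi] is dominated by [pi^-1 * exp (- |z - w|^2 / 2)].  Hence,
   by Schur's test, [Pi] is bounded in [L^2] for every weight [om] with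
   [om z <= om w * exp (kappa * |z - w|)]; moreover [Pi u = u] on the Fock space,
   so that [sup |u| <= sqrt pi * ||u||].  Together these give
   [||om * Pi (|v|^2 u)|| <= C * ||v||^2 * ||om * u||].  Since [Pi] is
   self-adjoint, [u'] is orthogonal (for the real scalar product) to [u], and the
   L^2 norms of [u] and [v] are conserved.  Gronwall's inequality for the bounded
   weights [exp (kappa * min (|z|, n))], followed by [n -> oo], gives the growth
   estimate.  The mean value inequality for the same truncated weights shows that
   a solution is differentiable in the weighted norm; its derivatives are again
   trilinear expressions in [u] and [v], whence smoothness, and Gronwall's
   inequality for differences of solutions gives stability.
   The identity [Pi u = u] reduces to the Gaussian mean value property of entire
   functions, which follows from Stokes' formula applied to [h (w) / (w - c)]
   times a radial cut-off, where [h] vanishes at [c]. *)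

Set Implicit Arguments.
Unset Strict Implicit.
Unset Printing Implicit Defensive.

Import Order.TTheory GRing.Theory Num.Theory.
Import numFieldNormedType.Exports.

Local Open Scope classical_set_scope.
Local Open Scope ring_scope.

(** * Complex numbers *)

(** The equation gives a derivative in the unweighted L^2 norm only; the weighted norm of a solution
    is not known beforehand to be finite, let alone continuous in time. For bounded weights this is
    no obstacle, since their norms are equivalent to the L^2 norm, and the estimates obtained for
    them are uniform in the truncation. The norm of a differentiable curve need not be
    differentiable, so differential inequalities are stated on increments and proved by subdivision;
    the price is a factor 2 in the exponent of Gronwall's inequality. In each cubic estimate one
    factor carries the weight and the other two are bounded in sup norm, hence by their conserved
    L^2 norms: only L^2 norms of the data enter the exponents. The basic constant is
    [4 * pi ^+ 2 * expR (kappa ^+ 2)]. It is positive at [kappa = 0], where the value [0] comes from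
    conservation instead. An entire function is only assumed complex differentiable at each point.
    Stokes' formula sees nothing but the conjugate derivative of the cut-off quotient, which is
    continuous, so a subdivision in the manner of Goursat suffices. *)

Section ComplexBasics.
Variable R : realType.
Implicit Types (x y : R) (z w a b : R[i]).
Local Notation Re := (@complex.Re R).
Local Notation Im := (@complex.Im R).
Local Notation "r %:C" := (real_complex R r).

Lemma cplx_eq z w : Re z = Re w -> Im z = Im w -> z = w.
Proof. by case: z => ? ?; case: w => ? ? /= -> ->. Qed.

Lemma ReD z w : Re (z + w) = Re z + Re w. Proof. by case: z; case: w. Qed.
Lemma ImD z w : Im (z + w) = Im z + Im w. Proof. by case: z; case: w. Qed.
Lemma ReN z : Re (- z) = - Re z. Proof. by case: z. Qed.
Lemma ImN z : Im (- z) = - Im z. Proof. by case: z. Qed.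
Lemma ReM z w : Re (z * w) = Re z * Re w - Im z * Im w.
Proof. by case: z; case: w. Qed.
Lemma ImM z w : Im (z * w) = Re z * Im w + Im z * Re w.
Proof. by case: z; case: w. Qed.
Lemma ReJ z : Re (conjc z) = Re z. Proof. by case: z. Qed.
Lemma ImJ z : Im (conjc z) = - Im z. Proof. by case: z. Qed.
Lemma Rerc x : Re x%:C = x. Proof. by []. Qed.
Lemma Imrc x : Im x%:C = 0. Proof. by []. Qed.
Lemma Re0 : Re 0 = 0. Proof. by []. Qed.
Lemma Im0 : Im 0 = 0. Proof. by []. Qed.
Lemma Re1 : Re 1 = 1. Proof. by []. Qed.
Lemma Im1 : Im 1 = 0. Proof. by []. Qed.
Lemma Rei : Re 'i%C = 0. Proof. by []. Qed.
Lemma Imi : Im 'i%C = 1. Proof. by []. Qed.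

Definition ReImE := (ReD, ImD, ReN, ImN, ReM, ImM, ReJ, ImJ, Rerc, Imrc, Re0, Im0, Re1, Im1, Rei, Imi).

Lemma normc_sq z : normc z ^+ 2 = Re z ^+ 2 + Im z ^+ 2.
Proof. by case: z => a b /=; rewrite sqr_sqrtr // addr_ge0 // sqr_ge0. Qed.

Lemma normc_ge0 z : 0 <= normc z.
Proof. by case: z => a b; exact: sqrtr_ge0. Qed.

Lemma normcM z w : normc (z * w) = normc z * normc w.
Proof. exact: Normc.normcM. Qed.

Lemma normc_rc x : normc x%:C = `|x|.
Proof. by rewrite /= expr0n /= addr0 sqrtr_sqr. Qed.

Lemma normcN z : normc (- z) = normc z.
Proof. exact: normcN. Qed.

Lemma normcJ z : normc (conjc z) = normc z.
Proof. by case: z => a b /=; rewrite sqrrN. Qed.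

Lemma normcD z w : normc (z + w) <= normc z + normc w.
Proof. exact: le_normcD. Qed.

Lemma normcB z w : normc (z - w) <= normc z + normc w.
Proof. by rewrite -(normcN w) normcD. Qed.

Lemma normcC z w : normc (z - w) = normc (w - z).
Proof. by rewrite -normcN opprB. Qed.

Lemma normc0 : normc (0 : R[i]) = 0. Proof. exact: Normc.normc0. Qed.
Lemma normc1 : normc (1 : R[i]) = 1. Proof. exact: Normc.normc1. Qed.
Lemma normci : normc ('i%C : R[i]) = 1.
Proof. by rewrite /= expr0n expr1n add0r sqrtr1. Qed.

Lemma normc_eq0 z : (normc z == 0) = (z == 0).
Proof. by apply/eqP/eqP => [/Normc.eq0_normc//|->]; rewrite normc0. Qed.

Lemma normc_gt0 z : (0 < normc z) = (z != 0).
Proof. by rewrite lt_def normc_ge0 andbT normc_eq0. Qed.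

Lemma normc_tri z w a : normc (z - a) <= normc (z - w) + normc (w - a).
Proof.
have -> : z - a = (z - w) + (w - a) by ring.
exact: normcD.
Qed.

Lemma normc_Re z : `|Re z| <= normc z.
Proof.
by rewrite -[leLHS]ger0_norm// -ler_sqr ?nnegrE ?normc_ge0// normr_id real_normK ?num_real// normc_sq lerDl sqr_ge0.
Qed.

Lemma normc_Im z : `|Im z| <= normc z.
Proof.
by rewrite -[leLHS]ger0_norm// -ler_sqr ?nnegrE ?normc_ge0// normr_id real_normK ?num_real// normc_sq lerDr sqr_ge0.
Qed.

Lemma normc_ReIm z : normc z <= `|Re z| + `|Im z|.
Proof.
rewrite -ler_sqr ?nnegrE ?normc_ge0 ?addr_ge0// normc_sq sqrrD !real_normK ?num_real//.
by rewrite -addrA lerD2l lerDr mulrn_wge0// mulr_ge0.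
Qed.

Lemma normc_dist z w : `|normc z - normc w| <= normc (z - w).
Proof.
rewrite ler_norml; have := normcD (z - w) w; have := normcD (w - z) z.
by rewrite !subrK (normcC w z); lra.
Qed.

(** Each bound on [sin] and [cos] below is obtained from the preceding one as a bound on the
    derivative. *)
Lemma mvt0 (f df : R -> R) (y M : R) : (forall x, is_derive x (1:R) f (df x)) ->
  (forall c, `|c| <= `|y| -> `|df c| <= M) -> `|f y - f 0| <= M * `|y|.
Proof.
move=> fd fM.
have cf (a b : R) : {within `[a, b], continuous f}.
  apply: continuous_subspaceT => x; apply/differentiable_continuous/derivable1_diffP.
  by have [] := fd x.
have [y0|y0] := leP 0 y.
- have [c] := MVT_segment y0 (fun x _ => fd x) (cf _ _).
  rewrite in_itv/= => /andP[c0 cy] ->; rewrite subr0 normrM ler_wpM2r//.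
  by apply: fM; rewrite !ger0_norm.
- have [c] := MVT_segment (ltW y0) (fun x _ => fd x) (cf _ _).
  rewrite in_itv/= => /andP[c0 cy] E; rewrite distrC E sub0r normrM normrN ler_wpM2r//.
  by apply: fM; rewrite !ler0_norm ?lerN2// ltW.
Qed.

Lemma sin_le x : `|sin x| <= `|x|.
Proof.
have := @mvt0 sin cos x 1 (fun x => is_derive_sin x).
by rewrite sin0 subr0 mul1r; apply=> c _; exact: cos_max.
Qed.

Lemma cosB1_le x : `|cos x - 1| <= `|x| ^+ 2.
Proof.
have := @mvt0 cos (fun x => - sin x) x `|x| (fun x => is_derive_cos x).
rewrite cos0 expr2; apply=> c cx; rewrite normrN; exact: (le_trans (sin_le _)).
Qed.

Lemma cosB1_le2 x : `|cos x - 1| <= `|x|.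
Proof.
have := @mvt0 cos (fun x => - sin x) x 1 (fun x => is_derive_cos x).
by rewrite cos0 mul1r; apply=> c cx; rewrite normrN sin_max.
Qed.

Lemma sinBx_le x : `|sin x - x| <= `|x| ^+ 2.
Proof.
have := @mvt0 (fun x => sin x - x) (fun x => cos x - 1) x `|x|.
rewrite sin0 !subr0 expr2; apply.
  by move=> c cx; exact: (le_trans (cosB1_le2 _)).
Qed.

(** Everything comes from [1 + x <= expR x]: taken at [- x] and multiplied by [expR x], it gives
    [expR x - 1 <= x * expR x]. *)
Lemma expRB1_le x : `|expR x - 1| <= `|x| * expR `|x|.
Proof.
have h1 := expR_ge1Dx x.
have h2 : expR x - 1 <= x * expR x.
  have := expR_ge1Dx (- x) => /(ler_wpM2l (expR_ge0 x)).
  by rewrite expRxMexpNx_1; lra.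
have h3 : 1 <= expR `|x| by rewrite -expR0 ler_expR.
have [x0|x0] := leP 0 x.
  by rewrite ger0_norm; [rewrite (ger0_norm x0)|lra].
rewrite ler0_norm; last by rewrite subr_le0 -expR0 ler_expR ltW.
by rewrite ltr0_norm// in h3 *; nra.
Qed.

Lemma expRB1x_le x : `|expR x - 1 - x| <= `|x| ^+ 2 * expR `|x|.
Proof.
have h1 := expR_ge1Dx x.
have h2 : expR x - 1 <= x * expR x.
  have := expR_ge1Dx (- x) => /(ler_wpM2l (expR_ge0 x)).
  by rewrite expRxMexpNx_1; lra.
have := expRB1_le x; move: h1 h2; set E := expR x => h1 h2 h3.
rewrite ger0_norm; last by lra.
apply: (@le_trans _ _ (`|x| * `|E - 1|)).
  by rewrite -normrM; apply: le_trans (ler_norm _); rewrite mulrBr mulr1; lra.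
by rewrite expr2 -mulrA ler_wpM2l.
Qed.

Lemma CexpD z w : Cexp (z + w) = Cexp z * Cexp w.
Proof.
apply: cplx_eq; rewrite ?ReM ?ImM /Cexp ?ReD ?ImD /= expRD.
  by rewrite cosD; ring.
by rewrite sinD; ring.
Qed.

Lemma Cexp0 : Cexp (0 : R[i]) = 1.
Proof. by apply: cplx_eq; rewrite /Cexp/= expR0 ?cos0 ?sin0 ?mulr0 ?mulr1. Qed.

Lemma Cexp_rc x : Cexp x%:C = (expR x)%:C.
Proof. by apply: cplx_eq; rewrite /Cexp/= ?cos0 ?sin0 ?mulr0 ?mulr1. Qed.

Lemma CexpJ z : Cexp (conjc z) = conjc (Cexp z).
Proof. by apply: cplx_eq; rewrite /Cexp !ReImE/= ?cosN ?sinN ?mulrN. Qed.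

Lemma normc_Cexp z : normc (Cexp z) = expR (Re z).
Proof.
apply/eqP; rewrite -(@eqrXn2 _ 2) ?normc_ge0 ?expR_ge0//; apply/eqP.
by rewrite normc_sq /Cexp /= !exprMn -mulrDr cos2Dsin2 mulr1.
Qed.

(** The real and imaginary parts contribute [2 * (r ^+ 2 * expR r)] each. The quadratic remainder is
    what later allows differentiation under the integral sign. *)
Lemma Cexp_taylor z :
  normc (Cexp z - 1 - z) <= 4 * normc z ^+ 2 * expR (normc z).
Proof.
have Rz := normc_Re z; have Iz := normc_Im z; set r := normc z in Rz Iz *.
have r0 : 0 <= r := normc_ge0 z.
set x := Re z in Rz *; set y := Im z in Iz *.
have Ex : expR `|x| <= expR r by rewrite ler_expR.
have E1 : 1 <= expR r by rewrite -expR0 ler_expR.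
have Ex' : expR x <= expR r by rewrite ler_expR (le_trans (ler_norm _)).
have Ex0 := expR_ge0 x; have Ea0 := expR_ge0 `|x|; have Er0 := expR_ge0 r.
have x2 : `|x| ^+ 2 <= r ^+ 2 by rewrite lerXn2r ?nnegrE.
have y2 : `|y| ^+ 2 <= r ^+ 2 by rewrite lerXn2r ?nnegrE.
have R1 : `|expR x * cos y - 1 - x| <= 2 * (r ^+ 2 * expR r).
  have -> : expR x * cos y - 1 - x = (expR x - 1 - x) + expR x * (cos y - 1) by ring.
  apply: le_trans (ler_normD _ _) _; rewrite normrM (ger0_norm Ex0) mulrDl mul1r lerD//.
    by apply: le_trans (expRB1x_le _) _; rewrite ler_pM ?sqr_ge0.
  by rewrite mulrC ler_pM// (le_trans (cosB1_le _)).
have I1 : `|expR x * sin y - y| <= 2 * (r ^+ 2 * expR r).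
  have -> : expR x * sin y - y = (expR x - 1) * sin y + (sin y - y) by ring.
  apply: le_trans (ler_normD _ _) _; rewrite normrM mulrDl mul1r lerD//.
    apply: (@le_trans _ _ ((r * expR r) * r)); last by rewrite mulrAC -expr2.
    rewrite ler_pM//; last exact: le_trans (sin_le _) _.
    by apply: le_trans (expRB1_le _) _; rewrite ler_pM.
  apply: le_trans (sinBx_le _) _; apply: le_trans y2 _.
  by rewrite ler_peMr// sqr_ge0.
apply: le_trans (normc_ReIm _) _.
rewrite /Cexp !ReImE/= -/x -/y oppr0 addr0.
have -> : 4 * r ^+ 2 * expR r = 2 * (r ^+ 2 * expR r) + 2 * (r ^+ 2 * expR r) by ring.
exact: lerD.
Qed.

End ComplexBasics.

(** * Wirtinger derivatives *)

Section Wirtinger.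
Variable R : realType.
Local Notation C := (R[i]).
Implicit Types (F G : C -> C) (p z w A B : C) (e d x y : R).
Local Notation "r %:C" := (real_complex R r).

(* [A] and [B] are the Wirtinger derivatives of [F] at [p], in the sense of
   total real differentiability. *)
Definition wirt F p A B := forall e, 0 < e -> exists2 d, 0 < d &
  forall z, normc (z - p) < d ->
    normc (F z - F p - A * (z - p) - B * conjc (z - p)) <= e * normc (z - p).

Lemma wirt_lip F p A B : wirt F p A B -> exists2 c : R, 0 < c &
  exists2 d, 0 < d & forall z, normc (z - p) < d ->
    normc (F z - F p) <= c * normc (z - p).
Proof.
move=> /(_ 1 ltr01)[d d0 H]; exists (normc A + normc B + 1).
  by rewrite ltr_wpDl// addr_ge0// normc_ge0.
exists d => // z zd.
have -> : F z - F p = (F z - F p - A * (z - p) - B * conjc (z - p)) + A * (z - p) + B * conjc (z - p) by ring.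
apply: le_trans (normcD _ _) _; rewrite normcM normcJ.
apply: le_trans (lerD (normcD _ _) (lexx _)) _; rewrite normcM.
by have := H _ zd; lra.
Qed.

Lemma wirt_cont F p A B : wirt F p A B -> forall e, 0 < e -> exists2 d, 0 < d &
  forall z, normc (z - p) < d -> normc (F z - F p) < e.
Proof.
move=> /wirt_lip[c c0 [d d0 H]] e e0; exists (Num.min d (e / c)).
  by rewrite lt_min d0 divr_gt0.
move=> z; rewrite lt_min => /andP[zd ze]; apply: le_lt_trans (H _ zd) _.
by rewrite mulrC -ltr_pdivlMr.
Qed.

(** The error splits into the remainder of each factor times the value of the other, plus the
    product of the two increments, which is quadratic by [wirt_lip]; each part receives [e / 3]. *)
Lemma wirtM F G p A B A' B' : wirt F p A B -> wirt G p A' B' ->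
  wirt (fun z => F z * G z) p (A * G p + F p * A') (B * G p + F p * B').
Proof.
move=> dF dG e e0.
have [cF cF0 [d1 d10 LF]] := wirt_lip dF.
have [cG cG0 [d2 d20 LG]] := wirt_lip dG.
pose e1 := e / 3 / (normc (G p) + 1); pose e2 := e / 3 / (normc (F p) + 1).
have G1 : 0 < normc (G p) + 1 by rewrite ltr_wpDl ?normc_ge0.
have F1 : 0 < normc (F p) + 1 by rewrite ltr_wpDl ?normc_ge0.
have e10 : 0 < e1 by rewrite !divr_gt0.
have e20 : 0 < e2 by rewrite !divr_gt0.
have [d3 d30 HF] := dF _ e10; have [d4 d40 HG] := dG _ e20.
pose d5 := e / 3 / (cF * cG).
have d50 : 0 < d5 by rewrite !divr_gt0// mulr_gt0.
exists (Num.min (Num.min d1 d2) (Num.min d3 (Num.min d4 d5))).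
  by rewrite !lt_min d10 d20 d30 d40 d50.
move=> z; rewrite !lt_min => /andP[/andP[z1 z2] /and3P[z3 z4 z5]].
have -> : F z * G z - F p * G p - (A * G p + F p * A') * (z - p) -
   (B * G p + F p * B') * conjc (z - p) =
   (F z - F p - A * (z - p) - B * conjc (z - p)) * G p +
   F p * (G z - G p - A' * (z - p) - B' * conjc (z - p)) +
   (F z - F p) * (G z - G p) by ring.
apply: le_trans (normcD _ _) _.
apply: le_trans (lerD (normcD _ _) (lexx _)) _.
rewrite !normcM; set r := normc (z - p).
have r0 : 0 <= r := normc_ge0 _.
have -> : e * r = e / 3 * r + e / 3 * r + e / 3 * r by field.
apply: lerD; first apply: lerD.
- apply: (@le_trans _ _ (e1 * r * (normc (G p) + 1))).
    by rewrite ler_pM ?normc_ge0 ?HF// lerDl.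
  by rewrite mulrAC divfK ?gt_eqF.
- apply: (@le_trans _ _ ((normc (F p) + 1) * (e2 * r))).
    by rewrite ler_pM ?normc_ge0 ?HG// lerDl.
  by rewrite mulrA [X in X * r]mulrC divfK ?gt_eqF.
- apply: (@le_trans _ _ ((cF * r) * (cG * r))).
    by rewrite ler_pM ?normc_ge0 ?LF ?LG.
  have -> : cF * r * (cG * r) = (cF * cG * r) * r by ring.
  rewrite ler_wpM2r//; move: z5; rewrite -/r /d5 ltr_pdivlMr ?mulr_gt0// => /ltW.
  by rewrite mulrC.
Qed.

Lemma wirt_cst c p : wirt (fun=> c) p 0 0.
Proof.
move=> e e0; exists 1 => // z _.
by rewrite !mul0r !subr0 subrr normc0 mulr_ge0 ?normc_ge0// ltW.
Qed.

Lemma wirtB F p A B c : wirt F p A B -> wirt (fun z => F z - c) p A B.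
Proof.
move=> H e e0; have [d d0 {}H] := H _ e0; exists d => // z zd.
have -> : F z - c - (F p - c) = F z - F p by ring.
exact: H.
Qed.

Lemma wirt_comp F G p A B A' : wirt F p A B -> wirt G (F p) A' 0 ->
  wirt (G \o F) p (A' * A) (A' * B).
Proof.
move=> dF dG e e0.
have [c c0 [d1 d10 L]] := wirt_lip dF.
have [d2 d20 HG] := dG (e / 2 / c) (divr_gt0 (divr_gt0 e0 (ltr0Sn R 1)) c0).
have A1 : 0 < normc A' + 1 by rewrite ltr_wpDl ?normc_ge0.
have [d3 d30 HF] := dF (e / 2 / (normc A' + 1)) (divr_gt0 (divr_gt0 e0 (ltr0Sn R 1)) A1).
exists (Num.min (Num.min d1 d3) (d2 / c)); first by rewrite !lt_min d10 d30 divr_gt0.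
move=> z; rewrite !lt_min => /andP[/andP[z1 z3] z2] /=.
have Fz : normc (F z - F p) < d2.
  by apply: le_lt_trans (L _ z1) _; rewrite mulrC -ltr_pdivlMr.
have -> : G (F z) - G (F p) - A' * A * (z - p) - A' * B * conjc (z - p) =
   (G (F z) - G (F p) - A' * (F z - F p) - 0 * conjc (F z - F p)) +
   A' * (F z - F p - A * (z - p) - B * conjc (z - p)) by ring.
apply: le_trans (normcD _ _) _; rewrite normcM.
set r := normc (z - p).
have -> : e * r = e / 2 * r + e / 2 * r by field.
apply: lerD.
- apply: le_trans (HG _ Fz) _.
  apply: (@le_trans _ _ (e / 2 / c * (c * r))).
    by rewrite ler_wpM2l ?L// !divr_ge0// ltW.
  by rewrite mulrA divfK ?gt_eqF.
- apply: (@le_trans _ _ ((normc A' + 1) * (e / 2 / (normc A' + 1) * r))).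
    by rewrite ler_pM ?normc_ge0 ?HF// lerDl.
  by rewrite mulrA [X in X * r]mulrC divfK ?gt_eqF.
Qed.

(** The norm of [R[i]^o] takes its values in [R[i]], so radii and tolerances are complex numbers
    that are positive for the partial order, hence real; they are carried over to [R] by
    [complex.Re]. *)
Lemma entireP f : entire f <-> forall z, exists A, wirt f z A 0.
Proof.
split => [ef z|H z].
- have /cvg_ex[A] := ef z; rewrite /= => /cvgrPdist_lt H.
  exists A => e e0; have e0' : (0 : C) < e%:C by rewrite ltcR.
  have /nbhs_ballP[d /= d0 {}H] := H _ e0'.
  have Ed : d = (complex.Re d)%:C by rewrite RRe_real// gtr0_real.
  have d0' : 0 < complex.Re d by move: d0; rewrite [X in 0 < X]Ed ltcR.
  exists (complex.Re d) => // w wz; rewrite mul0r subr0.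
  have [->|nwz] := eqVneq w z; first by rewrite !subrr mulr0 subrr normc0 mulr0.
  have nwz' : w - z != 0 by rewrite subr_eq0.
  have B0 : ball (0 : C^o) d (w - z).
    rewrite -ball_normE /ball_ /= sub0r normrN [X in _ < X]Ed.
    by change ((normc (w - z))%:C < (complex.Re d)%:C); rewrite ltcR.
  have := H _ B0 nwz'.
  have -> : ((w - z) *: (1 : C^o)) = w - z by rewrite /GRing.scale/= mulr1.
  rewrite /GRing.scale /= subrK => h.
  have {}h : normc (A - (w - z)^-1 * (f w - f z)) < e by rewrite -ltcR.
  have -> : f w - f z - A * (w - z) = - ((A - (w - z)^-1 * (f w - f z)) * (w - z)).
    by field.
  by rewrite normcN normcM ler_wpM2r ?normc_ge0// ltW.
- have [A HA] := H z; apply/cvg_ex; exists A; apply/cvgrPdist_lt => /= e e0.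
  have Ee : e = (complex.Re e)%:C by rewrite RRe_real// gtr0_real.
  have e0' : 0 < complex.Re e by move: e0; rewrite [X in 0 < X]Ee ltcR.
  have [d d0 {}HA] := HA _ (divr_gt0 e0' ((ltr0Sn R 1) : 0 < 2)).
  apply/nbhs_ballP; exists d%:C => /=; first by rewrite ltcR.
  move=> h; rewrite -ball_normE /ball_ /= sub0r normrN => hd h0.
  have {}hd : normc h < d by rewrite -ltcR.
  have -> : (h *: (1 : C^o)) = h by rewrite /GRing.scale/= mulr1.
  rewrite /GRing.scale /=.
  have := HA (h + z); rewrite addrK mul0r subr0 => /(_ hd) {}HA.
  have -> : A - h^-1 * (f (h + z) - f z) = - (h^-1 * (f (h + z) - f z - A * h)) by field.
  rewrite [X in _ < X]Ee; change ((normc (- (h^-1 * (f (h + z) - f z - A * h))))%:C < (complex.Re e)%:C).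
  rewrite ltcR normcN normcM Normc.normcV mulrC ltr_pdivrMr ?normc_gt0//.
  apply: le_lt_trans HA _; rewrite ltr_pM2r ?normc_gt0//; lra.
Qed.

Lemma entire_cont f z : entire f -> forall e, 0 < e -> exists2 d, 0 < d &
  forall w, normc (w - z) < d -> normc (f w - f z) < e.
Proof. by move=> /entireP/(_ z)[A]; exact: wirt_cont. Qed.

Lemma wirt_Cexp p : wirt (@Cexp R) p (Cexp p) 0.
Proof.
move=> e e0.
pose M := 4 * normc (Cexp p) * expR 1 + 1.
have M0 : 0 < M by rewrite ltr_wpDl// !mulr_ge0// ?normc_ge0 ?expR_ge0.
exists (Num.min 1 (e / M)); first by rewrite lt_min ltr01 divr_gt0.
move=> z; rewrite lt_min => /andP[z1 z2].
have -> : Cexp z - Cexp p - Cexp p * (z - p) - 0 * conjc (z - p) =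
   Cexp p * (Cexp (z - p) - 1 - (z - p)).
  have -> : Cexp z = Cexp p * Cexp (z - p) by rewrite -CexpD addrC subrK.
  by ring.
rewrite normcM; set r := normc (z - p) in z1 z2 *.
have r0 : 0 <= r := normc_ge0 _.
apply: le_trans (ler_wpM2l (normc_ge0 _) (Cexp_taylor _)) _; rewrite -/r.
apply: (@le_trans _ _ (M * r * r)); last first.
  by rewrite ler_wpM2r// mulrC -ler_pdivlMr// ltW.
have E1 : expR r <= expR 1 by rewrite ler_expR ltW.
have nc := normc_ge0 (Cexp p); have er := expR_ge0 r.
apply: (@le_trans _ _ (normc (Cexp p) * (4 * r ^+ 2 * expR 1))).
  by rewrite ler_wpM2l// ler_wpM2l// mulr_ge0// sqr_ge0.
by rewrite /M; have := sqr_ge0 r; nra.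
Qed.

Lemma wirt_inv c p : p != c -> wirt (fun w => (w - c)^-1) p (- ((p - c)^-1) ^+ 2) 0.
Proof.
move=> pc e e0; have pc' : p - c != 0 by rewrite subr_eq0.
set m := normc (p - c); have m0 : 0 < m by rewrite normc_gt0.
(* The first radius keeps [w] at distance at least [m / 2] from the pole; with it, the second gives
   [normc (w - p) <= e * m ^+ 2 * normc (w - c)]. *)
exists (Num.min (m / 2) (e * m ^+ 3 / 2)).
  by rewrite lt_min !divr_gt0// mulr_gt0// exprn_gt0.
move=> w; rewrite lt_min => /andP[w1 w2].
have wm : m / 2 <= normc (w - c).
  by have := normc_tri p w c; rewrite (normcC p w) -/m; lra.
have wc : w - c != 0 by rewrite -normc_gt0; lra.
have -> : (w - c)^-1 - (p - c)^-1 - - (p - c)^-1 ^+ 2 * (w - p) - 0 * conjc (w - p) =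
  (w - p) * (w - p) * ((p - c)^-1 ^+ 2 * (w - c)^-1) by field; apply/andP.
rewrite [(p - c)^-1 ^+ 2]expr2 !normcM !Normc.normcV -/m mulrAC ler_wpM2r ?normc_ge0//.
set r := normc (w - p) in w1 w2 *.
have r0 : 0 <= r := normc_ge0 _.
rewrite -!invfM ler_pdivrMr ?mulr_gt0//; last by lra.
have := ltW w2; rewrite ler_pdivlMr//.
have m2 : 0 < m ^+ 2 by rewrite exprn_gt0.
rewrite exprS => h.
have : e * (m * m) * (m / 2) <= e * (m * m) * normc (w - c).
  by rewrite ler_wpM2l// !mulr_ge0 ?ltW.
by move: h; rewrite expr2; nra.
Qed.

Lemma is_derive_approx (f : R -> R) x df : is_derive x (1:R) f df ->
  forall e, 0 < e -> exists2 d, 0 < d & forall y, `|y - x| < d ->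
    `|f y - f x - df * (y - x)| <= e * `|y - x|.
Proof.
move=> [/cvg_ex[l /= fl] fE] e e0.
have El : l = df by rewrite -fE; apply/esym/cvg_lim.
move/cvgrPdist_lt: fl => /(_ e e0)/nbhs_ballP[d /= d0 H]; exists d => // y yx.
have [->|nyx] := eqVneq y x; first by rewrite !subrr mulr0 subrr normr0 mulr0.
have nyx' : y - x != 0 by rewrite subr_eq0.
have B0 : ball (0 : R) d (y - x) by rewrite -ball_normE /ball_ /= sub0r normrN.
have := H _ B0 nyx'; rewrite /GRing.scale /= mulr1 subrK El => h.
have -> : f y - f x - df * (y - x) = - ((df - (y - x)^-1 * (f y - f x)) * (y - x)) by field.
by rewrite normrN normrM ler_wpM2r// ltW.
Qed.

(** With [a = p - c] and [k = w - p], the increment of the squared modulus is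
    [conjc a * k + a * conjc k + normc k ^+ 2], whence the two coefficients by the chain rule. *)
Lemma wirt_radial (eta : R -> R) c p deta :
  is_derive (normc (p - c) ^+ 2) (1:R) eta deta ->
  wirt (fun w => (eta (normc (w - c) ^+ 2))%:C) p
    (deta%:C * conjc (p - c)) (deta%:C * (p - c)).
Proof.
move=> /is_derive_approx H e e0.
set m := normc (p - c); have m0 : 0 <= m := normc_ge0 _.
have K0 : 0 < 2 * m + 1 by lra.
have [d d0 {}H] := H (e / 2 / (2 * m + 1)) (divr_gt0 (divr_gt0 e0 (ltr0Sn R 1)) K0).
have D0 : 0 < `|deta| + 1 by rewrite ltr_wpDl.
exists (Num.min (Num.min 1 (d / (2 * m + 1))) (e / 2 / (`|deta| + 1))).
  by rewrite !lt_min !divr_gt0 ?ltr01.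
move=> w; rewrite !lt_min => /andP[/andP[w1 w2] w3].
set r := normc (w - p) in w1 w2 w3 *; have r0 : 0 <= r := normc_ge0 _.
have E : normc (w - c) ^+ 2 - m ^+ 2 =
    2 * complex.Re (conjc (p - c) * (w - p)) + r ^+ 2.
  have -> : w - c = (w - p) + (p - c) by ring.
  by rewrite /m /r !normc_sq !(ReM,ImM,ReJ,ImJ,ReD,ImD); ring.
have Eb : `|normc (w - c) ^+ 2 - m ^+ 2| <= (2 * m + 1) * r.
  rewrite E; apply: le_trans (ler_normD _ _) _.
  rewrite normrM (ger0_norm (ler0n _ 2)) (ger0_norm (sqr_ge0 r)).
  have := normc_Re (conjc (p - c) * (w - p)); rewrite normcM normcJ -/m -/r.
  by nra.
have Ed : `|normc (w - c) ^+ 2 - m ^+ 2| < d.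
  by apply: le_lt_trans Eb _; rewrite mulrC -ltr_pdivlMr.
have {}H := H _ Ed.
set S := normc (w - c) ^+ 2 in E Eb Ed H *; set S0 := m ^+ 2 in E Eb Ed H *.
have -> : (eta S)%:C - (eta S0)%:C - deta%:C * conjc (p - c) * (w - p) -
    deta%:C * (p - c) * conjc (w - p) =
    (eta S - eta S0 - deta * (S - S0))%:C + (deta * r ^+ 2)%:C.
  by rewrite E; apply: cplx_eq; rewrite !ReImE; ring.
apply: le_trans (normcD _ _) _; rewrite !normc_rc.
have -> : e * r = e / 2 * r + e / 2 * r by field.
apply: lerD.
- apply: le_trans H _.
  apply: (@le_trans _ _ (e / 2 / (2 * m + 1) * ((2 * m + 1) * r))).
    by rewrite ler_wpM2l// !divr_ge0// ltW.
  by rewrite mulrA divfK ?gt_eqF.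
- rewrite normrM (ger0_norm (sqr_ge0 r)) expr2 mulrA ler_wpM2r//.
  have := ltW w3; rewrite ler_pdivlMr// => h.
  by have := normr_ge0 deta; nra.
Qed.

End Wirtinger.

(** * Subdivision and Gronwall's inequality *)

Section Cousin.
Variable R : realType.
Implicit Types (a c l x y : R).

Lemma exp2_small (l d : R) : 0 < d -> exists n : nat, l / 2 ^+ n < d.
Proof.
move=> d0; have [n ln] : exists n : nat, l / d < n%:R.
  by exists (Num.truncn (l / d)).+1; exact: truncnS_gt.
exists n; rewrite ltr_pdivrMr ?exprn_gt0// mulrC -ltr_pdivrMr//.
apply: lt_le_trans ln _; rewrite -natrX ler_nat; exact/ltnW/ltn_expl.
Qed.

(* Nested squares: a property of squares that passes from the four quarters to
   the whole and holds for all small squares around each point holds for all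
   squares. *)
Lemma square_cousin (P : R -> R -> R -> Prop) :
  (forall a c l, 0 < l -> P a c l -> P (a + l) c l -> P a (c + l) l ->
     P (a + l) (c + l) l -> P a c (l + l)) ->
  (forall x y, exists2 d, 0 < d & forall a c l, 0 < l -> l < d ->
     a <= x <= a + l -> c <= y <= c + l -> P a c l) ->
  forall a c l, 0 < l -> P a c l.
Proof.
move=> Psplit Ploc a0 c0 l0 l00; apply: contrapT => nP.
pose l_ (n : nat) := l0 / 2 ^+ n.
have l_gt0 n : 0 < l_ n by rewrite divr_gt0// exprn_gt0.
have l_S n : l_ n = l_ n.+1 + l_ n.+1.
  by rewrite /l_ exprS; field; rewrite expf_neq0.
pose good n (q q' : R * R) := [/\ ~ P q'.1 q'.2 (l_ n.+1),
   q.1 <= q'.1 /\ q'.1 + l_ n.+1 <= q.1 + l_ n &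
   q.2 <= q'.2 /\ q'.2 + l_ n.+1 <= q.2 + l_ n].
have step n q : ~ P q.1 q.2 (l_ n) -> exists q', good n q q'.
  have lS := l_S n; have lg := l_gt0 n.+1.
  move=> nPq; apply: contrapT => H; apply: nPq; rewrite lS.
  have key a c : q.1 <= a -> a + l_ n.+1 <= q.1 + l_ n -> q.2 <= c ->
      c + l_ n.+1 <= q.2 + l_ n -> P a c (l_ n.+1).
    by move=> *; apply: contrapT => nPq; apply: H; exists (a, c).
  by apply: Psplit => //; apply: key; lra.
(* The [else] branch is a default value; by [sP] it is never taken along the sequence [s]. *)
pose next n q := if pselect (~ P q.1 q.2 (l_ n)) is left h
   then projT1 (cid (step n q h)) else q.
pose s := fix s n := if n is m.+1 then next m (s m) else (a0, c0).
have sP n : ~ P (s n).1 (s n).2 (l_ n).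
  elim: n => [|n IH] /=; first by rewrite /l_ expr0 divr1.
  rewrite /next; case: pselect => //= h.
  by case: (cid _) => /= q' [].
have sg n : good n (s n) (s n.+1).
  rewrite /= /next; case: pselect => [h|/(_ (sP n))//].
  by case: (cid _).
(* Nested intervals: the supremum of the left ends lies in all of them. *)
have mono (u : nat -> R) (v : nat -> R) :
   (forall n, u n <= u n.+1 /\ u n.+1 + v n.+1 <= u n + v n) -> (forall n, 0 < v n) ->
   exists x, forall n, u n <= x <= u n + v n.
  move=> uv v0.
  have uh n k : u n <= u (n + k)%N.
    elim: k => [|k IH]; first by rewrite addn0.
    by apply: le_trans IH _; rewrite addnS; have [] := uv (n + k)%N.
  have vh n k : u (n + k)%N + v (n + k)%N <= u n + v n.
    elim: k => [|k IH]; first by rewrite addn0.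
    by apply: le_trans IH; rewrite addnS; have [] := uv (n + k)%N.
  have ub n m : u m <= u n + v n.
    have [/subnKC E|/ltnW/subnKC E] := leqP m n.
      apply: (@le_trans _ _ (u n)); first by rewrite -E.
      by rewrite lerDl ltW.
    apply: le_trans (vh n (m - n)%N); rewrite E lerDl ltW//.
  have hs : has_sup (range u).
    split; first by exists (u 0%N); exists 0%N.
    by exists (u 0%N + v 0%N) => _ [m _ <-].
  exists (sup (range u)) => n; apply/andP; split.
    by apply: ub_le_sup; [case: hs|exists n].
  by apply: ge_sup; [case: hs|move=> _ [m _ <-]].
have [x Hx] : exists x, forall n, (s n).1 <= x <= (s n).1 + l_ n.
  by apply: (mono (fun n => (s n).1)) => // n; have [] := sg n.
have [y Hy] : exists y, forall n, (s n).2 <= y <= (s n).2 + l_ n.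
  by apply: (mono (fun n => (s n).2)) => // n; have [] := sg n.
have [d d0 H] := Ploc x y.
have [n nd] := exp2_small l0 d0.
by apply: (sP n); exact: H.
Qed.

(** The planar statement, for a property that ignores the second coordinate. *)
Lemma interval_cousin (P : R -> R -> Prop) :
  (forall s m t, s <= m -> m <= t -> P s m -> P m t -> P s t) ->
  (forall x, exists2 d, 0 < d & forall s t, s <= x <= t -> t - s < d -> P s t) ->
  forall s t, s < t -> P s t.
Proof.
move=> Ptr Ploc s t st.
have := @square_cousin (fun a _ l => P a (a + l)) _ _ s 0 (t - s).
rewrite subr_gt0 st [s + _]addrC subrK; apply => //.
- move=> a _ l l0 h1 h2 _ _; rewrite addrA; apply: (Ptr _ _ _ _ _ h1 h2); lra.
- move=> x y; have [d d0 H] := Ploc x; exists d => // a _ l l0 ld axl _.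
  by apply: H => //; lra.
Qed.

(** A bound by [e * (r - s)] on intervals straddling a point is additive under subdivision, so it
    passes to the whole interval; then [e] tends to [0]. Requiring [s <= t <= r] lets both one-sided
    increments at [t] be used. *)
Lemma straddle (phi : R -> R) (a b : R) : a <= b ->
  (forall t, a <= t <= b -> forall e, 0 < e -> exists2 d, 0 < d &
     forall s r, a <= s -> s <= t -> t <= r -> r <= b -> r - s < d ->
       phi r - phi s <= e * (r - s)) ->
  phi b <= phi a.
Proof.
rewrite le_eqVlt => /predU1P[->//|ab] H.
rewrite -subr_le0; apply/ler_addgt0Pr => e e0; rewrite add0r.
have ba : 0 < b - a by rewrite subr_gt0.
have e'0 : 0 < e / (b - a) by rewrite divr_gt0.
have := @interval_cousin (fun s r => a <= s -> r <= b ->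
   phi r - phi s <= e / (b - a) * (r - s)) _ _ a b ab (lexx _) (lexx _).
rewrite divfK ?gt_eqF//; apply.
- move=> s m t sm mt h1 h2 as_ tb.
  have := h1 as_ (le_trans mt tb); have := h2 (le_trans as_ sm) tb; lra.
- move=> x; have [/andP[ax xb]|nx] := boolP (a <= x <= b).
    have [|d d0 {}H] := H x _ _ e'0; first by rewrite ax.
    by exists d => // s t /andP[sx xt] ts as_ tb; exact: H.
  exists 1 => // s t /andP[sx xt] _ as_ tb; exfalso; move/negP: nx; apply.
  by rewrite (le_trans as_ sx) (le_trans xt tb).
Qed.

(** [straddle] applies to [phi t - L * t], and to the same expression for [- phi]. The hypothesis
    bounds increments without asking for a derivative, because [phi] will be the norm of a curve. *)
Lemma mean_value_le (phi : R -> R) (a b L : R) : a <= b ->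
  (forall t, a <= t <= b -> forall e, 0 < e -> exists2 d, 0 < d &
     forall h, `|h| < d -> `|phi (t + h) - phi t| <= `|h| * (L + e)) ->
  `|phi b - phi a| <= L * (b - a).
Proof.
move=> ab H.
have key (psi : R -> R) : (forall t, a <= t <= b -> forall e, 0 < e -> exists2 d, 0 < d &
     forall h, `|h| < d -> `|psi (t + h) - psi t| <= `|h| * (L + e)) ->
     psi b - psi a <= L * (b - a).
  move=> {}H; suff : psi b - L * b <= psi a - L * a by lra.
  apply: (@straddle (fun t => psi t - L * t)) => // t tab e e0.
  have [d d0 {}H] := H t tab e e0; exists d => // s r _ st tr _ rsd.
  have h1 : psi r - psi t <= (r - t) * (L + e).
    have := H (r - t); rewrite ger0_norm ?subr_ge0// (_ : t + (r - t) = r); last by ring.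
    move=> H1.
    by apply: le_trans (ler_norm _) _; apply: H1; lra.
  have h2 : psi t - psi s <= (t - s) * (L + e).
    have := H (s - t); rewrite ler0_norm ?subr_le0// opprB (_ : t + (s - t) = s); last by ring.
    move=> H1.
    by apply: le_trans (ler_norm _) _; rewrite distrC; apply: H1; lra.
  lra.
rewrite ler_norml; apply/andP; split; last exact: key.
have := key (fun t => - phi t); rewrite -opprB lerNl opprK => K.
rewrite [phi b - _]addrC; apply: K.
move=> t tab e e0; have [d d0 {}H] := H t tab e e0; exists d => // h hd.
by rewrite -opprD normrN; exact: H.
Qed.

(** The product [expR (- (2 * K * t)) * phi t] is shown not to increase. With the rate [2 * K] in
    place of [K], the two inequalities [1 + K * h <= expR (2 * K * h)] and, for [2 * K * h <= 1],
    [1 <= expR (2 * K * h) * (1 - K * h)] follow at once from [1 + x <= expR x]; the factor 2 of the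
    conclusion comes from here. *)
Lemma gronwall_pos (phi : R -> R) (K t : R) : 0 <= K -> 0 <= t ->
  (forall t, 0 <= phi t) ->
  (forall t, forall e, 0 < e -> exists2 d, 0 < d &
     forall h, `|h| < d -> `|phi (t + h) - phi t| <= `|h| * (K * phi t + e)) ->
  phi t <= phi 0 * expR (2 * K * t).
Proof.
move=> K0 t0 phi0 H.
suff : expR (- (2 * K * t)) * phi t <= expR (- (2 * K * 0)) * phi 0.
  rewrite mulr0 oppr0 expR0 mul1r => /(ler_wpM2r (expR_ge0 (2 * K * t))).
  by rewrite mulrAC [expR _ * expR _]mulrC expRxMexpNx_1 mul1r.
apply: (@straddle (fun t => expR (- (2 * K * t)) * phi t)) => // x _ e e0.
pose E := expR (- (2 * K * x)); have E0 : 0 < E := expR_gt0 _.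
have E1 : 1 < expR 1 :> R by rewrite -expR0 ltr_expR.
(* [E] is the weight at [x], and [expR 1] bounds its growth when moving to the left of [x]. *)
have e'0 : 0 < e / (E * expR 1) by rewrite divr_gt0// mulr_gt0// expR_gt0.
have [d d0 {}H] := H x _ e'0.
(* The second radius ensures [2 * (K * h) <= 1] to the left of [x]; the [+ 1] covers [K = 0]. *)
exists (Num.min d (2 * (K + 1))^-1); first by rewrite lt_min d0 invr_gt0; lra.
move=> s r _ sx xr _; rewrite lt_min => /andP[rsd rsK].
have KK : 0 < 2 * (K + 1) by lra.
have rsK' : (r - s) * (2 * (K + 1)) < 1 by rewrite -ltr_pdivlMr// div1r.
have h1 : expR (- (2 * K * r)) * phi r - E * phi x <= e * (r - x).
  pose h := r - x; have h0 : 0 <= h by rewrite /h subr_ge0.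
  have -> : - (2 * K * r) = - (2 * K * x) + - (2 * K * h) by rewrite /h; ring.
  rewrite expRD -/E -mulrA -mulrBr -/h.
  have := H h; rewrite ger0_norm// (_ : x + h = r) => [H1|]; last by rewrite /h; ring.
  have {}H1 : phi r - phi x <= h * (K * phi x + e / (E * expR 1)).
    by apply: le_trans (ler_norm _) _; apply: H1; rewrite /h; lra.
  set q := expR (- (2 * K * h)).
  have q0 : 0 < q := expR_gt0 _.
  have q1 : q * (1 + K * h) <= 1.
    rewrite -[leRHS](@expRxMexpNx_1 _ (2 * K * h)) mulrC ler_pM2r//.
    apply: le_trans (expR_ge1Dx _); have := mulr_ge0 K0 h0; lra.
  have q2 : q <= 1 by rewrite -expR0 ler_expR oppr_le0 !mulr_ge0.
  have px := phi0 x.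
  have : q * phi r - phi x <= h * (e / (E * expR 1)).
    set e' := e / _ in e'0 H1 *.
    have : q * phi r <= q * (phi x + h * (K * phi x + e')) by rewrite ler_pM2l//; lra.
    have : q * (1 + K * h) * phi x <= phi x by rewrite ler_piMl.
    have : q * (h * e') <= h * e' by rewrite ler_piMl// mulr_ge0// ltW.
    lra.
  move=> /(ler_wpM2l (ltW E0))/le_trans; apply.
  have -> : E * (h * (e / (E * expR 1))) = e * h / expR 1.
    by field; rewrite !gt_eqF// expR_gt0.
  by rewrite ler_pdivrMr ?expR_gt0// ler_peMr ?mulr_ge0// ?(ltW e0)// ltW.
have h2 : E * phi x - expR (- (2 * K * s)) * phi s <= e * (x - s).
  pose h := x - s; have h0 : 0 <= h by rewrite /h subr_ge0.
  have -> : - (2 * K * s) = - (2 * K * x) + 2 * K * h by rewrite /h; ring.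
  rewrite expRD -/E -mulrA -mulrBr -/h.
  have := H (- h); rewrite normrN ger0_norm// (_ : x - h = s) => [H1|]; last by rewrite /h; ring.
  have {}H1 : phi x - phi s <= h * (K * phi x + e / (E * expR 1)).
    apply: le_trans (ler_norm _) _; rewrite distrC.
    by apply: H1; rewrite /h; lra.
  set q := expR (2 * K * h).
  have q0 : 0 < q := expR_gt0 _.
  have Kh0 := mulr_ge0 K0 h0.
  have Kh : 2 * (K * h) <= 1 by rewrite /h; nra.
  have q1 : 1 <= q * (1 - K * h).
    have := expR_ge1Dx (2 * K * h); rewrite -/q => q1.
    apply: (@le_trans _ _ ((1 + 2 * K * h) * (1 - K * h))); first by nra.
    by rewrite ler_wpM2r//; lra.
  have q2 : q <= expR 1 by rewrite ler_expR; lra.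
  have px := phi0 x.
  have : phi x - q * phi s <= h * (e / E).
    have -> : h * (e / E) = expR 1 * (h * (e / (E * expR 1))).
      by field; rewrite !gt_eqF// expR_gt0.
    set e' := e / _ in e'0 H1 *.
    have : q * (phi x - h * (K * phi x + e')) <= q * phi s by rewrite ler_pM2l//; lra.
    have : phi x <= q * (1 - K * h) * phi x by rewrite ler_peMl.
    have : q * (h * e') <= expR 1 * (h * e') by rewrite ler_wpM2r// mulr_ge0// ltW.
    lra.
  move=> /(ler_wpM2l (ltW E0))/le_trans; apply.
  have -> : E * (h * (e / E)) = e * h by field; rewrite gt_eqF.
  by [].
lra.
Qed.

Lemma gronwall (phi : R -> R) (K t : R) : 0 <= K ->
  (forall t, 0 <= phi t) ->
  (forall t, forall e, 0 < e -> exists2 d, 0 < d &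
     forall h, `|h| < d -> `|phi (t + h) - phi t| <= `|h| * (K * phi t + e)) ->
  phi t <= phi 0 * expR (2 * K * `|t|).
Proof.
move=> K0 phi0 H; have [t0|t0] := leP 0 t; first by rewrite ger0_norm//; exact: (gronwall_pos K0 t0 phi0 H).
have := @gronwall_pos (fun t => phi (- t)) K (- t) K0 _ (fun t => phi0 _).
rewrite opprK oppr0 ltr0_norm//; apply; first by rewrite oppr_ge0 ltW.
move=> x e e0; have [d d0 {}H] := H (- x) e e0; exists d => // h hd.
by rewrite opprD -(normrN h); apply: H; rewrite normrN.
Qed.

End Cousin.

(** * The divergence theorem *)

Section Divergence.
Variable R : realType.
Local Notation mu := (@lebesgue_measure R).
Implicit Types (a c l x y e d : R).

Lemma integrable_cst_fin (dd : measure_display) (T : measurableType dd)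
  (nu : {measure set T -> \bar R}) (D : set T) (r : R) :
  measurable D -> (nu D < +oo)%E -> nu.-integrable D (EFin \o cst r).
Proof.
move=> mD fD; apply/integrableP; split; first exact/measurable_EFinP/measurable_cst.
under eq_integral do rewrite /=.
by rewrite integral_cst//= lte_mul_pinfty ?lee_fin.
Qed.

Lemma Rintegral_near (dd : measure_display) (T : measurableType dd)
  (nu : {measure set T -> \bar R}) (D : set T) (f : T -> R) (r e m : R) :
  measurable D -> nu D = m%:E -> nu.-integrable D (EFin \o f) ->
  (forall p, D p -> `|f p - r| <= e) ->
  `|\int[nu]_(x in D) f x - r * m| <= e * m.
Proof.
move=> mD Dm fi fr.
have Df : (nu D < +oo)%E by rewrite Dm ltry.
have ci s : nu.-integrable D (EFin \o cst s) by exact: integrable_cst_fin.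
have Es s : \int[nu]_(x in D) s = s * m by rewrite Rintegral_cst// Dm.
rewrite -!Es -RintegralB//; last exact: (ci r).
have bi : nu.-integrable D (EFin \o (fun p => f p - r)) by exact: (integrableB mD fi (ci r)).
apply: le_trans (le_normr_Rintegral mD bi) _.
by apply: le_Rintegral => //; [exact: (integrable_norm bi)|exact: (ci e)].
Qed.

Definition total_derive (X : R -> R -> R) x0 y0 x1 x2 :=
  forall e, 0 < e -> exists2 d, 0 < d & forall x y, `|x - x0| < d -> `|y - y0| < d ->
    `|X x y - X x0 y0 - x1 * (x - x0) - x2 * (y - y0)| <= e * (`|x - x0| + `|y - y0|).

(** Continuity along lines parallel to the axes makes the integrals over the sides of a square
    meaningful. *)
Lemma continuous_of_total (X : R -> R -> R) :
  (forall x0 y0, exists x1 x2, total_derive X x0 y0 x1 x2) ->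
  (forall b, continuous (fun y => X b y)) /\ (forall b, continuous (fun x => X x b)).
Proof.
move=> H.
have key (f : R -> R) y0 x2 : (forall e, 0 < e -> exists2 d, 0 < d &
    forall y, `|y - y0| < d -> `|f y - f y0 - x2 * (y - y0)| <= e * `|y - y0|) ->
    f @ y0 --> f y0.
  move=> /(_ 1 ltr01)[d d0 {}H]; apply/cvgrPdist_lt => e e0.
  have K0 : 0 < `|x2| + 1 by rewrite ltr_wpDl.
  apply/nbhs_ballP; exists (Num.min d (e / (`|x2| + 1))) => /=; first by rewrite lt_min d0 divr_gt0.
  move=> y; rewrite /ball_/= distrC lt_min => /andP[yd ye].
  rewrite distrC; have := H _ yd; rewrite mul1r => h.
  have -> : f y - f y0 = (f y - f y0 - x2 * (y - y0)) + x2 * (y - y0) by ring.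
  apply: le_lt_trans (ler_normD _ _) _; rewrite normrM.
  by move: ye; rewrite ltr_pdivlMr//; nra.
split => b y0.
- have [x1 [x2 {}H]] := H b y0; apply: (key _ _ x2) => e e0.
  have [d d0 {}H] := H e e0; exists d => // y yd.
  by have := H b y; rewrite !subrr normr0 mulr0 subr0 add0r => /(_ d0 yd).
- have [x1 [x2 {}H]] := H y0 b; apply: (key _ _ x1) => e e0.
  have [d d0 {}H] := H e e0; exists d => // y yd.
  by have := H y b; rewrite !subrr normr0 mulr0 subr0 addr0 => /(_ yd d0).
Qed.

Lemma continuous_integrable_oc (f : R -> R) a b : continuous f ->
  mu.-integrable `]a, b] (EFin \o f).
Proof.
move=> cf; apply: (@integrableS _ _ _ mu `[a, b]) => //.
  by apply: subset_itvr; rewrite bnd_simp.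
by apply: continuous_compact_integrable; [exact: segment_compact|exact: continuous_subspaceT].
Qed.

Lemma itv_oc_split a l : 0 < l ->
  `]a, a + (l + l)]%classic = `]a, a + l]%classic `|` `]a + l, a + l + l]%classic.
Proof.
move=> l0; apply/seteqP; split => x /=; rewrite !in_itv/=.
  by have [xl|xl] := leP x (a + l); [left|right]; lra.
by case; lra.
Qed.

Lemma itv_oc_disj a l : [disjoint `]a, a + l]%classic & `]a + l, a + l + l]%classic].
Proof.
by apply/disj_setPS => x /= []; rewrite !in_itv/=; lra.
Qed.

Lemma Rintegral_oc_split (f : R -> R) a l : 0 < l -> continuous f ->
  \int[mu]_(x in `]a, a + (l + l)]) f x =
  \int[mu]_(x in `]a, a + l]) f x + \int[mu]_(x in `]a + l, a + l + l]) f x.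
Proof.
move=> l0 cf; rewrite itv_oc_split// Rintegral_setU//.
  by rewrite -itv_oc_split//; exact: continuous_integrable_oc.
exact: itv_oc_disj.
Qed.

(** Half-open sides make the four quarters of a square disjoint, so integrals add up without
    discarding null sets. *)
Definition oc_square a c l : set (R * R) := `]a, a + l]%classic `*` `]c, c + l]%classic.

Lemma measurable_oc (a b : R) : measurable (`]a, b]%classic : set (measurableTypeR R)).
Proof. exact: measurable_itv. Qed.

Lemma measurable_oc_rect (a b c d : R) :
  measurable (`]a, b]%classic `*` `]c, d]%classic : set (measurableTypeR R * measurableTypeR R)).
Proof. by apply: measurableX; exact: measurable_oc. Qed.

Lemma leb_oc a l : 0 < l -> mu `]a, a + l] = l%:E.
Proof.
move=> l0; rewrite lebesgue_measure_itv/= lte_fin ltrDl l0 -EFinD.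
by congr EFin; ring.
Qed.

Lemma leb2_oc_square a c l : 0 < l -> leb2 R (oc_square a c l) = (l ^+ 2)%:E.
Proof.
move=> l0; rewrite product_measure1E; [|exact: measurable_oc..].
rewrite expr2 EFinM; congr (_ * _)%E; exact: leb_oc.
Qed.

Lemma oc_square_split (f : R * R -> R) a c l : 0 < l ->
  (leb2 R).-integrable setT (EFin \o f) ->
  \int[leb2 R]_(p in oc_square a c (l + l)) f p =
  \int[leb2 R]_(p in oc_square a c l) f p +
  \int[leb2 R]_(p in oc_square (a + l) c l) f p +
  (\int[leb2 R]_(p in oc_square a (c + l) l) f p +
  \int[leb2 R]_(p in oc_square (a + l) (c + l) l) f p).
Proof.
move=> l0 fi.
have fiS A : measurable A -> (leb2 R).-integrable A (EFin \o f).
  by move=> mA; exact: (integrableS measurableT mA).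
have mr := measurable_oc_rect.
have -> : oc_square a c (l + l) =
   (`]a, a + (l + l)]%classic `*` `]c, c + l]%classic) `|`
   (`]a, a + (l + l)]%classic `*` `]c + l, c + l + l]%classic).
  rewrite /oc_square (itv_oc_split c l0); apply/seteqP; split => -[x y] /=; first by case=> ? [?|?]; [left|right].
  by case=> -[? ?]; split => //; [left|right].
have XU (S : set R) : `]a, a + (l + l)]%classic `*` S =
   (`]a, a + l]%classic `*` S) `|` (`]a + l, a + l + l]%classic `*` S).
  rewrite (itv_oc_split a l0); apply/seteqP; split => -[x y] /=; first by case=> -[?|?] ?; [left|right].
  by case=> -[? ?]; split => //; [left|right].
rewrite Rintegral_setU//; last 2 first.
- by apply: fiS; apply: measurableU.
- apply/disj_setPS => -[x y] /= [[_ h1] [_ h2]].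
  by have /disj_setPS/(_ y) := itv_oc_disj c l; apply.
congr (_ + _); rewrite XU Rintegral_setU//.
- by apply: fiS; apply: measurableU.
- apply/disj_setPS => -[x y] /= [[h1 _] [h2 _]].
  by have /disj_setPS/(_ x) := itv_oc_disj a l; apply.
- by apply: fiS; apply: measurableU.
- apply/disj_setPS => -[x y] /= [[h1 _] [h2 _]].
  by have /disj_setPS/(_ x) := itv_oc_disj a l; apply.
Qed.

(* The flux through the boundary of a square minus the integral of the
   divergence is additive under subdivision and, at each point, negligible
   against the area; hence it vanishes, as in Goursat's lemma. *)
Lemma divergence_theorem (X Y : R -> R -> R) (D : R * R -> R) (N : R) :
  (forall x0 y0, exists x1 x2 y1 y2, [/\ D (x0, y0) = x1 + y2,
     total_derive X x0 y0 x1 x2 & total_derive Y x0 y0 y1 y2]) ->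
  (forall x0 y0 e, 0 < e -> exists2 d, 0 < d &
     forall x y, `|x - x0| < d -> `|y - y0| < d -> `|D (x, y) - D (x0, y0)| <= e) ->
  (leb2 R).-integrable setT (EFin \o D) ->
  (forall x y, N <= `|x| \/ N <= `|y| -> [/\ X x y = 0, Y x y = 0 & D (x, y) = 0]) ->
  \int[leb2 R]_p D p = 0.
Proof.
move=> HD cD iD vanish.
have HX x0 y0 : exists x1 x2, total_derive X x0 y0 x1 x2.
  by have [x1 [x2 [y1 [y2 [_ ? _]]]]] := HD x0 y0; exists x1, x2.
have HY x0 y0 : exists x1 x2, total_derive Y x0 y0 x1 x2.
  by have [x1 [x2 [y1 [y2 [_ _ ?]]]]] := HD x0 y0; exists y1, y2.
have [cX _] := continuous_of_total HX; have [_ cY] := continuous_of_total HY.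
pose I b c l := \int[mu]_(y in `]c, c + l]) X b y.
pose J b a l := \int[mu]_(x in `]a, a + l]) Y x b.
pose K a c l := \int[leb2 R]_(p in oc_square a c l) D p.
pose Lam a c l := (I (a + l) c l - I a c l) + (J (c + l) a l - J c a l) - K a c l.
have Lam_split a c l : 0 < l -> Lam a c (l + l) = Lam a c l + Lam (a + l) c l +
   (Lam a (c + l) l + Lam (a + l) (c + l) l).
  move=> l0; rewrite /Lam {1 2}/I {1 2}/J {1}/K !Rintegral_oc_split// oc_square_split// !addrA -!/(I _ _ _) -!/(J _ _ _).
  by rewrite /I /J /K; ring.
have Lam0 a c l : 0 < l -> Lam a c l = 0.
  move=> l0; apply/eqP; rewrite -normr_le0; apply/ler_addgt0Pr => e e0; rewrite add0r.
  have e'0 : 0 < e / l ^+ 2 by rewrite divr_gt0// exprn_gt0.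
  have -> : e = (e / l ^+ 2) * l ^+ 2 by rewrite divfK// gt_eqF// exprn_gt0.
  move: (e / l ^+ 2) e'0 => {e0}e e0.
  apply: (@square_cousin R (fun a c l => `|Lam a c l| <= e * l ^+ 2)) => //.
    move=> {l0}a {}c {}l l0 h1 h2 h3 h4; rewrite Lam_split//.
    apply: le_trans (ler_normD _ _) _.
    have := ler_normD (Lam a c l) (Lam (a + l) c l).
    have := ler_normD (Lam a (c + l) l) (Lam (a + l) (c + l) l).
    have -> : e * (l + l) ^+ 2 = 4 * (e * l ^+ 2) by ring.
    move: (e * l ^+ 2) (Lam a c l) (Lam (a + l) c l) (Lam a (c + l) l)
      (Lam (a + l) (c + l) l) h1 h2 h3 h4 => *; lra.
  move=> x0 y0; have [x1 [x2 [y1 [y2 [ED tX tY]]]]] := HD x0 y0.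
  (* Each pair of opposite sides contributes [4 * (e / 9) * l ^+ 2] and the divergence
     [e / 9 * l ^+ 2]: nine ninths in all. *)
  have e'0 : 0 < e / 9 by rewrite divr_gt0.
  have [d1 d10 {}tX] := tX _ e'0; have [d2 d20 {}tY] := tY _ e'0.
  have [d3 d30 {}cD] := cD x0 y0 _ e'0.
  exists (Num.min d1 (Num.min d2 d3)); first by rewrite !lt_min d10 d20.
  move=> {l0}a {}c {}l l0; rewrite !lt_min => /and3P[l1 l2 l3] /andP[ax xa] /andP[cy yc].
  have near r b : b <= r -> r <= b + l -> forall s, b <= s <= b + l -> `|s - r| <= l.
    by move=> ? ? s ?; rewrite ler_norml; lra.
  have nx := near x0 a ax xa; have ny := near y0 c cy yc.
  have KE : `|K a c l - (x1 + y2) * l ^+ 2| <= e / 9 * l ^+ 2.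
    apply: Rintegral_near.
    - exact: measurable_oc_rect.
    - exact: leb2_oc_square.
    - exact: (integrableS measurableT (measurable_oc_rect _ _ _ _)).
    - move=> [x y] [/=]; rewrite !in_itv/= => /andP[h1 h2] /andP[h3 h4]; rewrite -ED.
      apply: cD; apply: le_lt_trans l3; [apply: nx|apply: ny]; lra.
  have IE : `|(I (a + l) c l - I a c l) - (x1 * l) * l| <= (4 * (e / 9) * l) * l.
    rewrite /I -RintegralB//; [|exact: continuous_integrable_oc..].
    apply: Rintegral_near => //; first exact: leb_oc.
      apply: continuous_integrable_oc => y; apply: cvgB; exact: cX.
    move=> y; rewrite /= in_itv/= => /andP[h1 h2].
    have {}ny := ny y _.
    have {}ny : `|y - y0| <= l by apply: ny; lra.
    have n1 : `|a + l - x0| <= l by apply: nx; lra.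
    have n2 : `|a - x0| <= l by apply: nx; lra.
    have := tX (a + l) y (le_lt_trans n1 l1) (le_lt_trans ny l1).
    have := tX a y (le_lt_trans n2 l1) (le_lt_trans ny l1).
    set A := _ - _ - _ - _; set B := _ - _ - _ - _ => hA hB.
    have -> : X (a + l) y - X a y - x1 * l = B - A by rewrite /A /B; ring.
    apply: le_trans (ler_normB _ _) _; nra.
  have JE : `|(J (c + l) a l - J c a l) - (y2 * l) * l| <= (4 * (e / 9) * l) * l.
    rewrite /J -RintegralB//; [|exact: continuous_integrable_oc..].
    apply: Rintegral_near => //; first exact: leb_oc.
      apply: continuous_integrable_oc => y; apply: cvgB; exact: cY.
    move=> x; rewrite /= in_itv/= => /andP[h1 h2].
    have {}nx := nx x _.
    have {}nx : `|x - x0| <= l by apply: nx; lra.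
    have n1 : `|c + l - y0| <= l by apply: ny; lra.
    have n2 : `|c - y0| <= l by apply: ny; lra.
    have := tY x (c + l) (le_lt_trans nx l2) (le_lt_trans n1 l2).
    have := tY x c (le_lt_trans nx l2) (le_lt_trans n2 l2).
    set A := _ - _ - _ - _; set B := _ - _ - _ - _ => hA hB.
    have -> : Y x (c + l) - Y x c - y2 * l = B - A by rewrite /A /B; ring.
    apply: le_trans (ler_normB _ _) _; nra.
  rewrite /Lam.
  have -> : I (a + l) c l - I a c l + (J (c + l) a l - J c a l) - K a c l =
    (I (a + l) c l - I a c l - x1 * l * l) + (J (c + l) a l - J c a l - y2 * l * l) -
    (K a c l - (x1 + y2) * l ^+ 2) by ring.
  apply: le_trans (ler_normB _ _) _.
  apply: le_trans (lerD (ler_normD _ _) (lexx _)) _.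
  rewrite expr2 in KE *; lra.
(* On the boundary of the square of half-side [M] the field vanishes, so there is no flux; outside
   it [D] vanishes, so the integral over the square is that over the plane. *)
pose M := Num.max N 1; have M0 : 0 < M by rewrite lt_max ltr01 orbT.
have NM : N <= M by rewrite le_max lexx.
have van x y : M <= `|x| \/ M <= `|y| -> [/\ X x y = 0, Y x y = 0 & D (x, y) = 0].
  by move=> h; apply: vanish; case: h => /(le_trans NM) ?; [left|right].
have := Lam0 (- M) (- M) (M + M) (addr_gt0 M0 M0).
have EM : - M + (M + M) = M by ring.
have z (f : R -> R) A : (forall x, f x = 0) -> \int[mu]_(x in A) f x = 0.
  by move=> h; rewrite (@eq_Rintegral _ _ _ mu A (cst 0))// Rintegral_mkcond;
     rewrite (@eq_Rintegral _ _ _ mu setT (cst 0)) ?Rintegral_cst ?mul0r// => x _;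
     rewrite patchE; case: ifP.
rewrite /Lam EM /I /J !z => [|x|x|x|x].
- rewrite !subrr !add0r => /eqP; rewrite oppr_eq0 => /eqP; rewrite /K Rintegral_mkcond => <-.
  apply: eq_Rintegral => -[x y] _; rewrite patchE; case: ifPn => //.
  rewrite notin_setE /oc_square EM /= !in_itv/= => h.
  have [] // := van x y; apply: contrapT => /not_orP[/negP h1 /negP h2]; apply: h.
  move: h1 h2; rewrite -!ltNge !ltr_norml => /andP[? ?] /andP[? ?]; split; lra.
- by have [] := van x (- M); first by right; rewrite normrN ger0_norm// ltW.
- by have [] := van x M; first by right; rewrite ger0_norm// ltW.
- by have [] := van (- M) x; first by left; rewrite normrN ger0_norm// ltW.
- by have [] := van M x; first by left; rewrite ger0_norm// ltW.
Qed.

End Divergence.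

(** * Complex integrals and square-integrable functions *)

Section ComplexIntegral.
Context (dd : measure_display) (T : measurableType dd) (R : realType).
Variable nu : {measure set T -> \bar R}.
Implicit Types (F G : T -> R[i]) (c : R[i]).
Local Notation Re := (@complex.Re R).
Local Notation Im := (@complex.Im R).

(** Measurability is expressed on the two coordinates, as in [inL2], rather than through a
    sigma-algebra on [R[i]]. *)
Definition cmeas F := measurable_fun setT (fun p => Re (F p)) /\
  measurable_fun setT (fun p => Im (F p)).

Definition cintegral F : R[i] :=
  ((\int[nu]_p Re (F p)) +i* (\int[nu]_p Im (F p)))%C.

Definition cintegrable F := cmeas F /\ (\int[nu]_p (normc (F p))%:E < +oo)%E.

Lemma cmeas_cst c : cmeas (fun=> c).
Proof. by split; exact: measurable_cst. Qed.

Lemma cmeasD F G : cmeas F -> cmeas G -> cmeas (fun p => F p + G p).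
Proof.
move=> [F1 F2] [G1 G2]; split.
  by under eq_fun do rewrite ReD; exact: measurable_funD.
by under eq_fun do rewrite ImD; exact: measurable_funD.
Qed.

Lemma cmeasM F G : cmeas F -> cmeas G -> cmeas (fun p => F p * G p).
Proof.
move=> [F1 F2] [G1 G2]; split.
  by under eq_fun do rewrite ReM; apply: measurable_funB; exact: measurable_funM.
by under eq_fun do rewrite ImM; apply: measurable_funD; exact: measurable_funM.
Qed.

Lemma cmeasJ F : cmeas F -> cmeas (fun p => conjc (F p)).
Proof.
move=> [F1 F2]; split; first by under eq_fun do rewrite ReJ.
by under eq_fun do rewrite ImJ; apply: measurableT_comp.
Qed.

Lemma cmeasN F : cmeas F -> cmeas (fun p => - F p).
Proof.
move=> [F1 F2]; split; first by under eq_fun do rewrite ReN; exact: measurableT_comp.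
by under eq_fun do rewrite ImN; exact: measurableT_comp.
Qed.

Lemma cmeas_real (f : T -> R) : measurable_fun setT f ->
  cmeas (fun p => (f p)%:C%C).
Proof. by move=> mf; split => //=; exact: measurable_cst. Qed.

Lemma cmeas_Cexp F : cmeas F -> cmeas (fun p => Cexp (F p)).
Proof.
move=> [F1 F2]; split; rewrite /Cexp /=; apply: measurable_funM.
- exact: measurableT_comp.
- by apply: measurableT_comp => //; apply: continuous_measurable_fun; exact: continuous_cos.
- exact: measurableT_comp.
- by apply: measurableT_comp => //; apply: continuous_measurable_fun; exact: continuous_sin.
Qed.

Lemma cmeas_normc F : cmeas F -> measurable_fun setT (fun p => normc (F p)).
Proof.
move=> [F1 F2].
have -> : (fun p => normc (F p)) = (fun p => Num.sqrt (Re (F p) ^+ 2 + Im (F p) ^+ 2)).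
  by apply/funext => p; case: (F p).
apply: measurableT_comp.
  by apply: continuous_measurable_fun => x; exact: sqrt_continuous.
by apply: measurable_funD; exact: measurable_funX.
Qed.

Lemma cmeas_normcE F : cmeas F -> measurable_fun setT (fun p => (normc (F p))%:E).
Proof. by move=> mF; apply/measurable_EFinP; exact: cmeas_normc. Qed.

Lemma cintegrable_ReIm F : cintegrable F ->
  nu.-integrable setT (EFin \o (fun p => Re (F p))) /\
  nu.-integrable setT (EFin \o (fun p => Im (F p))).
Proof.
move=> [mF fF]; have [F1 F2] := mF.
split; apply/integrableP; split; do ?exact/measurable_EFinP;
  apply: le_lt_trans fF; apply: ge0_le_integral => //.
- by apply/measurableT_comp => //; exact/measurable_EFinP.
- exact: cmeas_normcE.
- by move=> p _ /=; rewrite lee_fin normc_Re.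
- by apply/measurableT_comp => //; exact/measurable_EFinP.
- exact: cmeas_normcE.
- by move=> p _ /=; rewrite lee_fin normc_Im.
Qed.

Lemma cintegrable_le F (g : T -> R) : cmeas F -> measurable_fun setT g ->
  (forall p, normc (F p) <= g p) -> (\int[nu]_p (g p)%:E < +oo)%E -> cintegrable F.
Proof.
move=> mF mg Fg fg; split => //; apply: le_lt_trans fg.
apply: ge0_le_integral => //.
- by move=> p _; rewrite lee_fin normc_ge0.
- exact: cmeas_normcE.
- exact/measurable_EFinP.
- by move=> p _; rewrite lee_fin.
Qed.

Lemma eq_cintegral F G : F =1 G -> cintegral F = cintegral G.
Proof. by move=> /funext ->. Qed.

Lemma cintegralD F G : cintegrable F -> cintegrable G ->
  cintegral (fun p => F p + G p) = cintegral F + cintegral G.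
Proof.
move=> /cintegrable_ReIm[F1 F2] /cintegrable_ReIm[G1 G2].
apply: cplx_eq; rewrite ?ReD ?ImD /cintegral /= -RintegralD//;
  by apply: eq_Rintegral => p _; rewrite ?ReD ?ImD.
Qed.

Lemma cintegralZ c F : cintegrable F ->
  cintegral (fun p => c * F p) = c * cintegral F.
Proof.
move=> /cintegrable_ReIm[F1 F2].
have Z r (f : T -> R) : nu.-integrable setT (EFin \o f) ->
    nu.-integrable setT (EFin \o (fun p => r * f p)).
  by move=> fi; have := integrableZl measurableT r fi.
apply: cplx_eq; rewrite ?ReM ?ImM /cintegral /= -!RintegralZl//.
  by rewrite -RintegralB//; [apply: eq_Rintegral => p _; rewrite ReM|exact: Z..].
by rewrite -RintegralD//; [apply: eq_Rintegral => p _; rewrite ImM|exact: Z..].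
Qed.

Lemma cintegralJ F : cintegrable F ->
  cintegral (fun p => conjc (F p)) = conjc (cintegral F).
Proof.
move=> /cintegrable_ReIm[F1 F2].
apply: cplx_eq; rewrite ?ReJ ?ImJ /cintegral /=.
  by apply: eq_Rintegral => p _; rewrite ReJ.
rewrite -mulN1r -RintegralZl//.
by apply: eq_Rintegral => p _; rewrite ImJ mulN1r.
Qed.

Lemma cintegrableD F G : cintegrable F -> cintegrable G -> cintegrable (fun p => F p + G p).
Proof.
move=> [mF fF] [mG fG].
apply: (@cintegrable_le _ (fun p => normc (F p) + normc (G p))).
- exact: cmeasD.
- by apply: measurable_funD; exact: cmeas_normc.
- by move=> p; exact: normcD.
- under eq_integral do rewrite EFinD.
  rewrite ge0_integralD//; do ?[exact: cmeas_normcE|by move=> p _; rewrite lee_fin normc_ge0].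
  exact: lte_add_pinfty.
Qed.

Lemma cintegrableZ c F : cintegrable F -> cintegrable (fun p => c * F p).
Proof.
move=> [mF fF]; split; first by apply: cmeasM => //; exact: cmeas_cst.
under eq_integral do rewrite normcM EFinM.
rewrite ge0_integralZl_EFin//; do ?[exact: cmeas_normcE|exact: normc_ge0|by move=> p _; rewrite lee_fin normc_ge0].
by rewrite lte_mul_pinfty// lee_fin normc_ge0.
Qed.

Lemma cintegralB F G : cintegrable F -> cintegrable G ->
  cintegral (fun p => F p - G p) = cintegral F - cintegral G.
Proof.
move=> iF iG; rewrite -mulN1r -cintegralZ// -cintegralD//; last exact: cintegrableZ.
by apply: eq_cintegral => p; rewrite mulN1r.
Qed.

(** The constant 2 comes from bounding the real and imaginary parts separately. *)
Lemma normc_cintegral_le F : cintegrable F ->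
  ((normc (cintegral F))%:E <= 2%:E * \int[nu]_p (normc (F p))%:E)%E.
Proof.
move=> iF; have [R1 R2] := cintegrable_ReIm iF; have [mF fF] := iF; have [F1 F2] := mF.
apply: (@le_trans _ _ (`|\int[nu]_p Re (F p)| + `|\int[nu]_p Im (F p)|)%:E).
  by rewrite lee_fin; exact: normc_ReIm.
rewrite EFinD !EFin_normr_Rintegral//.
rewrite (_ : 2%:E = 1 + 1)%E// ge0_muleDl// !mul1e.
have key (h : T -> R) : measurable_fun setT h -> (forall p, `|h p| <= normc (F p)) ->
   (`| \int[nu]_p (h p)%:E | <= \int[nu]_p (normc (F p))%:E)%E.
  move=> mh hF; apply: le_trans (le_abse_integral _ _ _) _ => //; first exact/measurable_EFinP.
  apply: ge0_le_integral => //.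
  - by apply/measurableT_comp => //; exact/measurable_EFinP.
  - exact: cmeas_normcE.
  - by move=> p _; rewrite lee_fin.
apply: leeD; apply: key => // p; [exact: normc_Re|exact: normc_Im].
Qed.

End ComplexIntegral.


(** * Cauchy-Schwarz and Minkowski inequalities for square integrals *)

Section SquareIntegrable.
Context (dd : measure_display) (T : measurableType dd) (R : realType).
Variable nu : {measure set T -> \bar R}.
Implicit Types f g : T -> R.

Lemma poweR_sqr (x : \bar R) : (0 <= x)%E -> (x `^ 2 = x ^+ 2)%E.
Proof.
case: x => [r||//]; rewrite ?lee_fin => r0.
  by rewrite poweR_EFin -EFin_expe -powR_mulrn.
by rewrite poweRyr// expe2 mulyy.
Qed.

Lemma Lnorm2_sq f : (forall p, 0 <= f p) ->
  ((Lnorm nu 2%:E (EFin \o f)) ^+ 2 = \int[nu]_p (f p ^+ 2)%:E)%E.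
Proof.
move=> f0; rewrite -poweR_sqr ?Lnorm_ge0// powR_Lnorm//.
apply: eq_integral => p _.
have -> : `|(EFin \o f) p|%E = (f p)%:E by rewrite /= ger0_norm.
by rewrite poweR_sqr ?lee_fin// EFin_expe.
Qed.

Lemma sqe_le (x : \bar R) (B : R) : (0 <= x)%E -> 0 <= B ->
  (x ^+ 2 <= (B ^+ 2)%:E)%E = (x <= B%:E)%E.
Proof.
case: x => [r||//]; rewrite ?lee_fin => r0 B0.
  by rewrite -expr2 ler_sqr ?nnegrE.
by rewrite expe2 mulyy.
Qed.

Lemma Lnorm2_le f (B : R) : (forall p, 0 <= f p) -> 0 <= B ->
  ((Lnorm nu 2%:E (EFin \o f)) <= B%:E)%E =
  (\int[nu]_p (f p ^+ 2)%:E <= (B ^+ 2)%:E)%E.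
Proof. by move=> f0 B0; rewrite -Lnorm2_sq// sqe_le ?Lnorm_ge0. Qed.

(** Real bounds [A] and [B] stand for the norms, so that products of extended reals do not arise in
    applications. *)
Lemma cauchy_schwarz f g (A B : R) : measurable_fun setT f -> measurable_fun setT g ->
  (forall p, 0 <= f p) -> (forall p, 0 <= g p) -> 0 <= A -> 0 <= B ->
  (\int[nu]_p (f p ^+ 2)%:E <= (A ^+ 2)%:E)%E ->
  (\int[nu]_p (g p ^+ 2)%:E <= (B ^+ 2)%:E)%E ->
  (\int[nu]_p (f p * g p)%:E <= (A * B)%:E)%E.
Proof.
move=> mf mg f0 g0 A0 B0; rewrite -!Lnorm2_le// => fA gB.
have half : 2^-1 + 2^-1 = 1 :> R by lra.
have := hoelder nu mf mg (ltr0Sn R 1) (ltr0Sn R 1) half.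
rewrite Lnorm1 => h.
have -> : (\int[nu]_p (f p * g p)%:E = \int[nu]_x `|(EFin \o (f \* g)%R) x|)%E.
  by apply: eq_integral => p _; rewrite /= ger0_norm ?mulr_ge0.
by apply: le_trans h _; rewrite EFinM; apply: lee_pmul; rewrite ?Lnorm_ge0.
Qed.

Lemma minkowski2 f g (A B : R) : measurable_fun setT f -> measurable_fun setT g ->
  (forall p, 0 <= f p) -> (forall p, 0 <= g p) -> 0 <= A -> 0 <= B ->
  (\int[nu]_p (f p ^+ 2)%:E <= (A ^+ 2)%:E)%E ->
  (\int[nu]_p (g p ^+ 2)%:E <= (B ^+ 2)%:E)%E ->
  (\int[nu]_p ((f p + g p) ^+ 2)%:E <= ((A + B) ^+ 2)%:E)%E.
Proof.
move=> mf mg f0 g0 A0 B0; rewrite -!Lnorm2_le//; last 2 first.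
- by move=> p; rewrite addr_ge0.
- by rewrite addr_ge0.
move=> fA gB; have := minkowski_EFin nu mf mg (ler1n R 2).
by move=> h; apply: (le_trans h); rewrite [X in (_ <= X)%E]EFinD; exact: leeD.
Qed.

End SquareIntegrable.

(** * Square-integrable functions on the plane and Gaussian integrals *)

Section PlaneL2.
Variable R : realType.
Local Notation P := (measurableTypeR R * measurableTypeR R)%type.
Local Notation mu2 := (leb2 R).
Implicit Types (f g : R[i] -> R[i]) (c : R[i]).

Definition pmeas g := cmeas (fun p : P => g (plane p)).

Lemma inL2_pmeas g : inL2 g -> pmeas g.
Proof. by case. Qed.

Lemma L2norm_ge0 g : 0 <= L2norm g.
Proof. by rewrite fine_ge0// Lnorm_ge0. Qed.

Lemma inL2_fin g : inL2 g -> L2enorm g = (L2norm g)%:E.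
Proof.
by move=> [_ _ h]; rewrite /L2norm fineK// ge0_fin_numE// Lnorm_ge0.
Qed.

Lemma L2norm_sq g : inL2 g ->
  (\int[mu2]_p (normc (g (plane p)) ^+ 2)%:E = (L2norm g ^+ 2)%:E)%E.
Proof.
move=> ig; rewrite EFin_expe -inL2_fin// /L2enorm -Lnorm2_sq// => p.
exact: normc_ge0.
Qed.

Lemma inL2_intro g (B : R) : pmeas g -> 0 <= B ->
  (\int[mu2]_p (normc (g (plane p)) ^+ 2)%:E <= (B ^+ 2)%:E)%E ->
  inL2 g /\ L2norm g <= B.
Proof.
move=> [m1 m2] B0; rewrite -Lnorm2_le//; last by move=> p; exact: normc_ge0.
move=> h; have ig : inL2 g by split => //; apply: le_lt_trans h _; exact: ltry.
by split => //; rewrite -lee_fin -inL2_fin.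
Qed.

Lemma pmeas_normc g : pmeas g -> measurable_fun setT (fun p : P => normc (g (plane p))).
Proof. exact: cmeas_normc. Qed.

Lemma L2_meas g : inL2 g -> measurable_fun setT (fun p : P => normc (g (plane p))).
Proof. by move=> /inL2_pmeas; exact: cmeas_normc. Qed.

Lemma L2D f g : inL2 f -> inL2 g ->
  inL2 (fun z => f z + g z) /\ L2norm (fun z => f z + g z) <= L2norm f + L2norm g.
Proof.
move=> iF iG; apply: inL2_intro; rewrite ?addr_ge0 ?L2norm_ge0//.
  by apply: cmeasD; exact: inL2_pmeas.
apply: (@le_trans _ _ (\int[mu2]_p ((normc (f (plane p)) + normc (g (plane p))) ^+ 2)%:E)%E).
  apply: ge0_le_integral => //.
  - by move=> p _; rewrite lee_fin sqr_ge0.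
  - apply/measurable_EFinP/measurable_funX/cmeas_normc/cmeasD; exact: inL2_pmeas.
  - apply/measurable_EFinP/measurable_funX/measurable_funD; exact: L2_meas.
  - by move=> p _; rewrite lee_fin lerXn2r ?nnegrE ?addr_ge0 ?normc_ge0// normcD.
apply: minkowski2; rewrite ?L2norm_ge0// ?L2norm_sq//;
  do ?[exact: L2_meas|by move=> p; exact: normc_ge0].
Qed.

Lemma L2_le f g (c : R) : 0 <= c -> pmeas f -> inL2 g ->
  (forall z, normc (f z) <= c * normc (g z)) ->
  inL2 f /\ L2norm f <= c * L2norm g.
Proof.
move=> c0 mf ig fg; apply: inL2_intro; rewrite ?mulr_ge0 ?L2norm_ge0//.
rewrite exprMn EFinM -L2norm_sq//.
rewrite -ge0_integralZl_EFin//; last 3 first.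
- by move=> p _; rewrite lee_fin sqr_ge0.
- by apply/measurable_EFinP/measurable_funX; exact: L2_meas.
- exact: sqr_ge0.
apply: ge0_le_integral => //.
- by move=> p _; rewrite lee_fin sqr_ge0.
- by apply/measurable_EFinP/measurable_funX; exact: pmeas_normc.
- apply/measurable_EFinP/measurable_funM; first exact: measurable_cst.
  by apply/measurable_funX; exact: L2_meas.
- by move=> p _; rewrite lee_fin -exprMn lerXn2r ?nnegrE ?mulr_ge0 ?normc_ge0.
Qed.

(** The inequality [L2_le] for the factor [c], and again for [c^-1], gives the equality. *)
Lemma L2Z c f : inL2 f -> inL2 (fun z => c * f z) /\
  L2norm (fun z => c * f z) = normc c * L2norm f.
Proof.
have key (e : R[i]) (h : R[i] -> R[i]) : inL2 h -> inL2 (fun z => e * h z) /\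
    L2norm (fun z => e * h z) <= normc e * L2norm h.
  move=> ih; apply: L2_le; rewrite ?normc_ge0//.
    by apply: cmeasM; [exact: cmeas_cst|exact: inL2_pmeas].
  by move=> z; rewrite normcM.
move=> iF; have [i1 h1] := key c f iF; split => //.
have [->|c0] := eqVneq c 0.
  apply/eqP; rewrite normc0 mul0r eq_le L2norm_ge0 andbT.
  by have [_] := key 0 f iF; rewrite normc0 mul0r.
apply/eqP; rewrite eq_le h1/= -ler_pdivlMl ?normc_gt0//.
have [_] := key c^-1 _ i1; rewrite Normc.normcV.
by rewrite (_ : (fun z => c^-1 * (c * f z)) = f)//; apply/funext => z; rewrite mulKf.
Qed.

Lemma L2_cauchy_schwarz f g : inL2 f -> inL2 g ->
  (\int[mu2]_p (normc (f (plane p)) * normc (g (plane p)))%:E <= (L2norm f * L2norm g)%:E)%E.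
Proof.
move=> iF iG; apply: cauchy_schwarz; rewrite ?L2norm_ge0// ?L2norm_sq//;
  do ?[exact: L2_meas|by move=> p; exact: normc_ge0].
Qed.

Lemma L2_0 : inL2 (fun _ : R[i] => 0) /\ L2norm (fun _ : R[i] => 0) = 0.
Proof.
have [] := @inL2_intro (fun=> 0) 0.
- exact: cmeas_cst.
- by [].
- by under eq_integral do rewrite normc0 expr0n/=; rewrite integral0 expr0n.
by move=> i h; split => //; apply/eqP; rewrite eq_le h L2norm_ge0.
Qed.

(** Read off from the fact that the normal density has total mass 1. *)
Lemma integral_gauss1 (m s : R) : 0 < s ->
  (\int[@lebesgue_measure R]_x (expR (- (x - m) ^+ 2 / (s ^+ 2 *+ 2)))%:E = (Num.sqrt (s ^+ 2 * pi *+ 2))%:E)%E.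
Proof.
move=> s0; have s0' : s != 0 by rewrite gt_eqF.
have q0 : 0 < Num.sqrt (s ^+ 2 * pi *+ 2) :> R.
  by rewrite sqrtr_gt0 pmulrn_lgt0// mulr_gt0 ?exprn_gt0 ?pi_gt0.
have := integral_normal_pdf m s; rewrite normal_pdfE//.
under eq_integral do rewrite EFinM.
rewrite ge0_integralZl_EFin//; last 3 first.
- by move=> x _; rewrite lee_fin normal_fun_ge0.
- apply/measurable_EFinP; exact: measurable_normal_fun.
- exact: normal_peak_ge0.
rewrite /normal_peak => /(congr1 (fun x => (Num.sqrt (s ^+ 2 * pi *+ 2))%:E * x)%E).
by rewrite mule1 muleA -EFinM divff ?gt_eqF// mul1e.
Qed.

Lemma measurable_gauss2 (a : R) (q : P) : measurable_fun setT
  (fun p : P => expR (- (a * ((p.1 - q.1) ^+ 2 + (p.2 - q.2) ^+ 2)))).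
Proof.
apply: measurableT_comp => //; apply: measurableT_comp => //.
apply: measurable_funM => //; apply: measurable_funD; apply: measurable_funX;
  by apply: measurable_funB.
Qed.

Lemma integral_gauss2 (a : R) (q : P) : 0 < a ->
  (\int[mu2]_p (expR (- (a * ((p.1 - q.1) ^+ 2 + (p.2 - q.2) ^+ 2))))%:E = (pi / a)%:E)%E.
Proof.
(* The variance [(2 * a)^-1] turns the exponent of the normal density into [- a * x ^+ 2]. *)
move=> a0; pose s := Num.sqrt (2 * a)^-1.
have s2 : s ^+ 2 = (2 * a)^-1 by rewrite sqr_sqrtr// invr_ge0 mulr_ge0// ltW.
have s0 : 0 < s by rewrite sqrtr_gt0 invr_gt0 mulr_gt0.
have sE x : x / (s ^+ 2 *+ 2) = a * x.
  by rewrite s2 -mulr_natr; field; rewrite gt_eqF.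
have pE : s ^+ 2 * pi *+ 2 = pi / a.
  by rewrite s2 -mulr_natr; field; rewrite gt_eqF.
have G1 q' : (\int[@lebesgue_measure R]_x (expR (- (a * (x - q') ^+ 2)))%:E = (Num.sqrt (pi / a))%:E)%E.
  rewrite -pE -(integral_gauss1 q' s0); apply: eq_integral => x _.
  by rewrite mulNr sE.
rewrite fubini_tonelli1//; last first.
  by apply/measurable_EFinP; exact: measurable_gauss2.
rewrite /fubini_F.
under eq_integral => x _.
  under eq_integral => y _ do rewrite /= mulrDr opprD expRD EFinM.
  rewrite ge0_integralZl_EFin ?expR_ge0//; last first.
    apply/measurable_EFinP; apply: measurableT_comp => //; apply: measurableT_comp => //.
    by apply: measurable_funM => //; apply: measurable_funX; apply: measurable_funB.
  rewrite G1; over.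
rewrite /= ge0_integralZr//; last first.
  apply/measurable_EFinP; apply: measurableT_comp => //; apply: measurableT_comp => //.
  by apply: measurable_funM => //; apply: measurable_funX; apply: measurable_funB.
rewrite G1 -EFinM -expr2 sqr_sqrtr// divr_ge0 ?pi_ge0// ltW//.
Qed.

End PlaneL2.

(** * Schur's test over a sigma-finite measure *)

Section PlaneSigmaFinite.
Variable R : realType.
Local Notation P := (measurableTypeR R * measurableTypeR R)%type.

(* A copy of [leb2] carrying the sigma-finite structure needed by the Fubini
   theorems on [P * P]. *)
Definition plane_leb : set P -> \bar R := leb2 R.

HB.instance Definition _ := Measure.on plane_leb.

Lemma plane_leb_sigma_finite : sigma_finite setT plane_leb.
Proof.
have /sigma_finiteP[F [TF ndF Foo]] := sigma_finiteT (@lebesgue_measure R).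
exists (fun n => F n `*` F n).
  rewrite -setXTT TF predeqE => -[x y]; split => [[/= [n _ Fx] [k _ Fy]]|[n _ [? ?]]].
    exists (maxn n k) => //; split => /=.
      by move: x Fx; exact/subsetPset/ndF/leq_maxl.
    by move: y Fy; exact/subsetPset/ndF/leq_maxr.
  by split; exists n.
move=> n; have [mF fF] := Foo n; split; first exact: measurableX.
rewrite /plane_leb product_measure1E// lte_mul_pinfty// ge0_fin_numE//.
Qed.

HB.instance Definition _ := Measure_isSigmaFinite.Build _ _ _ plane_leb
  plane_leb_sigma_finite.

Definition plane_sf : {sigma_finite_measure set P -> \bar R} := plane_leb.

Lemma plane_sfE (f : P -> \bar R) : (\int[leb2 R]_p f p = \int[plane_sf]_p f p)%E.
Proof. by []. Qed.

End PlaneSigmaFinite.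

Section Schur.
Context (dd : measure_display) (T : measurableType dd) (R : realType).
Variable nu : {sigma_finite_measure set T -> \bar R}.

(* The kernel is [k ^+ 2], so that the Cauchy-Schwarz inequality splits it
   without square roots. *)
Lemma schur_test (k : T -> T -> R) (A B : R) (G H : T -> R) : 0 < A -> 0 <= B ->
  measurable_fun setT (fun x : T * T => k x.1 x.2) -> (forall p q, 0 <= k p q) ->
  (forall p, (\int[nu]_q (k p q ^+ 2)%:E <= A%:E)%E) ->
  (forall q, (\int[nu]_p (k p q ^+ 2)%:E <= A%:E)%E) ->
  measurable_fun setT G -> measurable_fun setT H ->
  (forall p, 0 <= G p) -> (forall p, 0 <= H p) ->
  (forall p, ((H p)%:E <= \int[nu]_q (k p q ^+ 2 * G q)%:E)%E) ->
  (\int[nu]_p (G p ^+ 2)%:E <= (B ^+ 2)%:E)%E ->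
  (\int[nu]_p (H p ^+ 2)%:E <= ((A * B) ^+ 2)%:E)%E.
Proof.
move=> Agt0 B0 mk k0 kA1 kA2 mG mH G0 H0 HG GB.
have A0 : 0 <= A := ltW Agt0.
pose S (p : T) := (\int[nu]_q (k p q ^+ 2 * G q ^+ 2)%:E)%E.
have S0 p : (0 <= S p)%E.
  by apply: integral_ge0 => q _; rewrite lee_fin mulr_ge0 ?sqr_ge0.
have mk1 p : measurable_fun setT (fun q => k p q).
  exact: (measurable_fun_pair2 p mk).
have mk2 q : measurable_fun setT (fun p => k p q).
  exact: (measurable_fun_pair1 q mk).
have HS p : ((H p ^+ 2)%:E <= A%:E * S p)%E.
  (* [S p] may be infinite at some points; the bound is trivial there because [A] is positive. *)
  have [Sy|] := eqVneq (S p) +oo%E.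
    by rewrite Sy mulry gtr0_sg// mul1e leey.
  rewrite -ltey => Sfin; have Sf : S p \is a fin_num by rewrite ge0_fin_numE.
  pose s := fine (S p); have s0 : 0 <= s by rewrite fine_ge0.
  have SE : S p = s%:E by rewrite fineK.
  have h : (\int[nu]_q (k p q * (k p q * G q))%:E <= (Num.sqrt A * Num.sqrt s)%:E)%E.
    apply: cauchy_schwarz => //.
    - by apply: measurable_funM.
    - by move=> q; rewrite mulr_ge0.
    - by rewrite sqr_sqrtr.
    - rewrite sqr_sqrtr// -SE /S.
      by under eq_integral do rewrite exprMn.
  rewrite SE -EFinM lee_fin -[leRHS]sqr_sqrtr; last by rewrite mulr_ge0.
  rewrite lerXn2r ?nnegrE ?sqrtr_ge0// sqrtrM//.
  rewrite -lee_fin; apply: le_trans (HG p) _; apply: le_trans h.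
  by under [X in (X <= _)%E]eq_integral do rewrite expr2 -mulrA.
have mT : measurable_fun setT (fun x : T * T => (k x.1 x.2 ^+ 2 * G x.2 ^+ 2)%:E).
  apply/measurable_EFinP/measurable_funM; first exact: measurable_funX.
  by apply: measurable_funX; exact: measurableT_comp.
have T0 (x : T * T) : (0 <= (k x.1 x.2 ^+ 2 * G x.2 ^+ 2)%:E)%E.
  by rewrite lee_fin mulr_ge0 ?sqr_ge0.
have mS : measurable_fun setT S by exact: (measurable_fun_fubini_tonelli_F _ mT T0).
apply: (@le_trans _ _ (\int[nu]_p (A%:E * S p))%E).
  apply: ge0_le_integral.
  - exact: measurableT.
  - by move=> p _; rewrite lee_fin sqr_ge0.
  - exact/measurable_EFinP/measurable_funX.
  - exact: measurable_funeM.
  - by move=> p _; exact: HS.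
rewrite ge0_integralZl_EFin; last 4 first.
- exact: measurableT.
- by move=> p _; exact: S0.
- exact: mS.
- exact: A0.
rewrite exprMn EFinM expr2 EFinM -muleA lee_wpmul2l ?lee_fin//.
(* Tonelli's theorem makes the bound on the integral of the kernel in its first variable
   available. *)
have FT : (\int[nu]_p S p = \int[nu]_q \int[nu]_p (k p q ^+ 2 * G q ^+ 2)%:E)%E.
  exact: (fubini_tonelli _ mT T0).
rewrite FT; apply: le_trans (_ : _ <= \int[nu]_q (A%:E * (G q ^+ 2)%:E))%E _.
  apply: ge0_le_integral.
  - exact: measurableT.
  - by move=> q _; apply: integral_ge0 => p _; rewrite lee_fin mulr_ge0 ?sqr_ge0.
  - exact: (measurable_fun_fubini_tonelli_G _ mT T0).
  - by apply: measurable_funeM; exact/measurable_EFinP/measurable_funX.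
  - move=> q _; under eq_integral => p _ do rewrite EFinM.
    rewrite ge0_integralZr; last 4 first.
    + exact: measurableT.
    + exact/measurable_EFinP/measurable_funX.
    + by move=> p _; rewrite lee_fin sqr_ge0.
    + by rewrite lee_fin sqr_ge0.
    by apply: lee_wpmul2r; [rewrite lee_fin sqr_ge0|exact: kA2].
rewrite ge0_integralZl_EFin; last 4 first.
- exact: measurableT.
- by move=> q _; rewrite lee_fin sqr_ge0.
- exact/measurable_EFinP/measurable_funX.
- exact: A0.
by apply: lee_wpmul2l; [rewrite lee_fin|exact: GB].
Qed.

End Schur.

(** * The kernel of the projection *)

Section PlaneMeasurability.
Variable R : realType.
Local Notation P := (measurableTypeR R * measurableTypeR R)%type.

(** A superlevel set of a continuous function is a countable union of open rectangles with rational
    corners, each measurable in the product. *)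
Lemma continuous_plane_measurable (f : R * R -> R) :
  (forall x0 y0 e, 0 < e -> exists2 d, 0 < d &
     forall x y, `|x - x0| < d -> `|y - y0| < d -> `|f (x, y) - f (x0, y0)| < e) ->
  measurable_fun setT (f : P -> R).
Proof.
move=> cf; apply: (measurability _ (RGenOInfty.measurableE R)).
move=> _ [_ [a ->] <-]; rewrite setTI.
pose rect (i : rat * rat * (rat * rat)) : set P :=
  `](ratr i.1.1 : R), ratr i.1.2[%classic `*` `](ratr i.2.1 : R), ratr i.2.2[%classic.
pose A : set P := f @^-1` `]a, +oo[%classic.
pose F i := if asbool (rect i `<=` A) then rect i else set0.
have -> : f @^-1` `]a, +oo[%classic = \bigcup_i F i.
  apply/seteqP; split; last first.
    by move=> p [i _]; rewrite /F; case: asboolP => // h; exact: h.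
  move=> [x0 y0] /=; rewrite in_itv/= andbT => h.
  have fa : 0 < f (x0, y0) - a by rewrite subr_gt0.
  have [d d0 H] := cf x0 y0 _ fa.
  have [q1 h1] : exists q, ratr q \in `]x0 - d, x0[ by apply: rat_in_itvoo; lra.
  have [q2 h2] : exists q, ratr q \in `]x0, x0 + d[ by apply: rat_in_itvoo; lra.
  have [q3 h3] : exists q, ratr q \in `]y0 - d, y0[ by apply: rat_in_itvoo; lra.
  have [q4 h4] : exists q, ratr q \in `]y0, y0 + d[ by apply: rat_in_itvoo; lra.
  move: h1 h2 h3 h4; rewrite !in_itv/= => /andP[? ?] /andP[? ?] /andP[? ?] /andP[? ?].
  exists ((q1, q2), (q3, q4)) => //; rewrite /F asboolT.
    by split; rewrite /= in_itv/=; apply/andP.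
  move=> [x y] [/=]; rewrite /A /= !in_itv/= => /andP[? ?] /andP[? ?]; rewrite andbT.
  have : `|f (x, y) - f (x0, y0)| < f (x0, y0) - a by apply: H; rewrite ltr_norml; lra.
  by rewrite ltr_norml; lra.
apply: countable_bigcupT_measurable; first exact: countableP.
move=> i; rewrite /F; case: asboolP => // _.
by apply: measurableX; exact: measurable_itv.
Qed.

Lemma pmeas_continuous (g : R[i] -> R[i]) :
  (forall z e, 0 < e -> exists2 d, 0 < d &
     forall w, normc (w - z) < d -> normc (g w - g z) < e) -> pmeas g.
Proof.
move=> cg; split; apply: continuous_plane_measurable => x0 y0 e e0.
- have [d d0 H] := cg (plane (x0, y0)) e e0; exists (d / 2); first by rewrite divr_gt0.
  move=> x y hx hy; apply: le_lt_trans (H (plane (x, y)) _).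
    by rewrite -ReN -ReD; exact: normc_Re.
  by apply: le_lt_trans (normc_ReIm _) _; rewrite /plane /=; lra.
- have [d d0 H] := cg (plane (x0, y0)) e e0; exists (d / 2); first by rewrite divr_gt0.
  move=> x y hx hy; apply: le_lt_trans (H (plane (x, y)) _).
    by rewrite -ImN -ImD; exact: normc_Im.
  by apply: le_lt_trans (normc_ReIm _) _; rewrite /plane /=; lra.
Qed.

Lemma pmeas_entire (f : R[i] -> R[i]) : entire f -> pmeas f.
Proof. by move=> ef; apply: pmeas_continuous => z; exact: entire_cont. Qed.

End PlaneMeasurability.

(** * Gaussian bounds on the kernel of the projection *)

Section GaussKernel.
Variable R : realType.
Local Notation P := (measurableTypeR R * measurableTypeR R)%type.
Local Notation mu2 := (leb2 R).
Implicit Types (z w : R[i]) (a b : R) (f g u : R[i] -> R[i]).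

Definition gk a z w : R := expR (- (a * normc (z - w) ^+ 2)).

Lemma gk_ge0 a z w : 0 <= gk a z w. Proof. exact: expR_ge0. Qed.
Lemma gkC a z w : gk a z w = gk a w z. Proof. by rewrite /gk normcC. Qed.

Lemma gk_sq a z w : gk a z w ^+ 2 = gk (2 * a) z w.
Proof. by rewrite /gk expr2 -expRD; congr expR; ring. Qed.

(** This is the squared form in which [schur_test] expects a kernel. *)
Lemma gk_half a z w : gk a z w = gk (a / 2) z w ^+ 2.
Proof. by rewrite gk_sq mulrC divfK. Qed.

Lemma gk_plane a (p q : P) : gk a (plane p) (plane q) =
  expR (- (a * ((p.1 - q.1) ^+ 2 + (p.2 - q.2) ^+ 2))).
Proof. by rewrite /gk normc_sq /plane !ReImE. Qed.

Lemma planeE z : z = plane (complex.Re z, complex.Im z).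
Proof. by case: z. Qed.

Lemma measurable_gk a z : measurable_fun setT (fun p : P => gk a z (plane p)).
Proof.
have -> : (fun p : P => gk a z (plane p)) = (fun p : P => expR (- (a *
    ((p.1 - complex.Re z) ^+ 2 + (p.2 - complex.Im z) ^+ 2)))).
  by apply/funext => p; rewrite gkC [in LHS](planeE z) gk_plane.
exact: (measurable_gauss2 a (complex.Re z, complex.Im z)).
Qed.

Lemma integral_gk a z : 0 < a -> (\int[mu2]_p (gk a z (plane p))%:E = (pi / a)%:E)%E.
Proof.
move=> a0; rewrite -(integral_gauss2 (complex.Re z, complex.Im z) a0).
by apply: eq_integral => p _; rewrite gkC [z in LHS]planeE gk_plane.
Qed.

Lemma measurable_gk2 a : measurable_fun setT (fun x : P * P => gk a (plane x.1) (plane x.2)).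
Proof.
under eq_fun do rewrite gk_plane.
apply: measurableT_comp => //; apply: measurableT_comp => //.
apply: measurable_funM => //; apply: measurable_funD; apply: measurable_funX;
  apply: measurable_funB; by do 2?[apply: measurableT_comp].
Qed.

Lemma inL2_gk a z : 0 < a -> inL2 (fun w => (gk a z w)%:C%C) /\
  L2norm (fun w => (gk a z w)%:C%C) <= Num.sqrt (pi / (2 * a)).
Proof.
move=> a0; apply: inL2_intro.
- by apply: cmeas_real; exact: measurable_gk.
- exact: sqrtr_ge0.
- rewrite sqr_sqrtr; last by rewrite divr_ge0 ?pi_ge0// mulr_ge0// ltW.
  rewrite -(@integral_gk (2 * a) z) ?mulr_gt0//.
  by under eq_integral do rewrite normc_rc (ger0_norm (gk_ge0 _ _ _)) gk_sq.
Qed.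

Lemma gauss_schur (a B : R) (G H : P -> R) : 0 < a -> 0 <= B ->
  measurable_fun setT G -> measurable_fun setT H ->
  (forall p, 0 <= G p) -> (forall p, 0 <= H p) ->
  (forall p, ((H p)%:E <= \int[mu2]_q (gk a (plane p) (plane q) * G q)%:E)%E) ->
  (\int[mu2]_p (G p ^+ 2)%:E <= (B ^+ 2)%:E)%E ->
  (\int[mu2]_p (H p ^+ 2)%:E <= ((pi / a * B) ^+ 2)%:E)%E.
Proof.
move=> a0 B0 mG mH G0 H0 HG GB.
pose k (p q : P) := gk (a / 2) (plane p) (plane q).
have kA p : (\int[plane_sf R]_q (k p q ^+ 2)%:E <= (pi / a)%:E)%E.
  under eq_integral => q _ do rewrite -gk_half.
  by rewrite -plane_sfE integral_gk.
have pa : 0 < pi / a :> R by rewrite divr_gt0 ?pi_gt0.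
have k0 p q : 0 <= k p q by exact: gk_ge0.
have kA' q : (\int[plane_sf R]_p (k p q ^+ 2)%:E <= (pi / a)%:E)%E.
  by under eq_integral => p _ do rewrite /k gkC; exact: kA.
have HG' p : ((H p)%:E <= \int[plane_sf R]_q (k p q ^+ 2 * G q)%:E)%E.
  rewrite -plane_sfE; apply: le_trans (HG p) _.
  by under eq_integral => q _ do rewrite gk_half.
rewrite plane_sfE in GB; rewrite plane_sfE.
exact: (schur_test pa B0 (measurable_gk2 (a / 2)) k0 kA kA' mG mH G0 H0 HG' GB).
Qed.

(** The kernel of [fockproj] without its Gaussian factor in [z]; it is holomorphic in [z]. *)
Definition fockker z w : R[i] := Cexp (conjc w * z - (normc w ^+ 2 / 2)%:C%C).

(** The real part of [conjc w * z] completes the two halves of squared moduli to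
    [- normc (z - w) ^+ 2 / 2]. *)
Lemma normc_fockker z w : expR (- (normc z ^+ 2 / 2)) * normc (fockker z w) = gk (1 / 2) z w.
Proof.
by rewrite normc_Cexp -expRD /gk !normc_sq !ReImE; congr expR; field.
Qed.

Lemma normc_fockker' z w : normc (fockker z w) = expR (normc z ^+ 2 / 2) * gk (1 / 2) z w.
Proof.
by rewrite -normc_fockker mulrA [expR _ * expR _]expRxMexpNx_1 mul1r.
Qed.

Lemma pmeas_id : pmeas (@id R[i]).
Proof. by split; [exact: measurable_fst|exact: measurable_snd]. Qed.

Lemma pmeas_fockker z : pmeas (fockker z).
Proof.
apply: cmeas_Cexp; apply: cmeasD.
  by apply: cmeasM; [apply: cmeasJ; exact: pmeas_id|exact: cmeas_cst].
apply: cmeasN; apply: cmeas_real.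
apply: measurable_funM => //; apply: measurable_funX.
by apply: cmeas_normc; exact: pmeas_id.
Qed.

Lemma fockproj_integrable u z : inL2 u ->
  cintegrable mu2 (fun p : P => fockker z (plane p) * u (plane p)).
Proof.
move=> iu; have h0 : 0 < 1 / 2 :> R by rewrite divr_gt0.
have [ig _] := inL2_gk z h0.
apply: (@cintegrable_le _ _ _ _ _
   (fun p : P => expR (normc z ^+ 2 / 2) * (normc ((gk (1 / 2) z (plane p))%:C%C) * normc (u (plane p))))).
- by apply: cmeasM; [exact: pmeas_fockker|exact: inL2_pmeas].
- by apply: measurable_funM => //; apply: measurable_funM; [exact: (L2_meas ig)|exact: (L2_meas iu)].
- move=> p; rewrite normcM normc_fockker' normc_rc (ger0_norm (gk_ge0 _ _ _)).
  by rewrite mulrA.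
under eq_integral do rewrite EFinM.
rewrite ge0_integralZl_EFin ?expR_ge0//; last 2 first.
- by move=> p _; rewrite lee_fin mulr_ge0 ?normc_ge0.
- by apply/measurable_EFinP; apply: measurable_funM; [exact: (L2_meas ig)|exact: (L2_meas iu)].
rewrite lte_mul_pinfty ?lee_fin ?expR_ge0//.
by apply: le_lt_trans (L2_cauchy_schwarz ig iu) _; exact: ltry.
Qed.

Lemma fockprojE u z : fockproj u z = (pi^-1 * expR (- (normc z ^+ 2 / 2)))%:C%C *
  cintegral mu2 (fun p : P => fockker z (plane p) * u (plane p)).
Proof. by []. Qed.

(** The factor 2 lost in [normc_cintegral_le] is compensated by the normalisation [pi^-1], since
    [2 <= pi]. *)
Lemma fockproj_le u z : inL2 u -> ((normc (fockproj u z))%:E <=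
  \int[mu2]_q (gk (1 / 2) z (plane q) * normc (u (plane q)))%:E)%E.
Proof.
move=> iu; have ifk := fockproj_integrable z iu.
have e0 : 0 <= expR (- (normc z ^+ 2 / 2)) := expR_ge0 _.
rewrite fockprojE normcM normc_rc ger0_norm; last first.
  by rewrite mulr_ge0 ?invr_ge0 ?pi_ge0 ?expR_ge0.
have := normc_cintegral_le ifk; rewrite EFinM.
have c0 : (0 <= (pi^-1 * expR (- (normc z ^+ 2 / 2)))%:E)%E.
  by rewrite lee_fin mulr_ge0 ?invr_ge0 ?pi_ge0 ?expR_ge0.
move=> /(lee_wpmul2l c0)/le_trans; apply.
rewrite muleA -EFinM.
have [mF _] := ifk.
rewrite -ge0_integralZl_EFin//; last 3 first.
- by move=> p _; rewrite lee_fin normc_ge0.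
- exact: cmeas_normcE.
- by rewrite !mulr_ge0 ?invr_ge0 ?pi_ge0 ?expR_ge0.
apply: ge0_le_integral => //.
- by move=> p _; rewrite lee_fin !mulr_ge0 ?invr_ge0 ?pi_ge0 ?expR_ge0 ?normc_ge0.
- by apply/measurable_EFinP; apply: measurable_funM => //; exact: cmeas_normc.
- by apply/measurable_EFinP; apply: measurable_funM; [exact: measurable_gk|exact: L2_meas].
move=> p _; rewrite lee_fin normcM.
have -> : pi^-1 * expR (- (normc z ^+ 2 / 2)) * 2 * (normc (fockker z (plane p)) * normc (u (plane p))) =
   (2 / pi) * ((expR (- (normc z ^+ 2 / 2)) * normc (fockker z (plane p))) * normc (u (plane p))) by ring.
rewrite normc_fockker ler_piMl ?mulr_ge0 ?gk_ge0 ?normc_ge0//.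
by rewrite ler_pdivrMr ?pi_gt0// mul1r pi_ge2.
Qed.

(** Cauchy-Schwarz against [gk (1 / 2) z], whose square has integral [pi]. *)
Lemma fockproj_sup u z : inL2 u -> normc (fockproj u z) <= Num.sqrt pi * L2norm u.
Proof.
move=> iu; rewrite -lee_fin; apply: le_trans (fockproj_le z iu) _.
have h0 : 0 < 1 / 2 :> R by rewrite divr_gt0.
have [ig gn] := inL2_gk z h0.
rewrite (_ : pi / (2 * (1 / 2)) = pi) in gn; last by field.
apply: le_trans (_ : _ <= (L2norm (fun w => (gk (1 / 2) z w)%:C%C) * L2norm u)%:E)%E _; last first.
  by rewrite lee_fin ler_wpM2r ?L2norm_ge0.
apply: le_trans (L2_cauchy_schwarz ig iu).
by under [X in (X <= _)%E]eq_integral => p _ do rewrite -[X in X * _](ger0_norm (gk_ge0 _ _ _)) -normc_rc.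
Qed.

Lemma fockprojD f g : inL2 f -> inL2 g ->
  fockproj (fun w => f w + g w) = (fun z => fockproj f z + fockproj g z).
Proof.
move=> iF iG; apply/funext => z; rewrite !fockprojE -mulrDr -cintegralD//; last 2 first.
- exact: fockproj_integrable.
- exact: fockproj_integrable.
by congr (_ * _); apply: eq_cintegral => p; rewrite mulrDr.
Qed.

Lemma fockprojZ (c : R[i]) f : inL2 f -> fockproj (fun w => c * f w) = (fun z => c * fockproj f z).
Proof.
move=> iF; apply/funext => z; rewrite !fockprojE [RHS]mulrCA -(cintegralZ c); last exact: (fockproj_integrable z iF).
by congr (_ * _); apply: eq_cintegral => p; rewrite mulrCA.
Qed.

End GaussKernel.

(** * The Gaussian mean value property *)

Section Stokes.
Variable R : realType.
Local Notation P := (measurableTypeR R * measurableTypeR R)%type.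
Local Notation mu2 := (leb2 R).
Local Notation C := (R[i]).
Local Notation Re := (@complex.Re R).
Local Notation Im := (@complex.Im R).
Implicit Types (F G : C -> C) (z w p c : C).

(** The derivative in [x] is [A + B] and the derivative in [y] is [i] times [A - B]; the
    coefficients are their components. *)
Lemma total_of_wirt F x0 y0 A B : wirt F (plane (x0, y0)) A B ->
  total_derive (fun x y => Re (F (plane (x, y)))) x0 y0 (Re A + Re B) (Im B - Im A) /\
  total_derive (fun x y => Im (F (plane (x, y)))) x0 y0 (Im A + Im B) (Re A - Re B).
Proof.
move=> H; split => e e0; have [d d0 {}H] := H e e0;
  exists (d / 2); rewrite ?divr_gt0// => x y hx hy.
- have nz : normc (plane (x, y) - plane (x0, y0)) <= `|x - x0| + `|y - y0|.
    exact: normc_ReIm.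
  have := H (plane (x, y)); rewrite (le_lt_trans nz); last by lra.
  move=> /(_ isT) h; apply: (@le_trans _ _ (e * normc (plane (x, y) - plane (x0, y0)))); last by rewrite ler_wpM2l// ltW.
  apply: le_trans h; apply: le_trans (normc_Re _).
  by rewrite le_eqVlt; apply/orP; left; apply/eqP; congr (`|_|); rewrite /plane !ReImE/=; ring.
- have nz : normc (plane (x, y) - plane (x0, y0)) <= `|x - x0| + `|y - y0|.
    exact: normc_ReIm.
  have := H (plane (x, y)); rewrite (le_lt_trans nz); last by lra.
  move=> /(_ isT) h; apply: (@le_trans _ _ (e * normc (plane (x, y) - plane (x0, y0)))); last by rewrite ler_wpM2l// ltW.
  apply: le_trans h; apply: le_trans (normc_Im _).
  by rewrite le_eqVlt; apply/orP; left; apply/eqP; congr (`|_|); rewrite /plane !ReImE/=; ring.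
Qed.

Lemma total_deriveN (X : R -> R -> R) x0 y0 x1 x2 : total_derive X x0 y0 x1 x2 ->
  total_derive (fun x y => - X x y) x0 y0 (- x1) (- x2).
Proof.
move=> H e e0; have [d d0 {}H] := H e e0; exists d => // x y hx hy.
apply: le_trans (H x y hx hy); rewrite -normrN.
by rewrite le_eqVlt; apply/orP; left; apply/eqP; congr (`|_|); ring.
Qed.

Definition ccont F := forall z (e : R), 0 < e -> exists2 d, 0 < d &
  forall w, normc (w - z) < d -> normc (F w - F z) < e.

(** The fields with components [Re F], [- Im F] and [Im F], [Re F] have divergences [2 * Re B] and
    [2 * Im B]. Both involve the conjugate derivative alone, which is why continuity is asked of [B]
    and not of the holomorphic derivative. *)
Lemma stokes F (B : C -> C) (N : R) : (forall p, exists A, wirt F p A (B p)) ->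
  ccont B -> cintegrable mu2 (fun p : P => B (plane p)) ->
  (forall w, N <= normc w -> F w = 0 /\ B w = 0) ->
  cintegral mu2 (fun p : P => B (plane p)) = 0.
Proof.
move=> HF cB iB van.
have [iR iI] := cintegrable_ReIm iB.
have van' x y : N <= `|x| \/ N <= `|y| -> F (plane (x, y)) = 0 /\ B (plane (x, y)) = 0.
  move=> h; apply: van; case: h => /le_trans; apply.
    exact: (normc_Re (plane (x, y))).
  exact: (normc_Im (plane (x, y))).
have cB' x0 y0 e : 0 < e -> exists2 d, 0 < d & forall x y, `|x - x0| < d -> `|y - y0| < d ->
    normc (B (plane (x, y)) - B (plane (x0, y0))) <= e.
  move=> e0; have [d d0 H] := cB (plane (x0, y0)) e e0.
  exists (d / 2); first by rewrite divr_gt0.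
  move=> x y hx hy; apply/ltW/H; apply: le_lt_trans (normc_ReIm _) _; rewrite /plane/=; lra.
have dbl (f : P -> R) : mu2.-integrable setT (EFin \o f) ->
    mu2.-integrable setT (EFin \o (fun q => 2 * f q)).
  by move=> fi; exact: (integrableZl measurableT 2 fi).
have h1 : \int[mu2]_p (2 * Re (B (plane p))) = 0.
  have H := @divergence_theorem R (fun x y => Re (F (plane (x, y))))
     (fun x y => - Im (F (plane (x, y)))) (fun q : R * R => 2 * Re (B (plane q))) N.
  apply: H.
  - move=> x0 y0; have [A wA] := HF (plane (x0, y0)); have [t1 t2] := total_of_wirt wA.
    do 4?eexists; split; [|exact: t1|exact: (total_deriveN t2)]; ring.
  - move=> x0 y0 e e0; have [|d d0 H] := cB' x0 y0 (e / 2); first by rewrite divr_gt0.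
    exists d => // x y hx hy; rewrite -mulrBr normrM ger0_norm// mulrC -ler_pdivlMr//.
    by apply: le_trans (H x y hx hy); rewrite -ReN -ReD normc_Re.
  - exact: dbl.
  - by move=> x y /van'[-> ->]; rewrite /= oppr0 mulr0.
have h2 : \int[mu2]_p (2 * Im (B (plane p))) = 0.
  have H := @divergence_theorem R (fun x y => Im (F (plane (x, y))))
     (fun x y => Re (F (plane (x, y)))) (fun q : R * R => 2 * Im (B (plane q))) N.
  apply: H.
  - move=> x0 y0; have [A wA] := HF (plane (x0, y0)); have [t1 t2] := total_of_wirt wA.
    do 4?eexists; split; [|exact: t2|exact: t1]; ring.
  - move=> x0 y0 e e0; have [|d d0 H] := cB' x0 y0 (e / 2); first by rewrite divr_gt0.
    exists d => // x y hx hy; rewrite -mulrBr normrM ger0_norm// mulrC -ler_pdivlMr//.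
    by apply: le_trans (H x y hx hy); rewrite -ImN -ImD normc_Im.
  - exact: dbl.
  - by move=> x y /van'[-> ->]; rewrite /= mulr0.
move: h1 h2; rewrite !RintegralZl// => /eqP h1 /eqP h2.
move: h1 h2; rewrite !mulf_eq0 !pnatr_eq0 /= => /eqP h1 /eqP h2.
by apply: cplx_eq; rewrite /cintegral/= ?h1 ?h2.
Qed.

Lemma ccontM F G : ccont F -> ccont G -> ccont (fun z => F z * G z).
Proof.
move=> cF cG z e e0.
pose M := normc (F z) + normc (G z) + 1.
have M0 : 0 < M by rewrite ltr_wpDl// addr_ge0// normc_ge0.
have e'0 : 0 < Num.min 1 (e / (2 * M)) by rewrite lt_min ltr01 divr_gt0// mulr_gt0.
have [d1 d10 H1] := cF z _ e'0; have [d2 d20 H2] := cG z _ e'0.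
exists (Num.min d1 d2); first by rewrite lt_min d10.
move=> w; rewrite lt_min => /andP[/H1 + /H2]; rewrite !lt_min => /andP[a1 a2] /andP[b1 b2].
have -> : F w * G w - F z * G z = (F w - F z) * (G w - G z) + (F w - F z) * G z + F z * (G w - G z) by ring.
move: a2 b2; rewrite !ltr_pdivlMr ?mulr_gt0// => a2 b2.
apply: le_lt_trans (normcD _ _) _.
apply: le_lt_trans (lerD (normcD _ _) (lexx _)) _; rewrite !normcM.
have := normc_ge0 (F w - F z); have := normc_ge0 (G w - G z).
have := normc_ge0 (F z); have := normc_ge0 (G z); rewrite /M in a2 b2.
set x := normc (F w - F z) in a1 a2 *; set y := normc (G w - G z) in b1 b2 *.
set a := normc (F z) in a2 b2 *; set b := normc (G z) in a2 b2 *.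
move=> b0 a0 y0 x0.
have : x * y <= y by rewrite ler_piMl// ltW.
nra.
Qed.

Lemma ccont_radial (phi : R -> R) c : continuous phi ->
  ccont (fun w => (phi (normc (w - c) ^+ 2))%:C%C).
Proof.
move=> cphi z e e0.
set s := normc (z - c) ^+ 2.
have /cvgrPdist_lt/(_ e e0)/nbhs_ballP[d d0' H] := cphi s.
have d0 : 0 < d := d0'.
pose m := normc (z - c); have m0 : 0 <= m := normc_ge0 _.
exists (Num.min 1 (d / (2 * m + 1))); first by rewrite lt_min ltr01 divr_gt0//; lra.
move=> w; rewrite lt_min ltr_pdivlMr; last by lra.
move=> /andP[w1 w2].
have -> : ((phi (normc (w - c) ^+ 2))%:C - (phi s)%:C)%C = (phi (normc (w - c) ^+ 2) - phi s)%:C%C.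
  by apply: cplx_eq; rewrite !ReImE ?subrr.
rewrite normc_rc distrC; apply: H; rewrite -ball_normE /ball_/= distrC.
have -> : normc (w - c) ^+ 2 - s = (normc (w - c) - m) * (normc (w - c) - m + 2 * m).
  by rewrite /s /m; ring.
have h : `|normc (w - c) - m| <= normc (w - z).
  by apply: le_trans (normc_dist _ _) _; rewrite (_ : w - c - (z - c) = w - z); last by ring.
rewrite normrM; apply: le_lt_trans w2; apply: ler_pM => //.
by apply: le_trans (ler_normD _ _) _; rewrite (ger0_norm (_ : 0 <= 2 * m)); lra.
Qed.

Lemma Rintegral_dct (dd : measure_display) (T : measurableType dd)
  (nu : {measure set T -> \bar R}) (f : nat -> T -> R) (l g : T -> R) :
  (forall n, measurable_fun setT (f n)) -> measurable_fun setT l ->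
  (forall q, f n q @[n --> \oo] --> l q) ->
  nu.-integrable setT (EFin \o g) -> (forall n q, `|f n q| <= g q) ->
  (\int[nu]_q f n q) @[n --> \oo] --> \int[nu]_q l q.
Proof.
move=> mf ml fl gi fg.
have [] := @dominated_convergence _ _ _ nu setT measurableT (fun n q => (f n q)%:E) (fun q => (l q)%:E) (fun q => (g q)%:E).
- by move=> n; apply/measurable_EFinP; exact: mf.
- exact/measurable_EFinP.
- by apply: aeW => p _; apply/fine_cvgP; split; [exact: nearW|exact: fl].
- exact: gi.
- by apply: aeW => p n _; rewrite lee_fin.
move=> li _; have -> : (\int[nu]_q (l q)%:E = (\int[nu]_q l q)%:E)%E.
  by rewrite /Rintegral fineK//; exact: integrable_fin_num.
by move/fine_cvgP => [_].
Qed.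

End Stokes.

(** * A radial cut-off with an explicit derivative *)

Section Cutoff.
Variable R : realType.
Implicit Types (x y s : R) (n : nat).

Definition pos (x : R) : R := Num.max x 0.

Lemma pos_ge0 x : 0 <= pos x. Proof. by rewrite le_max lexx orbT. Qed.

Lemma pos_le_exp x : pos (1 - x) <= expR (- x).
Proof. by rewrite ge_max expR_ge0 andbT; have := expR_ge1Dx (- x). Qed.

Lemma pos_eq0 x : x <= 0 -> pos x = 0. Proof. by move=> x0; rewrite /pos max_r. Qed.

Lemma pos_id x : 0 <= x -> pos x = x. Proof. by move=> x0; rewrite /pos max_l. Qed.

Lemma pos_le1 x : 0 <= x -> pos (1 - x) <= 1.
Proof. by move=> x0; rewrite ge_max ler01 andbT; lra. Qed.

Lemma continuous_pos : continuous pos.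
Proof.
move=> x; apply/cvgrPdist_lt => e e0; apply/nbhs_ballP; exists e => //= y.
rewrite /ball_/=; apply: le_lt_trans.
have := ler_norm (x - y); have := ler_norm (y - x); rewrite (distrC y x).
by case: (leP y 0) => y0; case: (leP x 0) => x0;
  rewrite ?(pos_eq0 y0) ?(pos_eq0 x0) ?(pos_id (ltW y0)) ?(pos_id (ltW x0)) ler_norml; lra.
Qed.

(** Squaring removes the kink at [0]: in all four sign cases the remainder is at most
    [(y - x) ^+ 2]. *)
Lemma is_derive_pos_sqr x : is_derive x (1:R) (fun y => pos y ^+ 2) (2 * pos x).
Proof.
have key y : `|pos y ^+ 2 - pos x ^+ 2 - 2 * pos x * (y - x)| <= (y - x) ^+ 2.
  have := sqr_ge0 (y - x); have := sqr_ge0 x; have := sqr_ge0 y.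
  have xy : (y <= 0 -> 0 < x -> x * y <= 0) /\ (0 < y -> x <= 0 -> x * y <= 0).
    by split=> ? ?; [rewrite mulr_ge0_le0// ltW|rewrite mulr_le0_ge0// ltW].
  case: (leP y 0) => y0; case: (leP x 0) => x0;
    rewrite ?(pos_eq0 y0) ?(pos_eq0 x0) ?(pos_id (ltW y0)) ?(pos_id (ltW x0)) ler_norml !expr2.
  - by lra.
  - by have := xy.1 y0 x0; lra.
  - by have := xy.2 y0 x0; lra.
  - by lra.
have H : h^-1 *: (pos (h *: (1 : R) + x) ^+ 2 - pos x ^+ 2) @[h --> 0^'] --> 2 * pos x.
  apply/cvgrPdist_lt => e e0; apply/nbhs_ballP; exists e => //= h.
  rewrite -ball_normE /ball_/= sub0r normrN => he h0.
  rewrite /GRing.scale/= mulr1.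
  have := key (h + x); rewrite addrK => k.
  have -> : 2 * pos x - h^-1 * (pos (h + x) ^+ 2 - pos x ^+ 2) =
    - (h^-1 * (pos (h + x) ^+ 2 - pos x ^+ 2 - 2 * pos x * h)) by field.
  rewrite normrN normrM normfV mulrC ltr_pdivrMr ?normr_gt0//.
  apply: le_lt_trans k _; rewrite -real_normK ?num_real// expr2.
  by rewrite ltr_pM2r ?normr_gt0.
apply: DeriveDef; last exact/cvg_lim.
by apply/cvg_ex; exists (2 * pos x).
Qed.

Lemma is_derive_pos_affine_sqr (k s : R) :
  is_derive s (1:R) (fun t => pos (1 - k * t) ^+ 2) (- (2 * k * pos (1 - k * s))).
Proof.
have ha : is_derive s (1:R) (fun t => 1 - k * t) (- k).
  by apply: is_derive_eq; rewrite /GRing.scale/=; ring.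
have := @is_derive1_comp R (fun y => pos y ^+ 2) (fun t => 1 - k * t) s _ _ (is_derive_pos_sqr _) ha.
by move=> h; apply: (is_derive_eq h); rewrite /GRing.scale/=; ring.
Qed.

Lemma is_derive_expN (s : R) : is_derive s (1:R) (fun t => expR (- t)) (- expR (- s)).
Proof.
have ha : is_derive s (1:R) (fun t : R => - t) (-1) by apply: is_derive_eq.
have := @is_derive1_comp R expR (fun t => - t) s _ _ (is_derive_expR _) ha.
by move=> h; apply: (is_derive_eq h); rewrite /GRing.scale/=; ring.
Qed.

(* As [k] grows, [cut k] tends to [expR (- s)] for [s > 0], but it vanishes at
   [0] and beyond [k]; [cut_inner k] carries its growth near [0]. *)
Definition cut_outer (k s : R) := expR (- s) * (pos (1 - k^-1 * s) ^+ 2 + 2 * k^-1 * pos (1 - k^-1 * s)).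
Definition cut_inner (k s : R) := 2 * k * pos (1 - k * s).
Definition cut (k s : R) := expR (- s) * pos (1 - k^-1 * s) ^+ 2 - pos (1 - k * s) ^+ 2.

Lemma is_derive_cut k s : is_derive s (1:R) (cut k) (cut_inner k s - cut_outer k s).
Proof.
have h := is_deriveB (is_deriveM (is_derive_expN s) (is_derive_pos_affine_sqr k^-1 s)) (is_derive_pos_affine_sqr k s).
by apply: (is_derive_eq h); rewrite /cut_inner /cut_outer /GRing.scale/=; ring.
Qed.

Lemma cut0 k : cut k 0 = 0.
Proof. by rewrite /cut !mulr0 subr0 oppr0 expR0 /pos max_l// expr1n mul1r subrr. Qed.

Lemma cut_support k s : 1 <= k -> k <= s ->
  [/\ cut k s = 0, cut_inner k s = 0 & cut_outer k s = 0].
Proof.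
move=> k1 ks; have k0 : 0 < k by lra.
have z1 : pos (1 - k^-1 * s) = 0 by rewrite pos_eq0// subr_le0 mulrC ler_pdivlMr// mul1r.
have z2 : pos (1 - k * s) = 0 by rewrite pos_eq0//; nra.
by rewrite /cut /cut_inner /cut_outer z1 z2 expr0n !(mulr0, addr0, subr0).
Qed.

Lemma cut_outer_le k s : 1 <= k -> 0 <= s -> 0 <= cut_outer k s <= 3 * expR (- s).
Proof.
move=> k1 s0; have k0 : 0 < k by lra.
have ki0 : 0 <= k^-1 by rewrite invr_ge0 ltW.
have ki : k^-1 <= 1 by rewrite invf_le1.
have e0 := expR_ge0 (- s).
have p0 := pos_ge0 (1 - k^-1 * s); have p1 := pos_le1 (mulr_ge0 ki0 s0).
rewrite /cut_outer mulrC; set x := pos _ in p0 p1 *.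
have h : 0 <= x ^+ 2 + 2 * k^-1 * x <= 3 by have := mulr_ge0 ki0 p0; nra.
by case/andP: h => h1 h2; rewrite mulr_ge0//= ler_wpM2r.
Qed.

Lemma cut_inner_le k s : 0 <= k -> 0 <= cut_inner k s <= 2 * k * expR (- (k * s)).
Proof.
move=> k0; rewrite /cut_inner !mulr_ge0 ?pos_ge0//=.
by rewrite ler_wpM2l ?mulr_ge0// pos_le_exp.
Qed.

Lemma cut_inner_eq0 k s : 0 < k -> k^-1 <= s -> cut_inner k s = 0.
Proof.
move=> k0 ks; rewrite /cut_inner pos_eq0 ?mulr0// subr_le0 mulrC -ler_pdivrMr// div1r//.
Qed.

Lemma continuous_cut_outer k : continuous (cut_outer k).
Proof.
move=> s; have c1 : {for s, continuous (fun t => pos (1 - k^-1 * t))}.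
  apply: continuous_comp; last exact: continuous_pos.
  by apply: cvgB; [exact: cvg_cst|apply: cvgM; [exact: cvg_cst|exact: cvg_id]].
apply: cvgM.
  by apply: continuous_comp; [exact: cvgN|exact: continuous_expR].
apply: cvgD; first by under eq_fun do rewrite expr2; exact: cvgM.
by apply: cvgM; [exact: cvg_cst|exact: c1].
Qed.

Lemma continuous_cut_inner k : continuous (cut_inner k).
Proof.
move=> s; have c1 : {for s, continuous (fun t => pos (1 - k * t))}.
  apply: continuous_comp; last exact: continuous_pos.
  by apply: cvgB; [exact: cvg_cst|apply: cvgM; [exact: cvg_cst|exact: cvg_id]].
by apply: cvgM; [exact: cvg_cst|exact: c1].
Qed.

Lemma cvg_cut_outer s : cut_outer n.+1%:R s @[n --> \oo] --> expR (- s).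
Proof.
have i0 : (n.+1%:R : R)^-1 @[n --> \oo] --> (0 : R) by exact: cvg_harmonic.
have c1 : pos (1 - n.+1%:R^-1 * s) @[n --> \oo] --> (1 : R).
  have h : pos (1 - 0 * s) = 1 by rewrite mul0r subr0 pos_id.
  rewrite -[X in _ --> X]h; apply: continuous_cvg; first exact: continuous_pos.
  by apply: cvgB; [exact: cvg_cst|apply: cvgM; [exact: i0|exact: cvg_cst]].
rewrite -[X in _ --> X]mulr1; apply: cvgM; first exact: cvg_cst.
have h : 1 * 1 + 2 * 0 * 1 = 1 :> R by ring.
rewrite -[X in _ --> X]h; apply: cvgD; first by under eq_fun do rewrite expr2; exact: cvgM.
by apply: cvgM => //; apply: cvgM => //; exact: cvg_cst.
Qed.

End Cutoff.

(** * The mean value property against a Gaussian and the reproducing formula *)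

Section GaussianMeanValue.
Variable R : realType.
Local Notation P := (measurableTypeR R * measurableTypeR R)%type.
Local Notation mu2 := (leb2 R).
Local Notation C := (R[i]).
Local Notation Re := (@complex.Re R).
Local Notation Im := (@complex.Im R).
Implicit Types (f g h : C -> C) (z w c : C).

Lemma wirt_eqB f p A B B' : wirt f p A B -> B = B' -> wirt f p A B'.
Proof. by move=> H <-. Qed.

Lemma realcB (x y : R) : (x - y)%:C%C = x%:C%C - y%:C%C.
Proof. by apply: cplx_eq; rewrite !ReImE ?subrr. Qed.

(* The zero of [h] at [c] compensates the pole of [1 / (w - c)], and the only
   contribution to the d-bar derivative is that of the radial factor. *)
Lemma cut_primitive_wirt h c (k : R) p : entire h -> h c = 0 ->
  exists A, wirt (fun w => h w * (w - c)^-1 * (cut k (normc (w - c) ^+ 2))%:C%C) p A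
    (h p * ((cut_inner k (normc (p - c) ^+ 2))%:C%C - (cut_outer k (normc (p - c) ^+ 2))%:C%C)).
Proof.
move=> eh hc0; have [->|pc] := eqVneq p c.
  exists 0; rewrite hc0 mul0r => e e0.
  (* At the pole, [cut k] vanishes at [0] and is of order [r ^+ 2] there, so the product is at most
     [normc (h w)] times a multiple of [r]; this is negligible against [r] because [h c = 0]. *)
  have [d1 d10 H] := is_derive_approx (is_derive_cut k 0) ltr01.
  set dc := cut_inner k 0 - cut_outer k 0 in H.
  have M0 : 0 < `|dc| + 1 by rewrite ltr_wpDl.
  have [d2 d20 Hh] := entire_cont c eh (divr_gt0 e0 M0).
  exists (Num.min (Num.min 1 d1) d2); first by rewrite !lt_min ltr01 d10.
  move=> w; rewrite !lt_min => /andP[/andP[w1 wd1] wd2].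
  rewrite subrr hc0 !mul0r !subr0; set r := normc (w - c) in w1 wd1 wd2 *.
  have r0 : 0 <= r := normc_ge0 _.
  (* At [w = c] the inverse takes its default value [0], which is the right value for the
     product. *)
  have [r0'|rn0] := eqVneq r 0.
    have -> : w - c = 0 by apply/eqP; rewrite -normc_eq0; exact/eqP.
    by rewrite invr0 mulr0 mul0r normc0 mulr_ge0// ltW.
  have rp : 0 < r by rewrite lt_def rn0.
  have rd : `|r ^+ 2 - 0| < d1.
    by rewrite subr0 ger0_norm ?sqr_ge0//; apply: le_lt_trans wd1; rewrite expr2 ler_piMl// ltW.
  have := H _ rd; rewrite cut0 !subr0 mul1r (ger0_norm (sqr_ge0 r)) => Hc.
  have cr : `|cut k (r ^+ 2)| <= (`|dc| + 1) * r ^+ 2.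
    rewrite -[cut _ _](subrK (dc * r ^+ 2)); apply: le_trans (ler_normD _ _) _.
    by rewrite normrM (ger0_norm (sqr_ge0 r)); lra.
  rewrite !normcM Normc.normcV -/r normc_rc.
  have := Hh _ wd2; rewrite hc0 subr0 => hw.
  apply: (@le_trans _ _ (e / (`|dc| + 1) * r^-1 * ((`|dc| + 1) * r ^+ 2))).
    by rewrite ler_pM ?mulr_ge0 ?normc_ge0 ?invr_ge0// ler_wpM2r ?invr_ge0// ltW.
  by rewrite le_eqVlt; apply/orP; left; apply/eqP; field; rewrite ?gt_eqF.
have [A wA] := (entireP h).1 eh p.
have wi := wirt_inv pc.
have wr := wirt_radial (is_derive_cut k (normc (p - c) ^+ 2)).
have pc' : p - c != 0 by rewrite subr_eq0.
eexists; apply: wirt_eqB (wirtM (wirtM wA wi) wr) _.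
rewrite (realcB (cut_inner _ _) (cut_outer _ _)).
move: (cut_inner _ _)%:C%C (cut_outer _ _)%:C%C (cut _ _)%:C%C => a b d.
by field.
Qed.

(** By Stokes' formula [h] has the same integral against [cut_outer] as against [cut_inner]. As the
    parameter grows, the former tends to the Gaussian integral by dominated convergence, and the
    latter to [0], because [cut_inner] has bounded mass and concentrates at the zero [c] of [h]. *)
Lemma gaussian_mean_value_null h c : entire h -> h c = 0 ->
  (\int[mu2]_p (gk 1 c (plane p) * normc (h (plane p)))%:E < +oo)%E ->
  cintegral mu2 (fun p : P => (gk 1 c (plane p))%:C%C * h (plane p)) = 0.
Proof.
move=> eh hc0 fin.
have mh : pmeas h := pmeas_entire eh.
have mnh : measurable_fun setT (fun p : P => normc (h (plane p))) := pmeas_normc mh.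
pose s (p : P) := normc (plane p - c) ^+ 2.
have s0 p : 0 <= s p by exact: sqr_ge0.
have gkE p : gk 1 c (plane p) = expR (- s p) by rewrite /gk normcC mul1r.
pose G (p : P) := gk 1 c (plane p) * normc (h (plane p)).
have G0 p : 0 <= G p by rewrite mulr_ge0 ?gk_ge0 ?normc_ge0.
have mG : measurable_fun setT G by apply: measurable_funM => //; exact: measurable_gk.
have Gi (K : R) : 0 <= K -> (\int[mu2]_p (K * G p)%:E < +oo)%E.
  move=> K0; under eq_integral do rewrite EFinM.
  rewrite ge0_integralZl_EFin//; last 2 first.
  - by move=> p _; rewrite lee_fin.
  - exact/measurable_EFinP.
  by rewrite lte_mul_pinfty.
have cradial (phi : R -> R) (K : R) : continuous phi -> 0 <= K ->
    (forall t, 0 <= t -> `|phi t| <= K * expR (- t)) ->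
    ccont (fun w => h w * (phi (normc (w - c) ^+ 2))%:C%C) /\
    cintegrable mu2 (fun p : P => h (plane p) * (phi (s p))%:C%C).
  move=> cphi K0 phiK.
  have cc : ccont (fun w => h w * (phi (normc (w - c) ^+ 2))%:C%C).
    by apply: ccontM; [move=> z; exact: entire_cont|exact: ccont_radial].
  split=> //; apply: (@cintegrable_le _ _ _ _ _ (fun p : P => K * G p)).
  - exact: (pmeas_continuous cc).
  - by apply: measurable_funM.
  - move=> p; rewrite normcM normc_rc mulrC /G mulrA ler_wpM2r ?normc_ge0//.
    by rewrite gkE phiK.
  - exact: Gi.
have kn1 n : 1 <= (n.+1%:R : R) by rewrite ler1n.
have outer_bd n (t : R) : 0 <= t -> `|cut_outer n.+1%:R t| <= 3 * expR (- t).
  by move=> t0; have /andP[k0 k1] := cut_outer_le (kn1 n) t0; rewrite ger0_norm.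
have inner_bd n (t : R) : 0 <= t -> `|cut_inner n.+1%:R t| <= 2 * n.+1%:R * expR (- t).
  move=> t0; have /andP[k0 k1] := cut_inner_le t (ler0n R n.+1); rewrite ger0_norm//.
  apply: le_trans k1 _; rewrite ler_wpM2l ?mulr_ge0 ?ler0n// ler_expR lerN2.
  by rewrite ler_peMl.
have outc n := cradial _ _ (@continuous_cut_outer R n.+1%:R) (ler0n R 3) (outer_bd n).
have outi n := cradial _ _ (@continuous_cut_inner R n.+1%:R) (mulr_ge0 (ler0n R 2) (ler0n R n.+1)) (inner_bd n).
pose I n := cintegral mu2 (fun p : P => h (plane p) * (cut_outer n.+1%:R (s p))%:C%C).
have IE n : I n = cintegral mu2 (fun p : P => h (plane p) * (cut_inner n.+1%:R (s p))%:C%C).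
  have [oc oi] := outc n; have [ic ii] := outi n.
  have := @stokes R (fun w => h w * (w - c)^-1 * (cut n.+1%:R (normc (w - c) ^+ 2))%:C%C)
    (fun p => h p * ((cut_inner n.+1%:R (normc (p - c) ^+ 2))%:C%C - (cut_outer n.+1%:R (normc (p - c) ^+ 2))%:C%C))
    (normc c + n.+1%:R) (fun p => cut_primitive_wirt n.+1%:R p eh hc0).
  have EE : (fun p : P => h (plane p) * ((cut_inner n.+1%:R (normc (plane p - c) ^+ 2))%:C%C - (cut_outer n.+1%:R (normc (plane p - c) ^+ 2))%:C%C)) =
    (fun p : P => h (plane p) * (cut_inner n.+1%:R (s p))%:C%C - h (plane p) * (cut_outer n.+1%:R (s p))%:C%C).
    by apply/funext => p; rewrite mulrBr.
  rewrite EE cintegralB// => H; apply/esym/eqP; rewrite -subr_eq0 -/(I n); apply/eqP; apply: H.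
  - move=> z e e0.
    have [|d1 d10 H1] := oc z (e / 2); first by rewrite divr_gt0.
    have [|d2 d20 H2] := ic z (e / 2); first by rewrite divr_gt0.
    exists (Num.min d1 d2); first by rewrite lt_min d10.
    move=> w; rewrite lt_min => /andP[/H1 h1 /H2 h2]; rewrite !mulrBr.
    set a := h w * _ in h2 *; set b := h z * _ in h2 *; set a' := h w * _ in h1 *; set b' := h z * _ in h1 *.
    have -> : a - a' - (b - b') = (a - b) - (a' - b') by ring.
    by apply: le_lt_trans (normcB _ _) _; lra.
  - have := cintegrableD ii (cintegrableZ (-1) oi).
    congr (cintegrable mu2 _); apply/funext => p; ring.
  - move=> w wn; have rn : n.+1%:R <= normc (w - c).
      by have := normcD (w - c) c; rewrite subrK; lra.
    have [] := @cut_support R n.+1%:R (normc (w - c) ^+ 2) (kn1 n).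
      by apply: (le_trans rn); rewrite expr2 ler_peMl ?normc_ge0//; exact: (le_trans (kn1 n)).
    by move=> -> -> ->; rewrite subrr !mulr0.
have Ismall e : 0 < e -> \forall n \near \oo, normc (I n) <= e.
  (* The majorant [2 * k * gk k c] of [cut_inner] has integral [2 * pi] for every [k]; the other
     factor 2 comes from [normc_cintegral_le]. *)
  move=> e0; have e'0 : 0 < e / (4 * pi) by rewrite divr_gt0// mulr_gt0// pi_gt0.
  have [d d0 Hd] := entire_cont c eh e'0.
  near=> n; rewrite IE; have [_ ii] := outi n.
  have k0 : 0 < (n.+1%:R : R) by rewrite ltr0n.
  have kd : (n.+1%:R : R)^-1 < d ^+ 2.
    have := near (near_infty_natSinv_lt (PosNum (exprn_gt0 2 d0))) n.
    by apply.
  rewrite -lee_fin; apply: le_trans (normc_cintegral_le ii) _.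
  apply: (@le_trans _ _ (2%:E * \int[mu2]_p (e / (4 * pi) * (2 * n.+1%:R) * gk n.+1%:R c (plane p))%:E)%E).
    apply: lee_wpmul2l; first by rewrite lee_fin.
    apply: ge0_le_integral.
    - exact: measurableT.
    - by move=> p _; rewrite lee_fin normc_ge0.
    - by have [m _] := ii; exact: cmeas_normcE.
    - by apply/measurable_EFinP/measurable_funM; [exact: measurable_cst|exact: measurable_gk].
    - move=> p _; rewrite lee_fin normcM normc_rc.
      have /andP[i0 i1] := cut_inner_le (s p) (ltW k0); rewrite (ger0_norm i0).
      have [sk|sk] := leP (n.+1%:R)^-1 (s p).
        by rewrite cut_inner_eq0// mulr0; apply: mulr_ge0; [apply: mulr_ge0; [exact: ltW|exact: mulr_ge0]|exact: gk_ge0].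
      rewrite -mulrA; apply: ler_pM; rewrite ?normc_ge0//.
        rewrite -[h _]subr0 -hc0; apply/ltW/Hd.
        rewrite -(@ltr_pXn2r _ 2) ?nnegrE ?normc_ge0 ?(ltW d0)//.
        exact: lt_trans sk kd.
      by rewrite /gk normcC.
  under eq_integral do rewrite EFinM.
  rewrite ge0_integralZl_EFin; last 4 first.
  - exact: measurableT.
  - by move=> p _; rewrite lee_fin gk_ge0.
  - by apply/measurable_EFinP; exact: measurable_gk.
  - by apply: mulr_ge0; [exact: ltW|exact: mulr_ge0].
  rewrite integral_gk// -!EFinM lee_fin le_eqVlt; apply/orP; left; apply/eqP.
  move: k0 (pi_gt0 R); clear; move: (n.+1%:R : R) (pi : R) => N q N0 q0.
  by field; rewrite !gt_eqF.
have real_lim (r : R) (u : nat -> R) : u n @[n --> \oo] --> r ->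
    (forall e, 0 < e -> \forall n \near \oo, `|u n| <= e) -> r = 0.
  move=> ur u0; have u00 : u n @[n --> \oo] --> (0 : R).
    apply/cvgrPdist_le => e e0; near=> n; rewrite sub0r normrN.
    by near: n; exact: u0.
  exact: (cvg_unique _ ur u00).
have mgk : measurable_fun setT (fun p : P => gk 1 c (plane p)) by exact: measurable_gk.
have Gint : mu2.-integrable setT (EFin \o (fun p : P => 3 * G p)).
  apply/integrableP; split; first by apply/measurable_EFinP; exact: measurable_funM.
  have g3 p : `|3 * G p| = 3 * G p by rewrite ger0_norm// mulr_ge0.
  rewrite (eq_integral (fun p : P => (3 * G p)%:E)); first exact: Gi.
  by move=> p _; rewrite /= g3.
have [mRe mIm] := mh.
have dct (F : R[i] -> R) : (forall z, `|F z| <= normc z) ->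
    measurable_fun setT (fun p : P => F (h (plane p))) ->
    \int[mu2]_p (F (h (plane p)) * cut_outer n.+1%:R (s p)) @[n --> \oo] -->
    \int[mu2]_p (F (h (plane p)) * gk 1 c (plane p)).
  move=> Fn mF; apply: (Rintegral_dct _ _ _ Gint).
  - move=> n; apply: measurable_funM => //.
    have := pmeas_continuous (ccont_radial c (@continuous_cut_outer R n.+1%:R)).
    by case.
  - exact: measurable_funM.
  - move=> p; apply: cvgM; first exact: cvg_cst.
    by rewrite gkE; exact: cvg_cut_outer.
  - move=> n p; rewrite normrM mulrC /G mulrA ler_pM// gkE; exact: outer_bd.
apply: cplx_eq; rewrite /cintegral /=.
- rewrite (@eq_Rintegral _ _ _ mu2 setT (fun p : P => Re (h (plane p)) * gk 1 c (plane p))); last first.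
    by move=> p _; rewrite ReM /= mul0r subr0 mulrC.
  apply: (real_lim _ _ (dct Re (@normc_Re R) mRe)) => e e0.
  near=> n; apply: le_trans (_ : normc (I n) <= e); last by near: n; exact: Ismall.
  rewrite (_ : \int[mu2]_p _ = Re (I n)); first exact: normc_Re.
  by apply: eq_Rintegral => p _; rewrite ReM /= mulr0 subr0.
- rewrite (@eq_Rintegral _ _ _ mu2 setT (fun p : P => Im (h (plane p)) * gk 1 c (plane p))); last first.
    by move=> p _; rewrite ImM /= mul0r addr0 mulrC.
  apply: (real_lim _ _ (dct Im (@normc_Im R) mIm)) => e e0.
  near=> n; apply: le_trans (_ : normc (I n) <= e); last by near: n; exact: Ismall.
  rewrite (_ : \int[mu2]_p _ = Im (I n)); first exact: normc_Im.
  by apply: eq_Rintegral => p _; rewrite ImM /= mulr0 add0r.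
Unshelve. all: by end_near.
Qed.


Lemma entireM f g : entire f -> entire g -> entire (fun z => f z * g z).
Proof.
move=> /entireP ef /entireP eg; apply/entireP => z.
have [A wA] := ef z; have [B wB] := eg z.
by eexists; apply: wirt_eqB (wirtM wA wB) _; rewrite mul0r mulr0 addr0.
Qed.

Lemma entireB_cst f c : entire f -> entire (fun z => f z - c).
Proof.
move=> /entireP ef; apply/entireP => z; have [A wA] := ef z.
by exists A; exact: wirtB.
Qed.

Lemma entire_Cexp_linear a : entire (fun z => Cexp (a * z)).
Proof.
apply/entireP => z.
have wl : wirt (fun z => a * z) z a 0.
  move=> e e0; exists 1 => // w _.
  have -> : a * w - a * z - a * (w - z) - 0 * conjc (w - z) = 0 by ring.
  by rewrite normc0 mulr_ge0 ?normc_ge0 ?ltW.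
have := wirt_comp wl (wirt_Cexp (a * z)) => h; eexists; apply: wirt_eqB h _.
by rewrite mulr0.
Qed.

(** The null case for [g - g c], together with the mass [pi] of [gk 1 c]. *)
Lemma gaussian_mean_value g c : entire g ->
  cintegrable mu2 (fun p : P => (gk 1 c (plane p))%:C%C * g (plane p)) ->
  cintegral mu2 (fun p : P => (gk 1 c (plane p))%:C%C * g (plane p)) = pi%:C%C * g c.
Proof.
move=> eg ig.
have igk : cintegrable mu2 (fun p : P => (gk 1 c (plane p))%:C%C).
  split; first by apply: cmeas_real; exact: measurable_gk.
  under eq_integral do rewrite normc_rc (ger0_norm (gk_ge0 _ _ _)).
  by rewrite integral_gk// ltry.
have igc := cintegrableZ (g c) igk.
have Igk : cintegral mu2 (fun p : P => (gk 1 c (plane p))%:C%C) = pi%:C%C.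
  apply: cplx_eq; rewrite /cintegral /=.
    by rewrite /Rintegral integral_gk// divr1.
  by rewrite /Rintegral integral0.
have h0 : cintegral mu2 (fun p : P => (gk 1 c (plane p))%:C%C * (g (plane p) - g c)) = 0.
  apply: (@gaussian_mean_value_null (fun z => g z - g c)).
  - exact: entireB_cst.
  - by rewrite subrr.
  - have [_] := cintegrableD ig (cintegrableZ (-1) igc).
    apply: le_lt_trans; rewrite le_eqVlt; apply/orP; left; apply/eqP.
    apply: eq_integral => p _.
    have -> : (gk 1 c (plane p))%:C%C * g (plane p) + -1 * (g c * (gk 1 c (plane p))%:C%C) =
       (gk 1 c (plane p))%:C%C * (g (plane p) - g c) by ring.
    by rewrite normcM normc_rc (ger0_norm (gk_ge0 _ _ _)).
apply/eqP; rewrite -subr_eq0 mulrC -Igk -cintegralZ// -cintegralB//; apply/eqP.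
rewrite -[RHS]h0; apply: eq_cintegral => p; ring.
Qed.

(** Multiplying [f] by the entire function [Cexp (- conjc z * w)] of [w] recentres the Gaussian
    weight at [z], so that the mean value property applies at [z]; all exponential factors then
    cancel but the one contained in [u z]. *)
Lemma fockproj_id u z : fock u -> fockproj u z = u z.
Proof.
move=> [[f ef uE] iu].
have ifk := fockproj_integrable z iu.
pose g w := f w * Cexp (- conjc z * w).
have eg : entire g := entireM ef (@entire_Cexp_linear _).
have E w : fockker z w * u w = (expR (normc z ^+ 2))%:C%C * ((gk 1 z w)%:C%C * g w).
  rewrite uE /fockker /g /gk -!Cexp_rc.
  set e1 := conjc w * z - _; set e2 := (- (normc w ^+ 2 / 2))%:C%C.
  set e3 := (normc z ^+ 2)%:C%C; set e4 := (- (1 * _))%:C%C; set e5 := - conjc z * w.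
  transitivity (Cexp (e1 + e2) * f w); first by rewrite mulrA -CexpD.
  transitivity (Cexp (e3 + e4 + e5) * f w); last by rewrite (CexpD (e3 + e4) e5) (CexpD e3 e4); ring.
  congr (Cexp _ * _); rewrite /e1 /e2 /e3 /e4 /e5.
  by apply: cplx_eq; rewrite !ReImE; do ?rewrite normc_sq; do ?rewrite ReImE; field.
have ig : cintegrable mu2 (fun p : P => (gk 1 z (plane p))%:C%C * g (plane p)).
  have := cintegrableZ (expR (- normc z ^+ 2))%:C%C ifk.
  congr (cintegrable mu2 _); apply/funext => p; rewrite E mulrA -!Cexp_rc -CexpD.
  rewrite (_ : _ + _ = 0) ?Cexp0 ?mul1r//.
  by apply: cplx_eq; rewrite !ReImE; ring.
have -> : fockproj u z = (pi^-1 * expR (- (normc z ^+ 2 / 2)))%:C%C *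
    cintegral mu2 (fun p : P => (expR (normc z ^+ 2))%:C%C * ((gk 1 z (plane p))%:C%C * g (plane p))).
  by rewrite fockprojE; congr (_ * _); apply: eq_cintegral => p; exact: E.
rewrite cintegralZ; last exact: ig.
rewrite (gaussian_mean_value eg ig).
rewrite uE /g.
have -> : (pi^-1 * expR (- (normc z ^+ 2 / 2)))%:C%C = (pi^-1)%:C%C * Cexp (- (normc z ^+ 2 / 2))%:C%C.
  by rewrite Cexp_rc; apply: cplx_eq; rewrite !ReImE; ring.
rewrite -!Cexp_rc.
have piV : (pi^-1)%:C%C * (pi : R)%:C%C = 1.
  by apply: cplx_eq; rewrite !ReImE ?mulr0 ?mul0r ?subr0 ?addr0// mulVf// gt_eqF// pi_gt0.
transitivity (((pi^-1)%:C%C * pi%:C%C) * f z * (Cexp (- (normc z ^+ 2 / 2))%:C%C * Cexp (normc z ^+ 2)%:C%C * Cexp (- conjc z * z))); first by ring.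
rewrite piV mul1r -!CexpD mulrC; congr (Cexp _ * _).
by apply: cplx_eq; rewrite !ReImE; do ?rewrite normc_sq; field.
Qed.

End GaussianMeanValue.

(** * The projection in weighted spaces *)

Section FockSpace.
Variable R : realType.
Local Notation P := (measurableTypeR R * measurableTypeR R)%type.
Local Notation mu2 := (leb2 R).
Local Notation C := (R[i]).
Implicit Types (f g h u v : C -> C) (z w c : C).

Lemma gk_L2_integrable (a M : R) g z : 0 < a -> 0 <= M -> inL2 g ->
  measurable_fun setT (fun p : P => M * (gk a z (plane p) * normc (g (plane p)))) /\
  (\int[mu2]_p (M * (gk a z (plane p) * normc (g (plane p))))%:E < +oo)%E.
Proof.
move=> a0 M0 ig.
have [igk _] := inL2_gk z a0.
have mgn : measurable_fun setT (fun p : P => gk a z (plane p) * normc (g (plane p))).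
  by apply: measurable_funM; [exact: measurable_gk|exact: (L2_meas ig)].
split; first exact: measurable_funM.
under eq_integral do rewrite EFinM.
rewrite ge0_integralZl_EFin//; last 2 first.
- by move=> p _; rewrite lee_fin mulr_ge0 ?gk_ge0 ?normc_ge0.
- exact/measurable_EFinP.
rewrite lte_mul_pinfty//.
apply: le_lt_trans (le_lt_trans (L2_cauchy_schwarz igk ig) (ltry _)).
apply: ge0_le_integral.
- exact: measurableT.
- by move=> p _; rewrite lee_fin mulr_ge0 ?gk_ge0 ?normc_ge0.
- exact/measurable_EFinP.
- by apply/measurable_EFinP; apply: measurable_funM; [exact: (L2_meas igk)|exact: (L2_meas ig)].
by move=> p _; rewrite lee_fin normc_rc (ger0_norm (gk_ge0 _ _ _)).
Qed.

(** From [(kappa - r / 2) ^+ 2 >= 0]: half of the Gaussian exponent pays for the weight, and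
    [expR (kappa ^+ 2)] is the loss. *)
Lemma gk_weight (kappa : R) z w :
  gk (1 / 2) z w * expR (kappa * normc (z - w)) <= expR (kappa ^+ 2) * gk (1 / 4) z w.
Proof.
rewrite /gk -!expRD ler_expR; set r := normc _.
by have := sqr_ge0 (kappa - r / 2); lra.
Qed.

(** Supplies the integrable majorant for the Taylor remainder of the kernel in [z]. The 6 comes from
    [1 + x + x ^+ 2 <= 6 * expR x]; the remaining [expR (2 * x)] is moved from [w] to [z - w] and
    absorbed by [gk_weight] at rate 2. *)
Lemma fockker_growth z : exists2 M : R, 0 <= M & forall w,
  (1 + normc w + normc w ^+ 2) * expR (normc w) * normc (fockker z w) <= M * gk (1 / 4) z w.
Proof.
exists (6 * (expR (normc z ^+ 2 / 2) * expR (2 * normc z) * expR (2 ^+ 2))).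
  by rewrite !mulr_ge0 ?expR_ge0.
move=> w; rewrite normc_fockker'; set x := normc w.
have x0 : 0 <= x := normc_ge0 _.
have e1 : 1 <= expR x by rewrite -expR0 ler_expR.
have e2 : x <= expR x by have := expR_ge1Dx x; lra.
have e3 : x ^+ 2 <= 4 * expR x.
  have h := expR_ge1Dx (x / 2).
  have -> : x = x / 2 + x / 2 by field.
  rewrite expRD; set y := x / 2 in h *; set t := expR y in h *.
  have y0 : 0 <= y by rewrite divr_ge0.
  nra.
have e4 : (1 + x + x ^+ 2) * expR x <= 6 * expR (2 * x).
  have -> : 2 * x = x + x by ring.
  by rewrite expRD mulrA ler_wpM2r ?expR_ge0//; lra.
have e5 : expR (2 * x) <= expR (2 * normc z) * expR (2 * normc (z - w)).
  rewrite -expRD ler_expR -mulrDr ler_wpM2l//.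
  by have := normcD z (w - z); rewrite addrC subrK (normcC w).
have e6 := gk_weight 2 z w.
have g0 := gk_ge0 (1 / 2) z w; have E0 := expR_ge0 (normc z ^+ 2 / 2).
apply: (@le_trans _ _ (6 * (expR (2 * normc z) * expR (2 * normc (z - w))) * (expR (normc z ^+ 2 / 2) * gk (1 / 2) z w))).
  apply: ler_wpM2r; first by rewrite mulr_ge0.
  by apply: le_trans e4 _; rewrite ler_wpM2l.
have -> : 6 * (expR (2 * normc z) * expR (2 * normc (z - w))) * (expR (normc z ^+ 2 / 2) * gk (1 / 2) z w) =
  6 * (expR (normc z ^+ 2 / 2) * expR (2 * normc z)) * (gk (1 / 2) z w * expR (2 * normc (z - w))) by ring.
have -> : 6 * (expR (normc z ^+ 2 / 2) * expR (2 * normc z) * expR (2 ^+ 2)) * gk (1 / 4) z w =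
  6 * (expR (normc z ^+ 2 / 2) * expR (2 * normc z)) * (expR (2 ^+ 2) * gk (1 / 4) z w) by ring.
by rewrite ler_wpM2l// !mulr_ge0 ?expR_ge0.
Qed.

Lemma fockkerD z (h : C) w : fockker (z + h) w = fockker z w * Cexp (conjc w * h).
Proof. by rewrite /fockker -CexpD; congr Cexp; ring. Qed.

Lemma pmeas_conj : pmeas (@conjc R).
Proof. by apply: cmeasJ; exact: pmeas_id. Qed.

(* Differentiation under the integral sign, by the second order Taylor bound
   of the exponential. *)
Lemma entire_fock_transform g : inL2 g ->
  entire (fun z => cintegral mu2 (fun p : P => fockker z (plane p) * g (plane p))).
Proof.
move=> ig; apply/entireP => z.
have [M M0 HM] := fockker_growth z.
have h4 : 0 < 1 / 4 :> R by rewrite divr_gt0.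
have [mb fb] := gk_L2_integrable z h4 M0 ig.
have mk := pmeas_fockker z; have mg := inL2_pmeas ig.
have bd w : normc (fockker z w) * normc (g w) + normc w * (normc (fockker z w) * normc (g w)) +
    normc w ^+ 2 * expR (normc w) * (normc (fockker z w) * normc (g w)) <= M * (gk (1 / 4) z w * normc (g w)).
  have -> : M * (gk (1 / 4) z w * normc (g w)) = M * gk (1 / 4) z w * normc (g w) by ring.
  apply: le_trans (ler_wpM2r (normc_ge0 (g w)) (HM w)).
  have e1 : 1 <= expR (normc w) by rewrite -expR0 ler_expR normc_ge0.
  have -> : (1 + normc w + normc w ^+ 2) * expR (normc w) * normc (fockker z w) * normc (g w) =
    (1 + normc w) * expR (normc w) * (normc (fockker z w) * normc (g w)) +
    normc w ^+ 2 * expR (normc w) * (normc (fockker z w) * normc (g w)) by ring.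
  rewrite lerD2r; set X := normc (fockker z w) * normc (g w).
  have X0 : 0 <= X by rewrite mulr_ge0 ?normc_ge0.
  have -> : X + normc w * X = (1 + normc w) * X by ring.
  by rewrite ler_wpM2r// ler_peMr// addr_ge0 ?normc_ge0.
have T1 w : 0 <= normc w * (normc (fockker z w) * normc (g w)) by rewrite !mulr_ge0 ?normc_ge0.
have T0 w : 0 <= normc (fockker z w) * normc (g w) by rewrite !mulr_ge0 ?normc_ge0.
have T2 w : 0 <= normc w ^+ 2 * expR (normc w) * (normc (fockker z w) * normc (g w)).
  by rewrite !mulr_ge0 ?normc_ge0 ?expR_ge0.
have i0 : cintegrable mu2 (fun p : P => fockker z (plane p) * g (plane p)).
  exact: fockproj_integrable.
have i1 : cintegrable mu2 (fun p : P => conjc (plane p) * (fockker z (plane p) * g (plane p))).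
  apply: (cintegrable_le _ mb _ fb).
    by apply: cmeasM; [exact: pmeas_conj|exact: cmeasM].
  move=> p; rewrite !normcM normcJ; apply: le_trans (bd (plane p)).
  by have := T0 (plane p); have := T2 (plane p); lra.
exists (cintegral mu2 (fun p : P => conjc (plane p) * (fockker z (plane p) * g (plane p)))).
have [B B0 HB] : exists2 B : R, 0 <= B & (\int[mu2]_p (M * (gk (1 / 4) z (plane p) * normc (g (plane p))))%:E = B%:E)%E.
  exists (fine (\int[mu2]_p (M * (gk (1 / 4) z (plane p) * normc (g (plane p))))%:E)%E).
    by apply: fine_ge0; apply: integral_ge0 => p _; rewrite lee_fin !mulr_ge0 ?gk_ge0 ?normc_ge0.
  rewrite fineK// ge0_fin_numE//.
  by apply: integral_ge0 => p _; rewrite lee_fin !mulr_ge0 ?gk_ge0 ?normc_ge0.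
(* The 8 is the 4 of [Cexp_taylor] times the 2 of [normc_cintegral_le]; the [+ 1] covers [B = 0]. *)
move=> e e0; exists (Num.min 1 (e / (8 * B + 1))).
  by rewrite lt_min ltr01 divr_gt0//; lra.
move=> z'; set h := z' - z; rewrite lt_min => /andP[h1 h2].
have -> : z' = z + h by rewrite /h addrC subrK.
have ih := fockproj_integrable (z + h) ig.
rewrite mul0r subr0 [_ * h]mulrC -cintegralZ// -cintegralB// -cintegralB//; last 2 first.
- have := cintegrableD ih (cintegrableZ (-1) i0).
  by congr (cintegrable mu2 _); apply/funext => p; ring.
- exact: cintegrableZ.
pose D w := fockker z w * g w * (Cexp (conjc w * h) - 1 - conjc w * h).
have -> : cintegral mu2 (fun p : P => fockker (z + h) (plane p) * g (plane p) - fockker z (plane p) * g (plane p) -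
    h * (conjc (plane p) * (fockker z (plane p) * g (plane p)))) =
  cintegral mu2 (fun p : P => D (plane p)).
  by apply: eq_cintegral => p; rewrite /D fockkerD; ring.
have nh0 : 0 <= normc h := normc_ge0 _.
have Dbd w : normc (D w) <= 4 * normc h ^+ 2 * (M * (gk (1 / 4) z w * normc (g w))).
  rewrite /D !normcM.
  apply: (@le_trans _ _ (normc (fockker z w) * normc (g w) * (4 * (normc w * normc h) ^+ 2 * expR (normc w)))).
    apply: ler_wpM2l; first exact: T0.
    apply: le_trans (Cexp_taylor _) _; rewrite normcM normcJ.
    apply: ler_wpM2l; first by apply: mulr_ge0; [|exact: sqr_ge0].
    by rewrite ler_expR ler_piMr ?normc_ge0// ltW.
  have -> : normc (fockker z w) * normc (g w) * (4 * (normc w * normc h) ^+ 2 * expR (normc w)) =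
    4 * normc h ^+ 2 * (normc w ^+ 2 * expR (normc w) * (normc (fockker z w) * normc (g w))) by ring.
  rewrite ler_wpM2l ?mulr_ge0 ?sqr_ge0//; apply: le_trans (bd w).
  by have := T0 w; have := T1 w; lra.
have mD : pmeas D.
  apply: cmeasM; first exact: cmeasM.
  have mc : cmeas (fun p : P => conjc (plane p) * h) by apply: cmeasM; [exact: pmeas_conj|exact: cmeas_cst].
  apply: cmeasD; last exact: cmeasN.
  by apply: cmeasD; [exact: cmeas_Cexp|exact: cmeas_cst].
have mb' : measurable_fun setT (fun p : P => 4 * normc h ^+ 2 * (M * (gk (1 / 4) z (plane p) * normc (g (plane p))))).
  exact: measurable_funM.
have fb' : (\int[mu2]_p (4 * normc h ^+ 2 * (M * (gk (1 / 4) z (plane p) * normc (g (plane p)))))%:E = (4 * normc h ^+ 2 * B)%:E)%E.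
  under eq_integral do rewrite EFinM.
  rewrite ge0_integralZl_EFin; last 4 first.
  - exact: measurableT.
  - by move=> p _; rewrite lee_fin !mulr_ge0 ?gk_ge0 ?normc_ge0.
  - exact/measurable_EFinP.
  - by rewrite !mulr_ge0 ?sqr_ge0.
  by rewrite HB -EFinM.
have iD : cintegrable mu2 (fun p : P => D (plane p)).
  apply: (cintegrable_le mD mb') => [p|]; first exact: Dbd.
  by rewrite fb' ltry.
rewrite -lee_fin; apply: le_trans (normc_cintegral_le iD) _.
apply: (@le_trans _ _ (2%:E * (4 * normc h ^+ 2 * B)%:E)%E).
  apply: lee_wpmul2l; first by rewrite lee_fin.
  rewrite -fb'; apply: ge0_le_integral.
  - exact: measurableT.
  - by move=> p _; rewrite lee_fin normc_ge0.
  - exact: cmeas_normcE.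
  - exact/measurable_EFinP.
  - by move=> p _; rewrite lee_fin.
rewrite -EFinM lee_fin.
have h3 : normc h * (8 * B + 1) <= e by rewrite -ler_pdivlMr ?ltW//; lra.
have -> : 2 * (4 * normc h ^+ 2 * B) = normc h * (8 * B) * normc h by ring.
by rewrite ler_wpM2r//; nra.
Qed.

Lemma entire_gaussian_pmeas f : entire f ->
  pmeas (fun z => (expR (- (normc z ^+ 2 / 2)))%:C%C * f z).
Proof.
move=> ef; apply: cmeasM; last exact: pmeas_entire.
apply: cmeas_real; apply: measurableT_comp => //; apply: measurableT_comp => //.
apply: measurable_funM => //; apply: measurable_funX.
by apply: cmeas_normc; exact: pmeas_id.
Qed.

Lemma fockproj_pmeas g : inL2 g -> pmeas (fockproj g).
Proof.
move=> ig.
have := entire_gaussian_pmeas (entire_fock_transform ig).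
move=> /(cmeasM (cmeas_cst P (pi^-1)%:C%C)); congr cmeas.
apply/funext => p; rewrite fockprojE mulrA; congr (_ * _).
by apply: cplx_eq; rewrite !ReImE; ring.
Qed.

(* The weights for which the Gaussian bound on the kernel of the projection
   still passes Schur's test. *)
Definition tame_weight (kappa : R) (om : C -> R) :=
  [/\ measurable_fun setT (fun p : P => om (plane p)), forall z, 1 <= om z &
      forall z w, om z <= om w * expR (kappa * normc (z - w))].

Definition wt (om : C -> R) u : C -> C := fun z => (om z)%:C%C * u z.

(** The loss in [gk_weight] times the mass [pi / (1 / 4)] of the kernel [gk (1 / 4)] left for
    Schur's test. *)
Definition schur_cst (kappa : R) : R := expR (kappa ^+ 2) * (pi / (1 / 4)).

Lemma schur_cst_gt0 kappa : 0 < schur_cst kappa.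
Proof. by rewrite mulr_gt0 ?expR_gt0// divr_gt0 ?pi_gt0// divr_gt0. Qed.

Lemma wt_pmeas kappa om u : tame_weight kappa om -> pmeas u -> pmeas (wt om u).
Proof. by move=> [mo _ _] mu; apply: cmeasM => //; exact: cmeas_real. Qed.

Lemma normc_wt kappa om u z : tame_weight kappa om -> normc (wt om u z) = om z * normc (u z).
Proof.
by move=> [_ o1 _]; rewrite normcM normc_rc ger0_norm//; apply: le_trans (o1 z).
Qed.

Lemma wt_inL2 kappa om u : tame_weight kappa om -> pmeas u -> inL2 (wt om u) ->
  inL2 u /\ L2norm u <= L2norm (wt om u).
Proof.
move=> to mu iw; rewrite -[X in _ <= X]mul1r; apply: L2_le => // z.
rewrite mul1r (normc_wt _ _ to) ler_peMl ?normc_ge0//.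
by have [] := to.
Qed.

Lemma fockproj_weighted kappa om g : 0 <= kappa -> tame_weight kappa om -> pmeas g ->
  inL2 (wt om g) ->
  inL2 (wt om (fockproj g)) /\
  L2norm (wt om (fockproj g)) <= schur_cst kappa * L2norm (wt om g).
Proof.
move=> k0 to mg iw.
have [ig _] := wt_inL2 to mg iw.
have [mo o1 oo] := to.
have o0 z : 0 <= om z by apply: le_trans (o1 z).
have mp := wt_pmeas to (fockproj_pmeas ig).
apply: inL2_intro => //; first by rewrite mulr_ge0 ?L2norm_ge0// ltW// schur_cst_gt0.
(* The loss is charged to [G], so that the kernel is exactly [gk (1 / 4)]. *)
pose G (p : P) := expR (kappa ^+ 2) * normc (wt om g (plane p)).
pose H (p : P) := normc (wt om (fockproj g) (plane p)).
have E : schur_cst kappa * L2norm (wt om g) = pi / (1 / 4) * (expR (kappa ^+ 2) * L2norm (wt om g)).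
  by rewrite /schur_cst; ring.
rewrite E.
have mG : measurable_fun setT G by apply: measurable_funM => //; exact: (L2_meas iw).
have mH : measurable_fun setT H by exact: pmeas_normc.
have h4 : 0 < 1 / 4 :> R by rewrite divr_gt0.
apply: (@gauss_schur R (1 / 4) _ G H h4 _ mG mH).
- by rewrite mulr_ge0 ?expR_ge0 ?L2norm_ge0.
- by move=> p; rewrite mulr_ge0 ?expR_ge0 ?normc_ge0.
- by move=> p; exact: normc_ge0.
- move=> p; rewrite /H (normc_wt _ _ to) EFinM.
  apply: (@le_trans _ _ ((om (plane p))%:E * \int[mu2]_q (gk (1 / 2) (plane p) (plane q) * normc (g (plane q)))%:E)%E).
    by apply: lee_wpmul2l; [rewrite lee_fin|exact: fockproj_le].
  have mk : measurable_fun setT (fun q : P => gk (1 / 2) (plane p) (plane q) * normc (g (plane q))).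
    by apply: measurable_funM; [exact: measurable_gk|exact: pmeas_normc].
  rewrite -ge0_integralZl_EFin; last 4 first.
  - exact: measurableT.
  - by move=> q _; rewrite lee_fin mulr_ge0 ?gk_ge0 ?normc_ge0.
  - exact/measurable_EFinP.
  - exact: o0.
  apply: ge0_le_integral.
  - exact: measurableT.
  - by move=> q _; rewrite lee_fin !mulr_ge0 ?gk_ge0 ?normc_ge0.
  - by apply/measurable_EFinP; apply: measurable_funM.
  - by apply/measurable_EFinP; apply: measurable_funM => //; exact: measurable_gk.
  move=> q _; rewrite lee_fin /G (normc_wt _ _ to).
  set z := plane p; set w := plane q.
  have -> : gk (1 / 4) z w * (expR (kappa ^+ 2) * (om w * normc (g w))) =
    expR (kappa ^+ 2) * gk (1 / 4) z w * (om w * normc (g w)) by ring.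
  apply: (@le_trans _ _ ((om w * expR (kappa * normc (z - w))) * (gk (1 / 2) z w * normc (g w)))).
    by apply: ler_wpM2r; [rewrite mulr_ge0 ?gk_ge0 ?normc_ge0|exact: oo].
  have -> : om w * expR (kappa * normc (z - w)) * (gk (1 / 2) z w * normc (g w)) =
    gk (1 / 2) z w * expR (kappa * normc (z - w)) * (om w * normc (g w)) by ring.
  by apply: ler_wpM2r; [rewrite mulr_ge0 ?normc_ge0|exact: gk_weight].
- rewrite /G; under eq_integral do rewrite exprMn EFinM.
  rewrite ge0_integralZl_EFin; last 4 first.
  - exact: measurableT.
  - by move=> q _; rewrite lee_fin sqr_ge0.
  - by apply/measurable_EFinP/measurable_funX; exact: (L2_meas iw).
  - exact: sqr_ge0.
  by rewrite L2norm_sq// -EFinM exprMn.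
Qed.

Lemma tame_weight1 : tame_weight 0 (fun=> 1).
Proof.
split => //.
by move=> z w; rewrite mul0r expR0 mulr1.
Qed.

Lemma wt1 u : wt (fun=> 1) u = u.
Proof. by apply/funext => z; rewrite /wt mul1r. Qed.

Lemma fockproj_fock g : inL2 g -> fock (fockproj g).
Proof.
move=> ig; split.
  exists (fun z => (pi^-1)%:C%C * cintegral mu2 (fun p : P => fockker z (plane p) * g (plane p))).
    have ec : entire (fun=> (pi^-1)%:C%C : C) by apply/entireP => z; exists 0; exact: wirt_cst.
    exact: (entireM ec (entire_fock_transform ig)).
  move=> z; rewrite fockprojE mulrA; congr (_ * _).
  by apply: cplx_eq; rewrite !ReImE; ring.
have [] := @fockproj_weighted 0 (fun=> 1) g (lexx _) tame_weight1 (inL2_pmeas ig).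
  by rewrite wt1.
by rewrite wt1.
Qed.

Lemma fockD u v : fock u -> fock v -> fock (fun z => u z + v z).
Proof.
move=> [[f ef fE] iu] [[g eg gE] iv]; split; last exact: (L2D iu iv).1.
exists (fun z => f z + g z); last by move=> z; rewrite fE gE mulrDr.
apply/entireP => z; have [A wA] := (entireP f).1 ef z; have [B wB] := (entireP g).1 eg z.
exists (A + B) => e e0.
have [|d1 d10 H1] := wA (e / 2); first by rewrite divr_gt0.
have [|d2 d20 H2] := wB (e / 2); first by rewrite divr_gt0.
exists (Num.min d1 d2); first by rewrite lt_min d10.
move=> w; rewrite lt_min => /andP[/H1 h1 /H2 h2].
have -> : f w + g w - (f z + g z) - (A + B) * (w - z) - 0 * conjc (w - z) =
  (f w - f z - A * (w - z) - 0 * conjc (w - z)) + (g w - g z - B * (w - z) - 0 * conjc (w - z)) by ring.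
by apply: le_trans (normcD _ _) _; lra.
Qed.

Lemma fockZ c u : fock u -> fock (fun z => c * u z).
Proof.
move=> [[f ef fE] iu]; split; last exact: (L2Z c iu).1.
exists (fun z => c * f z); last by move=> z; rewrite fE mulrCA.
have ec : entire (fun=> c) by apply/entireP => z; exists 0; exact: wirt_cst.
exact: (entireM ec ef).
Qed.

Lemma fockB u v : fock u -> fock v -> fock (fun z => u z - v z).
Proof.
move=> fu /(fockZ (-1)) fv; have := fockD fu fv.
by congr (@fock R _); apply/funext => z; rewrite mulN1r.
Qed.

Lemma fock_sup u z : fock u -> normc (u z) <= Num.sqrt pi * L2norm u.
Proof. by move=> fu; rewrite -fockproj_id//; apply: fockproj_sup; case: fu. Qed.

End FockSpace.

(** * Exchange of complex integrals *)

Section ComplexFubini.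
Context (dd : measure_display) (T : measurableType dd) (R : realType).
Variable nu : {sigma_finite_measure set T -> \bar R}.

(** Integrability is asked of every section, so that each inner integral is finite and the [fine] in
    its definition loses nothing. *)
Lemma Rintegral_swap (f : T * T -> R) : measurable_fun setT f ->
  (\int[nu]_p \int[nu]_q `|f (p, q)|%:E < +oo)%E ->
  (forall p, (\int[nu]_q `|f (p, q)|%:E < +oo)%E) ->
  (forall q, (\int[nu]_p `|f (p, q)|%:E < +oo)%E) ->
  \int[nu]_p (\int[nu]_q f (p, q)) = \int[nu]_q (\int[nu]_p f (p, q)).
Proof.
move=> mf ff f1 f2.
have mf' : measurable_fun setT (EFin \o f) by exact/measurable_EFinP.
have sec (g : T -> R) : measurable_fun setT g -> (\int[nu]_q `|g q|%:E < +oo)%E ->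
    ((\int[nu]_q g q)%:E = \int[nu]_q (g q)%:E)%E.
  move=> mg fg; rewrite /Rintegral fineK//; apply: integrable_fin_num => //.
  by apply/integrableP; split => //; exact/measurable_EFinP.
rewrite /Rintegral.
under eq_integral => p _ do rewrite -/(Rintegral nu setT (fun q => f (p, q)))
  (sec _ (measurable_fun_pair2 p mf) (f1 p)).
under [in RHS]eq_integral => q _ do rewrite -/(Rintegral nu setT (fun p => f (p, q)))
  (sec _ (measurable_fun_pair1 q mf) (f2 q)).
by congr fine; apply: (@Fubini _ _ _ _ _ nu nu (EFin \o f)); apply/integrable12ltyP.
Qed.

Lemma cintegral_swap (F : T * T -> R[i]) : cmeas F ->
  (\int[nu]_p \int[nu]_q (normc (F (p, q)))%:E < +oo)%E ->
  (forall p, cintegrable nu (fun q => F (p, q))) ->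
  (forall q, cintegrable nu (fun p => F (p, q))) ->
  cintegral nu (fun p => cintegral nu (fun q => F (p, q))) =
  cintegral nu (fun q => cintegral nu (fun p => F (p, q))).
Proof.
move=> mF ff f1 f2; have [m1 m2] := mF.
have n0 x : (0 <= (normc (F x))%:E)%E by rewrite lee_fin normc_ge0.
have sec (g : T -> R) (G : T -> R[i]) : measurable_fun setT g -> (forall p, `|g p| <= normc (G p)) ->
    cintegrable nu G -> (\int[nu]_p `|g p|%:E < +oo)%E.
  move=> mg gG [mG fG]; apply: le_lt_trans fG; apply: ge0_le_integral => //.
  - by apply/measurable_EFinP; exact: measurableT_comp.
  - exact: cmeas_normcE.
  - by move=> p _; rewrite lee_fin.
have key (g : T * T -> R) : measurable_fun setT g -> (forall x, `|g x| <= normc (F x)) ->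
    \int[nu]_p (\int[nu]_q g (p, q)) = \int[nu]_q (\int[nu]_p g (p, q)).
  move=> mg gF.
  have mag : measurable_fun setT (fun x => `|g x|%:E).
    by apply/measurable_EFinP; exact: measurableT_comp.
  have mnF : measurable_fun setT (fun x => (normc (F x))%:E) by exact: cmeas_normcE.
  apply: Rintegral_swap.
  - exact: mg.
  - apply: le_lt_trans ff; apply: ge0_le_integral.
    + exact: measurableT.
    + by move=> p _; apply: integral_ge0.
    + by apply: (measurable_fun_fubini_tonelli_F _ mag).
    + by apply: (measurable_fun_fubini_tonelli_F _ mnF).
    + move=> p _; apply: ge0_le_integral.
      * exact: measurableT.
      * by move=> q _; rewrite lee_fin.
      * exact: (measurable_fun_pair2 p mag).
      * exact: (measurable_fun_pair2 p mnF).
      * by move=> q _; rewrite lee_fin.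
  - by move=> p; apply: sec (f1 p); [exact: (measurable_fun_pair2 p mg)|move=> q; exact: gF].
  - by move=> q; apply: sec (f2 q); [exact: (measurable_fun_pair1 q mg)|move=> p; exact: gF].
apply: cplx_eq; rewrite /cintegral /=.
  by apply: (key (fun x => complex.Re (F x)) m1) => x; exact: normc_Re.
by apply: (key (fun x => complex.Im (F x)) m2) => x; exact: normc_Im.
Qed.

End ComplexFubini.

(** * Self-adjointness of the projection *)

Section SelfAdjoint.
Variable R : realType.
Local Notation P := (measurableTypeR R * measurableTypeR R)%type.
Local Notation mu2 := (leb2 R).
Local Notation C := (R[i]).
Implicit Types (f g u v : C -> C) (z w : C).

(** The full kernel of the projection; unlike [fockker] it is Hermitian, as [fkJ] shows. *)
Definition fk z w : C := (pi^-1 * expR (- (normc z ^+ 2 / 2)))%:C%C * fockker z w.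

Lemma fkE z w : fk z w = (pi^-1)%:C%C * Cexp (conjc w * z - ((normc z ^+ 2 + normc w ^+ 2) / 2)%:C%C).
Proof.
have -> : conjc w * z - ((normc z ^+ 2 + normc w ^+ 2) / 2)%:C%C =
    (- (normc z ^+ 2 / 2))%:C%C + (conjc w * z - (normc w ^+ 2 / 2)%:C%C).
  by apply: cplx_eq; rewrite !ReImE; field.
rewrite CexpD Cexp_rc /fk /fockker mulrA; congr (_ * _).
by apply: cplx_eq; rewrite !ReImE; ring.
Qed.

Lemma conjcM z w : conjc (z * w) = conjc z * conjc w.
Proof. by apply: cplx_eq; rewrite !ReImE; ring. Qed.

Lemma fkJ z w : conjc (fk z w) = fk w z.
Proof.
rewrite !fkE conjcM -CexpJ; congr (_ * Cexp _).
  by apply: cplx_eq; rewrite !ReImE; ring.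
by apply: cplx_eq; rewrite !ReImE; ring.
Qed.

Lemma normc_fk z w : normc (fk z w) = pi^-1 * gk (1 / 2) z w.
Proof.
rewrite normcM normc_rc ger0_norm; last by rewrite mulr_ge0 ?invr_ge0 ?pi_ge0 ?expR_ge0.
by rewrite -mulrA normc_fockker.
Qed.

Lemma cmeas_fk : cmeas (fun x : P * P => fk (plane x.1) (plane x.2)).
Proof.
have [a1 a2] := @pmeas_id R.
have m1 : cmeas (fun x : P * P => plane x.1).
  by split; [exact: (measurableT_comp a1 measurable_fst)|exact: (measurableT_comp a2 measurable_fst)].
have m2 : cmeas (fun x : P * P => plane x.2).
  by split; [exact: (measurableT_comp a1 measurable_snd)|exact: (measurableT_comp a2 measurable_snd)].
under eq_fun do rewrite fkE.
apply: cmeasM; first exact: cmeas_cst.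
apply: cmeas_Cexp; apply: cmeasD; first by apply: cmeasM => //; exact: cmeasJ.
apply: cmeasN; apply: cmeas_real; apply: measurable_funM; last exact: measurable_cst.
by apply: measurable_funD; apply: measurable_funX; exact: cmeas_normc.
Qed.

Lemma fockproj_fk g z : inL2 g ->
  fockproj g z = cintegral mu2 (fun q : P => fk z (plane q) * g (plane q)).
Proof.
move=> ig; rewrite fockprojE -cintegralZ; last exact: fockproj_integrable.
by apply: eq_cintegral => q; rewrite /fk mulrA.
Qed.

Lemma fk_integrable g z : inL2 g ->
  cintegrable mu2 (fun q : P => fk z (plane q) * g (plane q)).
Proof.
move=> ig.
have := cintegrableZ ((pi^-1 * expR (- (normc z ^+ 2 / 2)))%:C%C) (fockproj_integrable z ig).
by congr cintegrable; apply/funext => q; rewrite /fk mulrA.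
Qed.

(** The integral over [q] of the Gaussian kernel against [normc g] is square-integrable in [p] by
    Schur's test; Cauchy-Schwarz with [u] concludes. *)
Lemma fk_double_integral g u : inL2 g -> inL2 u ->
  (\int[plane_sf R]_p \int[plane_sf R]_q
    (normc (conjc (u (plane p)) * (fk (plane p) (plane q) * g (plane q))))%:E < +oo)%E.
Proof.
move=> ig iu.
have h2 : 0 < 1 / 2 :> R by rewrite divr_gt0.
have mg := L2_meas ig; have mu := L2_meas iu.
have p0 : 0 <= pi^-1 :> R by rewrite invr_ge0 pi_ge0.
pose K (x : P * P) := gk (1 / 2) (plane x.1) (plane x.2) * normc (g (plane x.2)).
have mK : measurable_fun setT (fun x => (K x)%:E).
  apply/measurable_EFinP; apply: measurable_funM; first exact: measurable_gk2.
  exact: (measurableT_comp mg measurable_snd).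
have K0 x : (0 <= (K x)%:E)%E by rewrite lee_fin mulr_ge0 ?gk_ge0 ?normc_ge0.
pose HE (p : P) := (\int[plane_sf R]_q (K (p, q))%:E)%E.
have mHE : measurable_fun setT HE by exact: (measurable_fun_fubini_tonelli_F _ mK K0).
have HEfin p : HE p \is a fin_num.
  rewrite ge0_fin_numE; last by apply: integral_ge0.
  have [_] := gk_L2_integrable (plane p) h2 (@ler01 R) ig.
  rewrite plane_sfE; congr (_ < _)%E; apply: eq_integral => q _.
  by congr EFin; exact: mul1r.
pose H p := fine (HE p).
have HH p : (H p)%:E = HE p by rewrite fineK.
have mH : measurable_fun setT H by exact: (measurableT_comp (fine_measurable measurableT) mHE).
have H0 p : 0 <= H p by apply: fine_ge0; apply: integral_ge0.
have n0 : forall p : P, 0 <= normc (u (plane p)) by move=> p; exact: normc_ge0.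
have HB : (\int[mu2]_p (H p ^+ 2)%:E <= ((pi / (1 / 2) * L2norm g) ^+ 2)%:E)%E.
  apply: (gauss_schur h2 (L2norm_ge0 g) mg mH _ H0).
  - by move=> p; exact: normc_ge0.
  - by move=> p; rewrite HH plane_sfE.
  - by rewrite L2norm_sq.
have uB : (\int[mu2]_p (normc (u (plane p)) ^+ 2)%:E <= (L2norm u ^+ 2)%:E)%E by rewrite L2norm_sq.
have B0 : 0 <= pi / (1 / 2) * L2norm g by rewrite mulr_ge0 ?L2norm_ge0// divr_ge0 ?pi_ge0.
have CS := cauchy_schwarz mH mu H0 n0 B0 (L2norm_ge0 u) HB uB.
have E p : (\int[plane_sf R]_q (normc (conjc (u (plane p)) * (fk (plane p) (plane q) * g (plane q))))%:E =
    (pi^-1)%:E * (H p * normc (u (plane p)))%:E)%E.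
  have -> : ((pi^-1)%:E * (H p * normc (u (plane p)))%:E = (pi^-1 * normc (u (plane p)))%:E * (H p)%:E)%E.
    by rewrite -!EFinM; congr EFin; ring.
  rewrite HH -ge0_integralZl_EFin; last 4 first.
  - exact: measurableT.
  - by move=> q _.
  - exact: (measurable_fun_pair2 p mK).
  - by rewrite mulr_ge0.
  have N (a b c : C) : normc (conjc a * (b * c)) = normc a * (normc b * normc c) by rewrite !normcM normcJ.
  by apply: eq_integral => q _; rewrite N normc_fk -EFinM /K /=; congr EFin; ring.
under eq_integral => p _ do rewrite E.
rewrite ge0_integralZl_EFin; last 4 first.
- exact: measurableT.
- by move=> p _; rewrite lee_fin mulr_ge0.
- by apply/measurable_EFinP; apply: measurable_funM.
- exact: p0.
rewrite lte_mul_pinfty// -plane_sfE.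
by apply: le_lt_trans CS _; rewrite ltry.
Qed.

(** Fubini's theorem and the Hermitian symmetry [fkJ] of the kernel. *)
Lemma fockproj_selfadjoint g u : inL2 g -> inL2 u ->
  cintegral mu2 (fun p : P => conjc (u (plane p)) * fockproj g (plane p)) =
  cintegral mu2 (fun p : P => conjc (fockproj u (plane p)) * g (plane p)).
Proof.
move=> ig iu.
pose F (x : P * P) := conjc (u (plane x.1)) * (fk (plane x.1) (plane x.2) * g (plane x.2)).
have [u1 u2] := inL2_pmeas iu; have [g1 g2] := inL2_pmeas ig.
have mF : cmeas F.
  apply: cmeasM.
    apply: cmeasJ; split; [exact: (measurableT_comp u1 measurable_fst)|exact: (measurableT_comp u2 measurable_fst)].
  apply: cmeasM; first exact: cmeas_fk.
  split; [exact: (measurableT_comp g1 measurable_snd)|exact: (measurableT_comp g2 measurable_snd)].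
have s1 p : cintegrable mu2 (fun q : P => F (p, q)).
  exact: (cintegrableZ (conjc (u (plane p))) (fk_integrable (plane p) ig)).
have sJ q : cintegrable mu2 (fun p : P => conjc (fk (plane q) (plane p) * u (plane p))).
  have [m n] := fk_integrable (plane q) iu; split; first exact: cmeasJ.
  by under eq_integral do rewrite normcJ.
have FE p q : F (p, q) = g (plane q) * conjc (fk (plane q) (plane p) * u (plane p)).
  by rewrite conjcM fkJ /F /=; ring.
have s2 q : cintegrable mu2 (fun p : P => F (p, q)).
  have := cintegrableZ (g (plane q)) (sJ q).
  by congr cintegrable; apply/funext => p; rewrite FE.
have L p : conjc (u (plane p)) * fockproj g (plane p) = cintegral mu2 (fun q : P => F (p, q)).
  by rewrite fockproj_fk// -cintegralZ//; exact: fk_integrable.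
have Rr q : conjc (fockproj u (plane q)) * g (plane q) = cintegral mu2 (fun p : P => F (p, q)).
  rewrite fockproj_fk// -cintegralJ; last exact: fk_integrable.
  by rewrite mulrC -cintegralZ//; apply: eq_cintegral => p; rewrite FE.
rewrite (eq_cintegral mu2 L) (eq_cintegral mu2 Rr).
exact: (@cintegral_swap _ _ _ (plane_sf R) F mF (fk_double_integral ig iu) s1 s2).
Qed.

Lemma sqmod_mulE v u : sqmod_mul v u = (fun z => v z * conjc (v z) * u z).
Proof.
by apply/funext => z; rewrite /sqmod_mul; congr (_ * _); apply: cplx_eq; rewrite normc_sq !ReImE; ring.
Qed.

Lemma L2_prod_integrable g u : inL2 g -> inL2 u ->
  cintegrable mu2 (fun p : P => conjc (u (plane p)) * g (plane p)).
Proof.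
move=> ig iu; split; first by apply: cmeasM; [apply: cmeasJ|]; exact: inL2_pmeas.
apply: le_lt_trans (le_lt_trans (L2_cauchy_schwarz iu ig) (ltry _)).
by under eq_integral do rewrite normcM normcJ.
Qed.

(* The projection of [|v|^2 u] pairs to a real number with [u]; this is what
   makes the flow preserve the L2 norm. *)
Lemma sqmod_pairing_real v u : fock u -> inL2 (sqmod_mul v u) ->
  \int[mu2]_p complex.Im (conjc (u (plane p)) * fockproj (sqmod_mul v u) (plane p)) = 0.
Proof.
move=> fu ig; have iu : inL2 u by case: fu.
have E := congr1 (@complex.Im R) (fockproj_selfadjoint ig iu).
transitivity (complex.Im (cintegral mu2 (fun p : P => conjc (fockproj u (plane p)) * sqmod_mul v u (plane p)))).
  by rewrite -E.
have -> : cintegral mu2 (fun p : P => conjc (fockproj u (plane p)) * sqmod_mul v u (plane p)) =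
    cintegral mu2 (fun p : P => ((normc (v (plane p)) * normc (u (plane p))) ^+ 2)%:C%C).
  apply: eq_cintegral => p; rewrite fockproj_id// sqmod_mulE.
  by apply: cplx_eq; rewrite exprMn !normc_sq !ReImE; ring.
rewrite /cintegral /Rintegral; change (fine (\int[mu2]_p (0 : R)%:E)%E = 0).
by rewrite integral0.
Qed.

Lemma L2norm_sq_Rintegral g : inL2 g -> \int[mu2]_p (normc (g (plane p)) ^+ 2) = L2norm g ^+ 2.
Proof. by move=> ig; rewrite /Rintegral L2norm_sq. Qed.

(** Pythagoras' theorem: the cross term is [- 2 * s] times the integral assumed to vanish. *)
Lemma L2norm_sq_i (s : R) g u : inL2 g -> inL2 u ->
  \int[mu2]_p complex.Im (conjc (u (plane p)) * g (plane p)) = 0 ->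
  L2norm (fun z => u z + 'i%C * s%:C%C * g z) ^+ 2 = L2norm u ^+ 2 + s ^+ 2 * L2norm g ^+ 2.
Proof.
move=> ig iu h0.
have isg : inL2 (fun z => 'i%C * s%:C%C * g z) by exact: (L2Z _ ig).1.
have [iw _] := L2D iu isg.
have [_ iI] := cintegrable_ReIm (L2_prod_integrable ig iu).
have sqi f : inL2 f -> mu2.-integrable setT (fun p : P => (normc (f (plane p)) ^+ 2)%:E).
  move=> iF; apply/integrableP; split.
    by apply/measurable_EFinP/measurable_funX; exact: L2_meas.
  under eq_integral do rewrite gee0_abs ?lee_fin ?sqr_ge0//.
  by rewrite L2norm_sq// ltry.
rewrite -!L2norm_sq_Rintegral//.
pose F1 (p : P) := normc (u (plane p)) ^+ 2.
pose F2 (p : P) := s ^+ 2 * normc (g (plane p)) ^+ 2.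
pose F3 (p : P) := (- 2 * s) * complex.Im (conjc (u (plane p)) * g (plane p)).
have i1 : mu2.-integrable setT (EFin \o F1) by exact: sqi.
have i2 : mu2.-integrable setT (EFin \o F2).
  by have := integrableZl measurableT (s ^+ 2) (sqi _ ig).
have i3 : mu2.-integrable setT (EFin \o F3).
  by have := integrableZl measurableT (- 2 * s) iI.
have -> : \int[mu2]_p (normc (u (plane p) + 'i%C * s%:C%C * g (plane p)) ^+ 2) =
    \int[mu2]_p (F1 p + (F2 p + F3 p)).
  apply: eq_Rintegral => p _; rewrite /F1 /F2 /F3 !normc_sq !ReImE.
  by rewrite -![Algebra.hasZero.zero _]/(0 : R); ring.
have i23 : mu2.-integrable setT (EFin \o (fun p => F2 p + F3 p)).
  by have := integrableD measurableT i2 i3.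
rewrite (RintegralD measurableT i1 i23) (RintegralD measurableT i2 i3).
rewrite (RintegralZl _ measurableT (sqi _ ig)) (RintegralZl _ measurableT iI) h0 mulr0 addr0.
by [].
Qed.

End SelfAdjoint.

(** * Weighted norms on the Fock space and their truncations *)

Section WeightedNorm.
Variable R : realType.
Local Notation P := (measurableTypeR R * measurableTypeR R)%type.
Local Notation mu2 := (leb2 R).
Local Notation C := (R[i]).
Implicit Types (f g u v : C -> C) (z w : C) (om : C -> R).

Definition wspace om : set (C -> C) := [set u | inL2 (wt om u)] `&` @fock R.
Definition wnorm om u : R := L2norm (wt om u).

Lemma wnorm_ge0 om u : 0 <= wnorm om u. Proof. exact: L2norm_ge0. Qed.

Lemma wt_D om u v : wt om (fun z => u z + v z) = (fun z => wt om u z + wt om v z).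
Proof. by apply/funext => z; rewrite /wt mulrDr. Qed.

Lemma wt_Z om c u : wt om (fun z => c * u z) = (fun z => c * wt om u z).
Proof. by apply/funext => z; rewrite /wt mulrCA. Qed.

Lemma wspaceD om u v : wspace om u -> wspace om v ->
  wspace om (fun z => u z + v z) /\ wnorm om (fun z => u z + v z) <= wnorm om u + wnorm om v.
Proof.
move=> [iu fu] [iv fv]; rewrite /wnorm /wspace wt_D; have [i n] := L2D iu iv.
by split => //; split; [rewrite /= wt_D|exact: fockD].
Qed.

Lemma wspaceZ om c u : wspace om u ->
  wspace om (fun z => c * u z) /\ wnorm om (fun z => c * u z) = normc c * wnorm om u.
Proof.
move=> [iu fu]; rewrite /wnorm /wspace wt_Z; have [i n] := L2Z c iu.
by split => //; split; [rewrite /= wt_Z|exact: fockZ].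
Qed.

Lemma wspaceB om u v : wspace om u -> wspace om v ->
  wspace om (fun z => u z - v z) /\ wnorm om (fun z => u z - v z) <= wnorm om u + wnorm om v.
Proof.
move=> wu /(wspaceZ (-1)); rewrite normcN normc1 mul1r => -[wv <-].
have -> : (fun z => u z - v z) = (fun z => u z + -1 * v z) by apply/funext => z; rewrite mulN1r.
exact: wspaceD.
Qed.

Lemma wnormC om u v : wspace om u -> wspace om v ->
  wnorm om (fun z => u z - v z) = wnorm om (fun z => v z - u z).
Proof.
move=> wu wv; have [w] := wspaceB wv wu; have [_] := wspaceZ (-1) (wspaceB wv wu).1.
rewrite normcN normc1 mul1r => <- _.
by congr wnorm; apply/funext => z; rewrite mulN1r opprB.
Qed.

Lemma wnorm_dist om u v : wspace om u -> wspace om v ->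
  `|wnorm om u - wnorm om v| <= wnorm om (fun z => u z - v z).
Proof.
move=> wu wv; have [w1 _] := wspaceB wu wv; have [w2 _] := wspaceB wv wu.
have [_ h1] := wspaceD w1 wv; have [_ h2] := wspaceD w2 wu.
have E1 : (fun z => u z - v z + v z) = u by apply/funext => z; rewrite subrK.
have E2 : (fun z => v z - u z + u z) = v by apply/funext => z; rewrite subrK.
rewrite E1 in h1; rewrite E2 -(wnormC wu wv) in h2.
by rewrite ler_norml; apply/andP; split; lra.
Qed.

Lemma fock_pmeas u : fock u -> pmeas u.
Proof. by case=> _; exact: inL2_pmeas. Qed.

Lemma wspace_fock om u : wspace om u -> fock u. Proof. by case. Qed.

Lemma L2norm_le_wnorm kappa om u : tame_weight kappa om -> wspace om u ->
  L2norm u <= wnorm om u.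
Proof. by move=> to [iu fu]; have [] := wt_inL2 to (fock_pmeas fu) iu. Qed.

Lemma wspace_dom kappa om (om' : C -> R) M u : tame_weight kappa om ->
  0 <= M -> (forall z, om' z <= M * om z) ->
  forall kappa', tame_weight kappa' om' -> wspace om u ->
  wspace om' u /\ wnorm om' u <= M * wnorm om u.
Proof.
move=> to M0 h kappa' to' [iu fu].
have [] := @L2_le _ (wt om' u) (wt om u) M M0 _ iu.
- by apply: (wt_pmeas to'); exact: fock_pmeas.
- move=> z; rewrite (normc_wt _ _ to) (normc_wt _ _ to') mulrA.
  by apply: ler_wpM2r => //; exact: normc_ge0.
by move=> i n; split.
Qed.

Lemma wspace1 u : wspace (fun=> 1) u = fock u.
Proof.
by apply/propext; split => [[]//|fu]; split => //=; rewrite wt1; case: fu.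
Qed.

Lemma wnorm1 u : wnorm (fun=> 1) u = L2norm u.
Proof. by rewrite /wnorm wt1. Qed.

Lemma fockproj_bound kappa om F g (A : R) : 0 <= kappa -> tame_weight kappa om ->
  0 <= A -> pmeas F -> wspace om g -> (forall z, normc (F z) <= A * normc (g z)) ->
  [/\ inL2 F, wspace om (fockproj F) & wnorm om (fockproj F) <= schur_cst kappa * (A * wnorm om g)].
Proof.
move=> k0 to A0 mF [ig fg] Fg.
have [iF nF] : inL2 (wt om F) /\ L2norm (wt om F) <= A * L2norm (wt om g).
  apply: L2_le => //; first exact: (wt_pmeas to mF).
  move=> z; rewrite !(normc_wt _ _ to) mulrCA; apply: ler_wpM2l => //.
  by have [_ o1 _] := to; apply: le_trans (o1 z).
have [i n] := fockproj_weighted k0 to mF iF.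
have [iF' _] := wt_inL2 to mF iF.
split => //; first by split => //; exact: fockproj_fock.
by apply: le_trans n _; rewrite ler_wpM2l// ltW// schur_cst_gt0.
Qed.

(* For the bounded weights [truncw kappa n] every element of the Fock space has
   a finite weighted norm, as needed a priori for Gronwall's inequality. *)
Definition expw (kappa : R) z := expR (kappa * normc z).
Definition truncw (kappa : R) (n : nat) z := expR (kappa * Num.min (normc z) n%:R).

Lemma tame_expw kappa : 0 <= kappa -> tame_weight kappa (expw kappa).
Proof.
move=> k0; split.
- apply: measurableT_comp => //; apply: measurable_funM => //.
  by apply: cmeas_normc; exact: pmeas_id.
- by move=> z; rewrite -expR0 ler_expR mulr_ge0 ?normc_ge0.
- move=> z w; rewrite -expRD ler_expR -mulrDr ler_wpM2l//.
  by have := normcD w (z - w); rewrite addrC subrK.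
Qed.

Lemma tame_truncw kappa n : 0 <= kappa -> tame_weight kappa (truncw kappa n).
Proof.
move=> k0; split.
- apply: measurableT_comp => //; apply: measurable_funM => //.
  by apply: measurable_minr => //; apply: cmeas_normc; exact: pmeas_id.
- by move=> z; rewrite -expR0 ler_expR mulr_ge0// le_min normc_ge0 ler0n.
- move=> z w; rewrite -expRD ler_expR -mulrDr ler_wpM2l//.
  have h : normc z <= normc w + normc (z - w).
    by have := normcD w (z - w); rewrite addrC subrK.
  have := normc_ge0 (z - w).
  by case: (leP (normc z) n%:R); case: (leP (normc w) n%:R); lra.
Qed.

Lemma truncw_le kappa n z : 0 <= kappa -> truncw kappa n z <= expw kappa z.
Proof. by move=> k0; rewrite ler_expR ler_wpM2l// ge_min lexx. Qed.

Lemma truncw_bound kappa n z : 0 <= kappa -> truncw kappa n z <= expR (kappa * n%:R).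
Proof. by move=> k0; rewrite ler_expR ler_wpM2l// ge_min lexx orbT. Qed.

Lemma wspace_trunc kappa n u : 0 <= kappa -> fock u ->
  wspace (truncw kappa n) u /\
  wnorm (truncw kappa n) u <= expR (kappa * n%:R) * L2norm u.
Proof.
move=> k0 fu; have w1 : wspace (fun=> 1) u by rewrite wspace1.
have h z : truncw kappa n z <= expR (kappa * n%:R) * (fun=> 1) z by rewrite mulr1; exact: truncw_bound.
by have := wspace_dom (tame_weight1 R) (expR_ge0 _) h (tame_truncw n k0) w1; rewrite wnorm1.
Qed.

Lemma wnorm_trunc_le kappa n u : 0 <= kappa -> wspace (expw kappa) u ->
  wnorm (truncw kappa n) u <= wnorm (expw kappa) u.
Proof.
move=> k0 wu; rewrite -[X in _ <= X]mul1r.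
apply: (wspace_dom (tame_expw k0) ler01 _ (tame_truncw n k0) wu).2.
by move=> z; rewrite mul1r; exact: truncw_le.
Qed.

(** Monotone convergence: at a given point the truncated weight increases with [n] and equals the
    full weight once [n] exceeds the modulus. Membership in the weighted space is part of the
    conclusion, which is how finiteness is obtained. *)
Lemma wnorm_trunc_limit kappa u (B : R) : 0 <= kappa -> 0 <= B -> fock u ->
  (forall n, wnorm (truncw kappa n) u <= B) ->
  wspace (expw kappa) u /\ wnorm (expw kappa) u <= B.
Proof.
move=> k0 B0 fu HB; have mu := fock_pmeas fu.
pose f (n : nat) (p : P) := (normc (wt (truncw kappa n) u (plane p)) ^+ 2)%:E.
have mf n : measurable_fun setT (f n).
  apply/measurable_EFinP/measurable_funX; apply: pmeas_normc.
  exact: (wt_pmeas (tame_truncw n k0)).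
have f0 n p : setT p -> (0 <= f n p)%E by move=> _; rewrite lee_fin sqr_ge0.
have nd p : setT p -> nondecreasing_seq (f ^~ p).
  move=> _ m n mn; rewrite lee_fin lerXn2r ?nnegrE ?normc_ge0//.
  rewrite !(normc_wt _ _ (tame_truncw _ k0)) ler_wpM2r ?normc_ge0//.
  rewrite ler_expR ler_wpM2l// le_min ge_min lexx/= ge_min ler_nat mn.
  by rewrite orbT.
have fB n : (\int[mu2]_p f n p <= (B ^+ 2)%:E)%E.
  rewrite L2norm_sq; last exact: (wspace_trunc n k0 fu).1.1.
  by rewrite lee_fin lerXn2r ?nnegrE ?L2norm_ge0//; exact: HB.
have lim_f p : (fun n => f n p) @ \oo --> (normc (wt (expw kappa) u (plane p)) ^+ 2)%:E.
  have E n : normc (plane p) < n%:R -> f n p = (normc (wt (expw kappa) u (plane p)) ^+ 2)%:E.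
    move=> h; rewrite /f (normc_wt _ _ (tame_truncw _ k0)) (normc_wt _ _ (tame_expw k0)).
    by rewrite /truncw /expw (min_idPl (ltW h)).
  by apply: cvg_near_cst; near=> n; apply: E; near: n; exact: nbhs_infty_gtr.
have [] := @inL2_intro R (wt (expw kappa) u) B (wt_pmeas (tame_expw k0) mu) B0.
  have := @cvg_monotone_convergence _ _ _ mu2 _ measurableT f mf f0 nd.
  have E : (\int[mu2]_p (normc (wt (expw kappa) u (plane p)) ^+ 2)%:E)%E =
      (\int[mu2]_p limn (f^~ p))%E.
    by apply: eq_integral => p _; apply/esym/cvg_lim.
  rewrite E => cv; rewrite -(cvg_lim _ cv)//.
  by apply: lime_le; [apply/cvg_ex; eexists; exact: cv|near=> n; exact: fB].
by move=> i n; split.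
Unshelve. all: by end_near.
Qed.

End WeightedNorm.

(** * Curves in weighted spaces *)

Section WeightedCurves.
Variable R : realType.
Local Notation C := (R[i]).
Implicit Types (f g : C -> C) (z w : C) (om : C -> R) (u v du dv : R -> C -> C) (a b c : C -> C).

Lemma wsD om a b : wspace om a -> wspace om b -> wspace om (fun z => a z + b z).
Proof. by move=> wa wb; have [] := wspaceD wa wb. Qed.
Lemma wsB om a b : wspace om a -> wspace om b -> wspace om (fun z => a z - b z).
Proof. by move=> wa wb; have [] := wspaceB wa wb. Qed.
Lemma wsZ om (k : C) a : wspace om a -> wspace om (fun z => k * a z).
Proof. by move=> wa; have [] := wspaceZ k wa. Qed.
Lemma wnD om a b : wspace om a -> wspace om b ->
  wnorm om (fun z => a z + b z) <= wnorm om a + wnorm om b.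
Proof. by move=> wa wb; have [] := wspaceD wa wb. Qed.
Lemma wnZ om (k : C) a : wspace om a -> wnorm om (fun z => k * a z) = normc k * wnorm om a.
Proof. by move=> wa; have [] := wspaceZ k wa. Qed.

Lemma wnorm_eq0 om a : (forall z, a z = 0) -> wnorm om a = 0.
Proof.
move=> a0; rewrite /wnorm -[RHS](L2_0 R).2; congr L2norm.
by apply/funext => z; rewrite /wt a0 mulr0.
Qed.

(** Differentiability at one time, written with a remainder instead of a quotient so that [h = 0]
    needs no exclusion. *)
Definition wderiv om u a (t : R) := forall e, 0 < e -> exists2 d, 0 < d &
  forall h : R, `|h| < d ->
    wnorm om (fun z => u (t + h) z - u t z - h%:C%C * a z) <= `|h| * e.

Lemma curve_derivativeP om u du : curve_derivative (wspace om) (wnorm om) u du <->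
  forall t, [/\ wspace om (u t), wspace om (du t) & wderiv om u (du t) t].
Proof.
have key t (h : R) : h != 0 -> wspace om (u (t + h)) -> wspace om (u t) -> wspace om (du t) ->
    wnorm om (fun z => u (t + h) z - u t z - h%:C%C * du t z) =
    `|h| * wnorm om (fun z => h^-1%:C%C * (u (t + h) z - u t z) - du t z).
  move=> h0 w1 w2 w3; rewrite -normc_rc -wnZ; last by apply: wsB => //; apply: wsZ; exact: wsB.
  congr wnorm; apply/funext => z; rewrite mulrBr mulrA.
  have -> : h%:C%C * h^-1%:C%C = 1 :> C by rewrite -rmorphM /= divff.
  by rewrite mul1r.
split=> H t; have [w1 w2 w3] := H t; split => //.
  move=> e e0; move/cvgrPdist_lt: w3 => /(_ e e0)/nbhs_ballP[d /= d0 Hd]; exists d => // h hd.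
  have [->|h0] := eqVneq h 0.
    by rewrite normr0 mul0r wnorm_eq0// => z; rewrite addr0 subrr mul0r subrr.
  have [wh _ _] := H (t + h).
  rewrite key// ler_wpM2l//.
  have B0 : ball (0 : R) d h by rewrite -ball_normE /ball_ /= sub0r normrN.
  have := Hd _ B0 h0; rewrite /= sub0r normrN ger0_norm ?wnorm_ge0//; exact: ltW.
apply/cvgrPdist_le => e e0; have [d d0 Hd] := w3 e e0.
apply/nbhs_ballP; exists d => //= h; rewrite -ball_normE /ball_ /= sub0r normrN => hd h0.
rewrite sub0r normrN ger0_norm ?wnorm_ge0//.
have [wh _ _] := H (t + h).
by have := Hd h hd; rewrite key// ler_pM2l// normr_gt0.
Qed.

Lemma wderiv_dom kappa om kappa' (om' : C -> R) M u a t :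
  tame_weight kappa om -> tame_weight kappa' om' ->
  0 <= M -> (forall z, om' z <= M * om z) ->
  (forall s, wspace om (u s)) -> wspace om a -> wderiv om u a t -> wderiv om' u a t.
Proof.
move=> to to' M0 h wu wa H e e0.
have M1 : 0 < M + 1 by rewrite ltr_wpDl.
have [d d0 {}H] := H (e / (M + 1)) (divr_gt0 e0 M1); exists d => // k kd.
have w : wspace om (fun z => u (t + k) z - u t z - k%:C%C * a z).
  by apply: wsB; [exact: wsB|exact: wsZ].
have [_ n] := wspace_dom to M0 h to' w; apply: le_trans n _.
apply: le_trans (ler_wpM2l M0 (H k kd)) _.
rewrite mulrCA ler_wpM2l// mulrCA ler_piMr ?ltW// ltr_pdivrMr// mul1r; lra.
Qed.

(** Puts the norm of a curve in the form required by [mean_value_le] and [gronwall]. *)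
Lemma wderiv_norm om u a t : (forall s, wspace om (u s)) -> wspace om a -> wderiv om u a t ->
  forall e, 0 < e -> exists2 d, 0 < d & forall h, `|h| < d ->
    `|wnorm om (u (t + h)) - wnorm om (u t)| <= `|h| * (wnorm om a + e).
Proof.
move=> wu wa H e e0; have [d d0 {}H] := H e e0; exists d => // h hd.
apply: le_trans (wnorm_dist (wu _) (wu _)) _.
have w : wspace om (fun z => u (t + h) z - u t z - h%:C%C * a z).
  by apply: wsB; [exact: wsB|exact: wsZ].
have := wnD w (wsZ (h%:C%C) wa); rewrite wnZ// normc_rc.
have -> : (fun z => u (t + h) z - u t z - h%:C%C * a z + h%:C%C * a z) = (fun z => u (t + h) z - u t z).
  by apply/funext => z; rewrite subrK.
by have := H h hd; lra.
Qed.

Lemma wderiv_cont om u a t : (forall s, wspace om (u s)) -> wspace om a -> wderiv om u a t ->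
  forall e, 0 < e -> exists2 d, 0 < d & forall h, `|h| < d ->
    wnorm om (fun z => u (t + h) z - u t z) <= e.
Proof.
move=> wu wa H e e0; have [d d0 {}H] := H 1 ltr01.
have n0 := wnorm_ge0 om a; have n1 : 0 < wnorm om a + 1 by lra.
exists (Num.min d (e / (wnorm om a + 1))); first by rewrite lt_min d0 divr_gt0.
move=> h; rewrite lt_min ltr_pdivlMr// => /andP[hd he].
have w : wspace om (fun z => u (t + h) z - u t z - h%:C%C * a z).
  by apply: wsB; [exact: wsB|exact: wsZ].
have := wnD w (wsZ (h%:C%C) wa); rewrite wnZ// normc_rc.
have -> : (fun z => u (t + h) z - u t z - h%:C%C * a z + h%:C%C * a z) = (fun z => u (t + h) z - u t z).
  by apply/funext => z; rewrite subrK.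
by have := H h hd; lra.
Qed.

Lemma wderivD om u v a b t : (forall s, wspace om (u s)) -> (forall s, wspace om (v s)) ->
  wspace om a -> wspace om b ->
  wderiv om u a t -> wderiv om v b t ->
  wderiv om (fun s z => u s z + v s z) (fun z => a z + b z) t.
Proof.
move=> wu wv wa wb H1 H2 e e0; have e2 : 0 < e / 2 by rewrite divr_gt0.
have [d1 d10 {}H1] := H1 _ e2; have [d2 d20 {}H2] := H2 _ e2.
exists (Num.min d1 d2); first by rewrite lt_min d10.
move=> h; rewrite lt_min => /andP[/H1 h1 /H2 h2].
have w1 : wspace om (fun z => u (t + h) z - u t z - h%:C%C * a z).
  by apply: wsB; [exact: wsB|exact: wsZ].
have w2 : wspace om (fun z => v (t + h) z - v t z - h%:C%C * b z).
  by apply: wsB; [exact: wsB|exact: wsZ].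
have := wnD w1 w2.
have -> : (fun z => u (t + h) z - u t z - h%:C%C * a z + (v (t + h) z - v t z - h%:C%C * b z)) =
  (fun z => u (t + h) z + v (t + h) z - (u t z + v t z) - h%:C%C * (a z + b z)).
  by apply/funext => z; ring.
lra.
Qed.

Lemma wderivZ om (k : C) u a t : (forall s, wspace om (u s)) -> wspace om a ->
  wderiv om u a t -> wderiv om (fun s z => k * u s z) (fun z => k * a z) t.
Proof.
move=> wu wa H e e0; have k0 := normc_ge0 k; have k1 : 0 < normc k + 1 by lra.
have [d d0 {}H] := H (e / (normc k + 1)) (divr_gt0 e0 k1); exists d => // h hd.
have w : wspace om (fun z => u (t + h) z - u t z - h%:C%C * a z).
  by apply: wsB; [exact: wsB|exact: wsZ].
have -> : (fun z => k * u (t + h) z - k * u t z - h%:C%C * (k * a z)) =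
    (fun z => k * (u (t + h) z - u t z - h%:C%C * a z)) by apply/funext => z; ring.
rewrite wnZ//; apply: le_trans (ler_wpM2l k0 (H h hd)) _.
rewrite mulrCA ler_wpM2l// mulrCA ler_piMr ?ltW// ltr_pdivrMr// mul1r; lra.
Qed.

Lemma wderivB om u v a b t : (forall s, wspace om (u s)) -> (forall s, wspace om (v s)) ->
  wspace om a -> wspace om b ->
  wderiv om u a t -> wderiv om v b t ->
  wderiv om (fun s z => u s z - v s z) (fun z => a z - b z) t.
Proof.
move=> wu wv wa wb H1 /(wderivZ (-1) wv wb) H2.
have wv' s := wsZ (-1) (wv s).
have := wderivD wu wv' wa (wsZ (-1) wb) H1 H2.
have -> : (fun s z => u s z + -1 * v s z) = (fun s z => u s z - v s z).
  by apply/funext => s; apply/funext => z; rewrite mulN1r.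
by have -> : (fun z => a z + -1 * b z) = (fun z => a z - b z) by apply/funext => z; rewrite mulN1r.
Qed.

Lemma wderiv_affine om b c (r t : R) : wderiv om (fun s z => b z + (s - r)%:C%C * c z) c t.
Proof.
move=> e e0; exists 1 => // h _; rewrite wnorm_eq0 ?mulr_ge0 ?(ltW e0)// => z.
by rewrite !rmorphB !rmorphD /=; ring.
Qed.

(** The curve [u s] minus its affine comparison through [u t] with slope [c] vanishes at [t] and has
    derivative [du s - c]. With [c = 0] this yields Lipschitz bounds, with [c = du t]
    differentiability. *)
Lemma wnorm_mean_value om u du c t (h L : R) :
  (forall s, wspace om (u s)) -> (forall s, wspace om (du s)) -> wspace om c ->
  (forall s, wderiv om u (du s) s) ->
  (forall s, `|s - t| <= `|h| -> wnorm om (fun z => du s z - c z) <= L) ->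
  wnorm om (fun z => u (t + h) z - u t z - h%:C%C * c z) <= L * `|h|.
Proof.
move=> wu wdu wc H HL.
pose W s z := u s z - (u t z + (s - t)%:C%C * c z).
have wW s : wspace om (W s) by apply: wsB => //; apply: wsD => //; exact: wsZ.
have dW s : wderiv om W (fun z => du s z - c z) s.
  apply: wderivB => //; last exact: wderiv_affine.
  by move=> r; apply: wsD => //; exact: wsZ.
have step (x : R) : `|x - t| <= `|h| -> forall e, 0 < e -> exists2 d, 0 < d &
    forall k, `|k| < d -> `|wnorm om (W (x + k)) - wnorm om (W x)| <= `|k| * (L + e).
  move=> xh e e0; have [d d0 Hd] := wderiv_norm wW (wsB (wdu x) wc) (dW x) e0.
  exists d => // k kd; apply: le_trans (Hd k kd) _; rewrite ler_wpM2l// lerD2r; exact: HL.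
have W0 : wnorm om (W t) = 0 by apply: wnorm_eq0 => z; rewrite /W subrr mul0r addr0 subrr.
have -> : (fun z => u (t + h) z - u t z - h%:C%C * c z) = W (t + h).
  by apply/funext => z; rewrite /W [t + h - t]addrC addKr opprD addrA.
have := wnorm_ge0 om (W (t + h)).
have [h0|h0] := leP 0 h => W1.
  have ab : t <= t + h by lra.
  have := @mean_value_le R (fun s => wnorm om (W s)) t (t + h) L ab.
  rewrite W0 subr0 ger0_norm// [t + h - t]addrC addKr ger0_norm//; apply.
  by move=> x /andP[x1 x2]; apply: step; rewrite ger0_norm ?ger0_norm//; lra.
have ab : t + h <= t by lra.
have := @mean_value_le R (fun s => wnorm om (W s)) (t + h) t L ab.
rewrite W0 sub0r normrN ger0_norm// (_ : t - (t + h) = - h); last by ring.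
rewrite ltr0_norm//; apply.
by move=> x /andP[x1 x2]; apply: step; rewrite ler0_norm ?ltr0_norm//; lra.
Qed.

End WeightedCurves.

(** * Estimates and product rule for the cubic nonlinearity *)

Section TrilinearMap.
Variables (R : realType) (kappa : R) (om : R[i] -> R).
Hypotheses (kappa_ge0 : 0 <= kappa) (om_tame : tame_weight kappa om).
Local Notation C := (R[i]).
Local Notation N := (wnorm om).
Local Notation W := (wspace om).
Local Notation F := (@fock R).
Local Notation L := (@L2norm R).
Implicit Types (a b c d : C -> C) (z : C).

(** Polarised form of the nonlinearity, conjugate-linear in the middle argument; [tri v v u] is the
    projection of [|v|^2 u]. *)
Definition tri a b c : C -> C := fockproj (fun z => a z * conjc (b z) * c z).

(** The factor [pi] is the product of the two constants [Num.sqrt pi] of [fock_sup]. *)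
Definition tri_cst := schur_cst kappa * pi.

Lemma tri_cst_gt0 : 0 < tri_cst.
Proof. by rewrite mulr_gt0 ?schur_cst_gt0 ?pi_gt0. Qed.

Lemma tri_pmeas a b c : F a -> F b -> F c -> pmeas (fun z => a z * conjc (b z) * c z).
Proof.
move=> /fock_pmeas ma /fock_pmeas mb /fock_pmeas mc.
by apply: cmeasM => //; apply: cmeasM => //; exact: cmeasJ.
Qed.

(** [g] stands for whichever of the three factors carries the weight; [x] and [y] are the L^2 norms
    of the two others, bounded in sup norm. *)
Lemma tri_aux a b c (g : C -> C) (x y : R) : F a -> F b -> F c -> W g ->
  0 <= x -> 0 <= y ->
  (forall z, normc (a z) * normc (b z) * normc (c z) <=
     (Num.sqrt pi * x) * (Num.sqrt pi * y) * normc (g z)) ->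
  [/\ inL2 (fun z => a z * conjc (b z) * c z), W (tri a b c) &
    N (tri a b c) <= tri_cst * (x * y * N g)].
Proof.
move=> fa fb fc wg x0 y0 h.
have s0 : 0 <= Num.sqrt pi :> R := sqrtr_ge0 _.
have A0 : 0 <= (Num.sqrt pi * x) * (Num.sqrt pi * y) by rewrite !mulr_ge0.
have [|i w n] := fockproj_bound kappa_ge0 om_tame A0 (tri_pmeas fa fb fc) wg.
  by move=> z; rewrite !normcM normcJ.
split => //; apply: le_trans n _.
have -> : tri_cst * (x * y * N g) = schur_cst kappa * (pi * x * y * N g) by rewrite /tri_cst; ring.
have -> : Num.sqrt pi * x * (Num.sqrt pi * y) = Num.sqrt pi ^+ 2 * x * y :> R by ring.
by rewrite sqr_sqrtr// pi_ge0.
Qed.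

Lemma tri3 a b c : F a -> F b -> W c ->
  [/\ inL2 (fun z => a z * conjc (b z) * c z), W (tri a b c) &
    N (tri a b c) <= tri_cst * (L a * L b * N c)].
Proof.
move=> fa fb wc; have fc := wspace_fock wc.
apply: tri_aux => //; do ?exact: L2norm_ge0.
move=> z; rewrite ler_wpM2r ?normc_ge0// ler_pM ?normc_ge0//; exact: fock_sup.
Qed.

Lemma tri2 a b c : F a -> W b -> F c ->
  [/\ inL2 (fun z => a z * conjc (b z) * c z), W (tri a b c) &
    N (tri a b c) <= tri_cst * (L a * L c * N b)].
Proof.
move=> fa wb fc; have fb := wspace_fock wb.
apply: tri_aux => //; do ?exact: L2norm_ge0.
move=> z; rewrite mulrAC ler_wpM2r ?normc_ge0// ler_pM ?normc_ge0//; exact: fock_sup.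
Qed.

Lemma tri1 a b c : W a -> F b -> F c ->
  [/\ inL2 (fun z => a z * conjc (b z) * c z), W (tri a b c) &
    N (tri a b c) <= tri_cst * (L b * L c * N a)].
Proof.
move=> wa fb fc; have fa := wspace_fock wa.
apply: tri_aux => //; do ?exact: L2norm_ge0.
move=> z; rewrite -mulrA mulrC ler_wpM2r ?normc_ge0// ler_pM ?normc_ge0//; exact: fock_sup.
Qed.

Lemma tri_W a b c : W a -> W b -> W c -> W (tri a b c).
Proof. by move=> [_ fa] [_ fb] wc; have [] := tri3 fa fb wc. Qed.

Lemma tri_inL2 a b c : W a -> W b -> W c -> inL2 (fun z => a z * conjc (b z) * c z).
Proof. by move=> [_ fa] [_ fb] wc; have [] := tri3 fa fb wc. Qed.

Lemma tri_N a b c : W a -> W b -> W c -> N (tri a b c) <= tri_cst * (N a * N b * N c).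
Proof.
move=> wa wb wc; have [_ fa] := wa; have [_ fb] := wb.
have [_ _ n] := tri3 fa fb wc; apply: le_trans n _.
rewrite ler_wpM2l ?(ltW tri_cst_gt0)// ler_wpM2r ?wnorm_ge0//.
by rewrite ler_pM ?L2norm_ge0//; exact: (L2norm_le_wnorm om_tame).
Qed.

(** The scalars are real, as time increments are; this puts the conjugated middle argument on the
    same footing as the others. *)
Lemma tri_lin1 (k : R) a d b c : W a -> W d -> W b -> W c -> forall z,
  tri (fun z => a z + k%:C%C * d z) b c z = tri a b c z + k%:C%C * tri d b c z.
Proof.
move=> wa wd wb wc z; have i1 := tri_inL2 wa wb wc; have i2 := tri_inL2 wd wb wc.
rewrite /tri; have := congr1 (@^~ z) (fockprojD i1 (L2Z (k%:C%C) i2).1); rewrite fockprojZ//= => <-.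
by congr fockproj; apply/funext => w; ring.
Qed.

Lemma tri_lin2 (k : R) a b d c : W a -> W b -> W d -> W c -> forall z,
  tri a (fun z => b z + k%:C%C * d z) c z = tri a b c z + k%:C%C * tri a d c z.
Proof.
move=> wa wb wd wc z; have i1 := tri_inL2 wa wb wc; have i2 := tri_inL2 wa wd wc.
rewrite /tri; have := congr1 (@^~ z) (fockprojD i1 (L2Z (k%:C%C) i2).1); rewrite fockprojZ//= => <-.
congr fockproj; apply/funext => w.
have -> : conjc (b w + k%:C%C * d w) = conjc (b w) + k%:C%C * conjc (d w).
  by apply: cplx_eq; rewrite !ReImE; ring.
ring.
Qed.

Lemma tri_lin3 (k : R) a b c d : W a -> W b -> W c -> W d -> forall z,
  tri a b (fun z => c z + k%:C%C * d z) z = tri a b c z + k%:C%C * tri a b d z.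
Proof.
move=> wa wb wc wd z; have i1 := tri_inL2 wa wb wc; have i2 := tri_inL2 wa wb wd.
rewrite /tri; have := congr1 (@^~ z) (fockprojD i1 (L2Z (k%:C%C) i2).1); rewrite fockprojZ//= => <-.
by congr fockproj; apply/funext => w; ring.
Qed.

Lemma wnorm_sum3 a b c (x : R) : W a -> W b -> W c -> N a <= x -> N b <= x -> N c <= x ->
  N (fun z => a z + b z + c z) <= 3 * x.
Proof.
move=> wa wb wc ax bx cx; have := wnD (wsD wa wb) wc; have := wnD wa wb; lra.
Qed.

Implicit Types (u v w : R -> C -> C).

Lemma wderiv_tri u v w a b c (t : R) :
  (forall s, W (u s)) -> (forall s, W (v s)) -> (forall s, W (w s)) -> W a -> W b -> W c ->
  wderiv om u a t -> wderiv om v b t -> wderiv om w c t ->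
  wderiv om (fun s => tri (u s) (v s) (w s))
    (fun z => tri a (v t) (w t) z + tri (u t) b (w t) z + tri (u t) (v t) c z) t.
Proof.
move=> wu wv ww wa wb wc Hu Hv Hw e e0.
have n0 := wnorm_ge0 om.
pose M := 1 + N (u t) + N (v t) + N (w t) + N a + N b + N c.
have [[M0 nut vM] [wM na nb]] : [/\ 0 < M, N (u t) <= M & N (v t) + 1 <= M] /\
    [/\ N (w t) + 1 <= M, N a <= M & N b <= M].
  rewrite /M; move: (N (u t)) (N (v t)) (N (w t)) (N a) (N b) (N c) (n0 (u t)) (n0 (v t))
    (n0 (w t)) (n0 a) (n0 b) (n0 c) => *; do 2!split; lra.
have nvt : N (v t) <= M by rewrite (le_trans _ vM)// lerDl.
have K0 := tri_cst_gt0.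
(* Six error terms, three in [S1] and three in [S2], each at most [tri_cst * M ^+ 2 * e1] per unit
   of time. *)
pose e1 := e / (6 * tri_cst * M ^+ 2).
have D0 : 0 < 6 * tri_cst * M ^+ 2 by apply: mulr_gt0; [exact: mulr_gt0|exact: exprn_gt0].
have e10 : 0 < e1 by rewrite divr_gt0.
(* The bound by [1] keeps the norms of [v (t + h)] and [w (t + h)] below [M]. *)
pose e2 := Num.min 1 e1; have e20 : 0 < e2 by rewrite lt_min ltr01.
have [d1 d10 H1] := Hu _ e10; have [d2 d20 H2] := Hv _ e10; have [d3 d30 H3] := Hw _ e10.
have [d4 d40 H4] := wderiv_cont wv wb Hv e20; have [d5 d50 H5] := wderiv_cont ww wc Hw e20.
exists (Num.min (Num.min (Num.min d1 d2) (Num.min d3 d4)) d5).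
  by rewrite !lt_min d10 d20 d30 d40 d50.
move=> h; rewrite !lt_min => /andP[/andP[/andP[/H1 h1 /H2 h2] /andP[/H3 h3 /H4 h4]] /H5 h5].
set ra := (fun z => u (t + h) z - u t z - h%:C%C * a z) in h1.
set rb := (fun z => v (t + h) z - v t z - h%:C%C * b z) in h2.
set rc := (fun z => w (t + h) z - w t z - h%:C%C * c z) in h3.
set dv := (fun z => v (t + h) z - v t z) in h4.
set dw := (fun z => w (t + h) z - w t z) in h5.
have wra : W ra by apply: wsB; [exact: wsB|exact: wsZ].
have wrb : W rb by apply: wsB; [exact: wsB|exact: wsZ].
have wrc : W rc by apply: wsB; [exact: wsB|exact: wsZ].
have wdv : W dv by exact: wsB.
have wdw : W dw by exact: wsB.
have Eu : u (t + h) = (fun z => (fun z => u t z + h%:C%C * a z) z + 1%:C%C * ra z).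
  by apply/funext => z; rewrite /ra; ring.
have Ev : v (t + h) = (fun z => (fun z => v t z + h%:C%C * b z) z + 1%:C%C * rb z).
  by apply/funext => z; rewrite /rb; ring.
have Ew : w (t + h) = (fun z => (fun z => w t z + h%:C%C * c z) z + 1%:C%C * rc z).
  by apply/funext => z; rewrite /rc; ring.
have Ev' : v (t + h) = (fun z => v t z + 1%:C%C * dv z).
  by apply/funext => z; rewrite /dv; ring.
have Ew' : w (t + h) = (fun z => w t z + 1%:C%C * dw z).
  by apply/funext => z; rewrite /dw; ring.
have wu' : W (fun z => u t z + h%:C%C * a z) by apply: wsD; [exact: wu|exact: wsZ].
have wv' : W (fun z => v t z + h%:C%C * b z) by apply: wsD; [exact: wv|exact: wsZ].
have ww' : W (fun z => w t z + h%:C%C * c z) by apply: wsD; [exact: ww|exact: wsZ].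
have E1 z : tri (u (t + h)) (v (t + h)) (w (t + h)) z = tri (u t) (v (t + h)) (w (t + h)) z +
    h%:C%C * tri a (v (t + h)) (w (t + h)) z + tri ra (v (t + h)) (w (t + h)) z.
  by rewrite [in LHS]Eu tri_lin1// tri_lin1// mul1r.
have E2 z : tri (u t) (v (t + h)) (w (t + h)) z = tri (u t) (v t) (w (t + h)) z +
    h%:C%C * tri (u t) b (w (t + h)) z + tri (u t) rb (w (t + h)) z.
  by rewrite [in LHS]Ev tri_lin2// tri_lin2// mul1r.
have E3 z : tri (u t) (v t) (w (t + h)) z = tri (u t) (v t) (w t) z +
    h%:C%C * tri (u t) (v t) c z + tri (u t) (v t) rc z.
  by rewrite [in LHS]Ew tri_lin3// tri_lin3// mul1r.
have E4 z : tri a (v (t + h)) (w (t + h)) z = tri a (v t) (w (t + h)) z + tri a dv (w (t + h)) z.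
  by rewrite [in LHS]Ev' tri_lin2// mul1r.
have E5 z : tri a (v t) (w (t + h)) z = tri a (v t) (w t) z + tri a (v t) dw z.
  by rewrite [in LHS]Ew' tri_lin3// mul1r.
have E6 z : tri (u t) b (w (t + h)) z = tri (u t) b (w t) z + tri (u t) b dw z.
  by rewrite [in LHS]Ew' tri_lin3// mul1r.
(* [S1] collects the terms containing a first-order remainder. In [S2], multiplied by [h], the
   derivative of one factor meets the increment of a later one. *)
pose S1 z := tri ra (v (t + h)) (w (t + h)) z + tri (u t) rb (w (t + h)) z + tri (u t) (v t) rc z.
pose S2 z := tri a dv (w (t + h)) z + tri a (v t) dw z + tri (u t) b dw z.
have -> : (fun z => tri (u (t + h)) (v (t + h)) (w (t + h)) z - tri (u t) (v t) (w t) z -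
    h%:C%C * (tri a (v t) (w t) z + tri (u t) b (w t) z + tri (u t) (v t) c z)) =
    (fun z => S1 z + h%:C%C * S2 z).
  apply/funext => z; rewrite E1 E2 E3 E4 E5 E6 /S1 /S2.
  move: (tri (u t) (v t) (w t) z) (tri a (v t) (w t) z) (tri a dv (w (t + h)) z)
    (tri a (v t) dw z) (tri ra (v (t + h)) (w (t + h)) z) (tri (u t) b (w t) z)
    (tri (u t) b dw z) (tri (u t) rb (w (t + h)) z) (tri (u t) (v t) c z)
    (tri (u t) (v t) rc z) => *; ring.
have W1 : W S1 by do 2?[apply: wsD]; exact: tri_W.
have W2 : W S2 by do 2?[apply: wsD]; exact: tri_W.
have nv : N (v (t + h)) <= M.
  apply: le_trans vM; have := wnD (wv t) wdv.
  rewrite (_ : (fun z => v t z + dv z) = v (t + h)); last by apply/funext => z; rewrite /dv; ring.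
  by move=> /le_trans; apply; rewrite lerD2l (le_trans h4)// ge_min lexx.
have nw : N (w (t + h)) <= M.
  apply: le_trans wM; have := wnD (ww t) wdw.
  rewrite (_ : (fun z => w t z + dw z) = w (t + h)); last by apply/funext => z; rewrite /dw; ring.
  by move=> /le_trans; apply; rewrite lerD2l (le_trans h5)// ge_min lexx.
have e21 : e2 <= e1 by rewrite ge_min lexx orbT.
have T (f1 f2 f3 : C -> C) (x : R) : W f1 -> W f2 -> W f3 -> 0 <= x ->
    N f1 * N f2 * N f3 <= M * M * x -> N (tri f1 f2 f3) <= tri_cst * M ^+ 2 * x.
  move=> w1 w2 w3 x0 H; apply: le_trans (tri_N w1 w2 w3) _.
  have -> : tri_cst * M ^+ 2 * x = tri_cst * (M * M * x) by ring.
  by apply: ler_wpM2l => //; exact: ltW.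
have Pm (x y r x' y' r' : R) : 0 <= x -> 0 <= y -> 0 <= r -> x <= x' -> y <= y' -> r <= r' ->
    x * y * r <= x' * y' * r' by move=> *; rewrite !ler_pM// mulr_ge0.
have he0 : 0 <= `|h| * e1 by rewrite mulr_ge0// ltW.
have e1' := ltW e10.
have h4' := le_trans h4 e21; have h5' := le_trans h5 e21.
have B1 : N S1 <= 3 * (tri_cst * M ^+ 2 * (`|h| * e1)).
  apply: wnorm_sum3; do ?exact: tri_W.
  - by apply: T => //; rewrite -mulrA mulrC; apply: Pm.
  - by apply: T => //; rewrite mulrAC; apply: Pm.
  - by apply: T => //; apply: Pm.
have B2 : N S2 <= 3 * (tri_cst * M ^+ 2 * e1).
  apply: wnorm_sum3; do ?exact: tri_W.
  - by apply: T => //; rewrite mulrAC; apply: Pm.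
  - by apply: T => //; apply: Pm.
  - by apply: T => //; apply: Pm.
apply: le_trans (wnD W1 (wsZ (h%:C%C) W2)) _; rewrite wnZ// normc_rc.
have Ee : e = 6 * (tri_cst * M ^+ 2 * e1) by rewrite /e1; field; apply/andP; split; rewrite gt_eqF.
have -> : `|h| * e = 3 * (tri_cst * M ^+ 2 * (`|h| * e1)) + `|h| * (3 * (tri_cst * M ^+ 2 * e1)).
  rewrite {1}Ee; ring.
by apply: lerD => //; exact: ler_wpM2l.
Qed.

End TrilinearMap.

(** * The flow *)

Section Flow.
Variable R : realType.
Local Notation C := (R[i]).
Local Notation L := (@L2norm R).
Implicit Types (u v : R -> C -> C) (a b c : C -> C) (om : C -> R).

(* [s = -1] in the equation for [u] and [s = 1] in that for [v]. *)
Definition flow_rhs (s : R) u v (t : R) : C -> C :=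
  fun z => 'i%C * s%:C%C * tri (v t) (v t) (u t) z.

Lemma tri_sqmod a b : tri b b a = fockproj (sqmod_mul b a).
Proof. by rewrite sqmod_mulE. Qed.

Lemma normc_is (s : R) : normc ('i%C * s%:C%C : C) = `|s|.
Proof. by rewrite normcM normci mul1r normc_rc. Qed.

Lemma L2norm_conserved s u v : (forall t, fock (u t)) -> (forall t, fock (v t)) ->
  (forall t, wderiv (fun=> 1) u (flow_rhs s u v t) t) ->
  forall t, L (u t) = L (u 0).
Proof.
move=> fu fv H.
have t1 := tame_weight1 R.
have w1 r : wspace (fun=> 1) (u r) by rewrite wspace1.
have w2 r : wspace (fun=> 1) (v r) by rewrite wspace1.
have step t e : 0 < e -> exists2 d, 0 < d & forall h, `|h| < d ->
    `|L (u (t + h)) ^+ 2 - L (u t) ^+ 2| <= `|h| * (0 + e).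
  move=> e0.
  have wg := tri_W (lexx 0) t1 (w2 t) (w2 t) (w1 t).
  set g := tri _ _ _ in wg; have [_ fg] := wg; have [_ ig] := fg; have [_ iu] := fu t.
  have g0 := L2norm_ge0 g; have u0 := L2norm_ge0 (u t).
  (* [M] bounds [L (u (t + h)) + L A] for the first-order approximation [A] below, when [|h| < 1]
     and [e1 <= 1]. *)
  pose M := 2 * (L (u t) + `|s| * L g) + 1.
  have M0 : 0 < M.
    by rewrite /M; have : 0 <= `|s| * L g; [rewrite mulr_ge0|lra].
  pose e1 := Num.min 1 (e / 2 / M).
  have e10 : 0 < e1 by rewrite lt_min ltr01 !divr_gt0.
  have q0 : 0 <= s ^+ 2 * L g ^+ 2 by rewrite mulr_ge0 ?sqr_ge0.
  have q1 : 0 < s ^+ 2 * L g ^+ 2 + 1 by lra.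
  have [d d0 {}H] := H t _ e10.
  exists (Num.min (Num.min d 1) (e / 2 / (s ^+ 2 * L g ^+ 2 + 1))).
    by rewrite !lt_min d0 ltr01 !divr_gt0.
  move=> h; rewrite !lt_min => /andP[/andP[hd h1] h2].
  have {H}hr := H h hd.
  (* By orthogonality, the squared norm of this first-order approximation of [u (t + h)] differs
     from that of [u t] only by a term in [h ^+ 2]. *)
  pose A (z : C) := u t z + 'i%C * (s * h)%:C%C * g z.
  have fA : fock A by apply: fockD => //; exact: fockZ.
  have wA : wspace (fun=> 1) A by rewrite wspace1.
  have PA : L A ^+ 2 = L (u t) ^+ 2 + (s * h) ^+ 2 * L g ^+ 2.
    by apply: L2norm_sq_i => //; rewrite /g tri_sqmod; apply: sqmod_pairing_real => //;
      have := tri_inL2 (lexx 0) t1 (w2 t) (w2 t) (w1 t); rewrite sqmod_mulE.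
  have hA : L A <= L (u t) + `|s| * L g.
    have := wnD (w1 t) (wsZ ('i%C * (s * h)%:C%C) wg); rewrite wnZ// normc_is !wnorm1.
    move=> /le_trans; apply; rewrite lerD2l normrM ler_wpM2r// ler_piMr// ltW//.
  have hX := wnorm_dist (w1 (t + h)) wA; rewrite !wnorm1 in hX.
  have EA : (fun z => u (t + h) z - A z) = (fun z => u (t + h) z - u t z - h%:C%C * flow_rhs s u v t z).
    apply/funext => z; rewrite /A /flow_rhs -/g.
    by rewrite (rmorphM (real_complex R)) /=; ring.
  rewrite wnorm1 in hr; rewrite EA in hX; have {hr EA}hX := le_trans hX hr.
  have X0 := L2norm_ge0 (u (t + h)); have A0 := L2norm_ge0 A.
  have he : `|h| * e1 <= 1.
    have : e1 <= 1 by rewrite ge_min lexx.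
    by move=> ?; rewrite mulr_ile1// ltW.
  have hM : L (u (t + h)) + L A <= M.
    by move: hX; rewrite ler_norml => /andP[_ ?]; rewrite /M; lra.
  rewrite add0r.
  have -> : L (u (t + h)) ^+ 2 - L (u t) ^+ 2 =
      (L (u (t + h)) - L A) * (L (u (t + h)) + L A) + (s ^+ 2 * L g ^+ 2) * `|h| ^+ 2.
    by rewrite real_normK ?num_real//; move: PA; rewrite exprMn => PA; lra.
  apply: le_trans (ler_normD _ _) _; rewrite normrM (ger0_norm (addr_ge0 X0 A0)).
  rewrite [X in _ + X]ger0_norm; last by rewrite mulr_ge0 ?sqr_ge0.
  have B1 : `|L (u (t + h)) - L A| * (L (u (t + h)) + L A) <= `|h| * (e / 2).
    apply: (@le_trans _ _ (`|h| * e1 * M)).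
      by apply: ler_pM => //; exact: addr_ge0.
    rewrite -mulrA ler_wpM2l// -ler_pdivlMr//.
    by rewrite ge_min lexx orbT.
  have B2 : s ^+ 2 * L g ^+ 2 * `|h| ^+ 2 <= `|h| * (e / 2).
    rewrite expr2 mulrCA ler_wpM2l//.
    move: h2; rewrite ltr_pdivlMr// mulrC => h2; have := normr_ge0 h; lra.
  lra.
have conv t x y : `|y| <= 0 -> y = x - t -> x = t :> R.
  by rewrite normr_le0 => /eqP -> /eqP; rewrite eq_sym subr_eq0 => /eqP.
move=> t.
have sq : L (u t) ^+ 2 = L (u 0) ^+ 2.
  have [t0|/ltW t0] := leP 0 t.
    have := mean_value_le t0 (fun x _ => @step x); rewrite mul0r => /conv; exact.
  have := mean_value_le t0 (fun x _ => @step x); rewrite mul0r => /conv h.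
  by apply/esym; apply: h.
by apply/eqP; rewrite -(eqrXn2 (ltn0Sn 1))// ?L2norm_ge0//; apply/eqP.
Qed.

(** * A priori growth and Lipschitz bounds in the weighted norm *)

Section Growth.
Variables (kappa : R) (s : R) (u v : R -> C -> C).
Hypotheses (kappa_ge0 : 0 <= kappa) (s1 : `|s| = 1).
Hypotheses (fu : forall t, fock (u t)) (fv : forall t, fock (v t)).
Hypothesis du : forall t, wderiv (fun=> 1) u (flow_rhs s u v t) t.
Hypothesis vE : forall t, L (v t) = L (v 0).
Local Notation X := (expw kappa).
Local Notation K := (tri_cst kappa).
Local Notation growth := (2 * (K * L (v 0) ^+ 2)).

(** The weight is put on [u]; conservation of the norm of [v] makes the coefficient constant in
    time. *)
Lemma flow_rhs_bound om t : tame_weight kappa om -> wspace om (u t) ->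
  wspace om (flow_rhs s u v t) /\
  wnorm om (flow_rhs s u v t) <= K * L (v 0) ^+ 2 * wnorm om (u t).
Proof.
move=> to wu; have [_ w n] := tri3 kappa_ge0 to (fv t) (fv t) wu.
split; first exact: wsZ.
by rewrite wnZ// normc_is s1 mul1r -mulrA expr2 -{1}(vE t) -{1}(vE t).
Qed.

(** A bounded weight is dominated by a constant, so the L^2 derivative is also the derivative in the
    truncated norm. *)
Lemma wderiv_trunc n t : wderiv (truncw kappa n) u (flow_rhs s u v t) t.
Proof.
have t1 := tame_weight1 R.
have wu r : wspace (fun=> 1) (u r) by rewrite wspace1.
have wf : wspace (fun=> 1) (flow_rhs s u v t).
  by apply: wsZ; apply: (tri_W (lexx 0) t1) => //; rewrite wspace1.
apply: (wderiv_dom t1 (tame_truncw n kappa_ge0) (expR_ge0 (kappa * n%:R)) _ wu wf (du t)).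
by move=> z; rewrite mulr1; exact: truncw_bound.
Qed.

Lemma wspace_truncw n t : wspace (truncw kappa n) (u t).
Proof. by have [] := wspace_trunc n kappa_ge0 (fu t). Qed.

Lemma trunc_growth n t :
  wnorm (truncw kappa n) (u t) <= wnorm (truncw kappa n) (u 0) * expR (growth * `|t|).
Proof.
have K0 := ltW (tri_cst_gt0 kappa).
apply: (@gronwall R (fun r => wnorm (truncw kappa n) (u r)) (K * L (v 0) ^+ 2)).
- by rewrite mulr_ge0 ?sqr_ge0.
- by move=> r; exact: wnorm_ge0.
move=> r e e0.
have [wf nf] := flow_rhs_bound (tame_truncw n kappa_ge0) (wspace_truncw n r).
have [d d0 H] := wderiv_norm (wspace_truncw n) wf (wderiv_trunc n r) e0.
exists d => // h hd; apply: le_trans (H h hd) _.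
by rewrite ler_wpM2l// lerD2r.
Qed.

Lemma exp_growth t : wspace X (u 0) ->
  wspace X (u t) /\ wnorm X (u t) <= wnorm X (u 0) * expR (growth * `|t|).
Proof.
move=> w0; apply: wnorm_trunc_limit => //; first by rewrite mulr_ge0 ?wnorm_ge0 ?expR_ge0.
move=> n; apply: le_trans (trunc_growth n t) _.
by rewrite ler_wpM2r ?expR_ge0//; exact: wnorm_trunc_le.
Qed.

(** Continuity in time for the full weight must precede differentiability. The mean value inequality
    with slope [0] gives a constant independent of [n], and the bound passes to the limit. *)
Lemma exp_lipschitz t : wspace X (u 0) -> exists2 B, 0 <= B & forall h, `|h| <= 1 ->
  wnorm X (fun z => u (t + h) z - u t z) <= B * `|h|.
Proof.
move=> w0; have K0 := ltW (tri_cst_gt0 kappa).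
have KL : 0 <= K * L (v 0) ^+ 2 by rewrite mulr_ge0 ?sqr_ge0.
pose B := K * L (v 0) ^+ 2 * (wnorm X (u 0) * expR (growth * (`|t| + 1))).
have B0 : 0 <= B by rewrite mulr_ge0// mulr_ge0 ?wnorm_ge0 ?expR_ge0.
exists B => // h h1.
have [] // := @wnorm_trunc_limit R kappa (fun z => u (t + h) z - u t z) (B * `|h|) kappa_ge0.
- exact: mulr_ge0.
- exact: fockB.
move=> n; have tn := tame_truncw n kappa_ge0; have wn := wspace_truncw n.
have f0 : wspace (truncw kappa n) (fun=> 0 : C).
  have := wsZ 0 (wn 0); congr wspace; by apply/funext => z; rewrite mul0r.
have wf r : wspace (truncw kappa n) (flow_rhs s u v r) by have [] := flow_rhs_bound tn (wn r).
have := wnorm_mean_value (h := h) (L := B) wn wf f0 (wderiv_trunc n) (t := t).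
have -> : (fun z => u (t + h) z - u t z - h%:C%C * 0) = (fun z => u (t + h) z - u t z).
  by apply/funext => z; rewrite mulr0 subr0.
apply=> r hr.
have -> : (fun z => flow_rhs s u v r z - 0) = flow_rhs s u v r.
  by apply/funext => z; rewrite subr0.
have [_ n1] := flow_rhs_bound tn (wn r); apply: le_trans n1 _.
apply: ler_wpM2l => //; apply: le_trans (trunc_growth n r) _.
apply: ler_pM; rewrite ?wnorm_ge0 ?expR_ge0//; first exact: wnorm_trunc_le.
rewrite ler_expR ler_wpM2l//; first by rewrite mulr_ge0.
have := ler_normD (r - t) t; rewrite subrK; lra.
Qed.

End Growth.

Lemma tri_telescope kappa om a b c a' b' c' : 0 <= kappa -> tame_weight kappa om ->
  wspace om a -> wspace om b -> wspace om c -> wspace om a' -> wspace om b' -> wspace om c' ->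
  forall z, tri a' b' c' z - tri a b c z =
    tri (fun z => a' z - a z) b' c' z + tri a (fun z => b' z - b z) c' z +
    tri a b (fun z => c' z - c z) z.
Proof.
move=> k0 to wa wb wc wa' wb' wc' z.
have E (f g : C -> C) : f = (fun z => g z + 1%:C%C * (f z - g z)).
  by apply/funext => x; rewrite mul1r addrC subrK.
have [da db dc] := And3 (wsB wa' wa) (wsB wb' wb) (wsB wc' wc).
rewrite [X in tri X b' c' z](E a' a) (tri_lin1 k0 to 1) // [X in tri a X c' z](E b' b).
rewrite (tri_lin2 k0 to 1) // [X in tri a b X z](E c' c) (tri_lin3 k0 to 1) //.
rewrite !mul1r.
move: (tri a b c z) (tri a b _ z) (tri a _ c' z) (tri _ b' c' z) => *; ring.
Qed.

End Flow.

(** * Smoothness in the weighted norm *)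

Section Regularity.
Variable R : realType.
Local Notation C := (R[i]).
Local Notation L := (@L2norm R).
Implicit Types (u v : R -> C -> C) (a b c : C -> C) (om : C -> R).

Lemma tri_diff_le kappa om a b c a' b' c' (M x : R) : 0 <= kappa -> tame_weight kappa om ->
  wspace om a -> wspace om b -> wspace om c -> wspace om a' -> wspace om b' -> wspace om c' ->
  wnorm om a <= M -> wnorm om b <= M -> wnorm om b' <= M -> wnorm om c' <= M ->
  wnorm om (fun z => a' z - a z) <= x -> wnorm om (fun z => b' z - b z) <= x ->
  wnorm om (fun z => c' z - c z) <= x ->
  wnorm om (fun z => tri a' b' c' z - tri a b c z) <= 3 * (tri_cst kappa * (M * M * x)).
Proof.
move=> k0 to wa wb wc wa' wb' wc' na nb nb' nc' da db dc.
have n0 := wnorm_ge0 om; have M0 : 0 <= M := le_trans (n0 a) na.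
have x0 := le_trans (n0 _) da; have K0 := ltW (tri_cst_gt0 kappa).
have [wda wdb wdc] := And3 (wsB wa' wa) (wsB wb' wb) (wsB wc' wc).
have -> : (fun z => tri a' b' c' z - tri a b c z) =
    (fun z => tri (fun z => a' z - a z) b' c' z + tri a (fun z => b' z - b z) c' z +
      tri a b (fun z => c' z - c z) z).
  by apply/funext => z; exact: (tri_telescope k0 to).
have T (f1 f2 f3 : C -> C) : wspace om f1 -> wspace om f2 -> wspace om f3 ->
    wnorm om f1 * wnorm om f2 * wnorm om f3 <= M * M * x ->
    wnorm om (tri f1 f2 f3) <= tri_cst kappa * (M * M * x).
  move=> w1 w2 w3 H; apply: le_trans (tri_N k0 to w1 w2 w3) _; exact: ler_wpM2l.
have Pm (y1 y2 y3 : R) : 0 <= y1 -> 0 <= y2 -> 0 <= y3 -> y1 <= M -> y2 <= M -> y3 <= x ->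
    y1 * y2 * y3 <= M * M * x by move=> *; rewrite !ler_pM// mulr_ge0.
apply: wnorm_sum3; do ?exact: (tri_W k0 to).
- by apply: T => //; rewrite -mulrA mulrC; apply: Pm.
- by apply: T => //; rewrite mulrAC; apply: Pm.
- by apply: T => //; apply: Pm.
Qed.

(** By [exp_lipschitz] and trilinearity the right-hand side is Lipschitz near [t] for the full
    weight. The mean value inequality for truncated weights then bounds the first-order remainder by
    a multiple of [h ^+ 2] that does not depend on [n]. *)
Lemma wderiv_exp kappa s s' u v : 0 <= kappa -> `|s| = 1 -> `|s'| = 1 ->
  (forall t, fock (u t)) -> (forall t, fock (v t)) ->
  (forall t, wderiv (fun=> 1) u (flow_rhs s u v t) t) ->
  (forall t, wderiv (fun=> 1) v (flow_rhs s' v u t) t) ->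
  wspace (expw kappa) (u 0) -> wspace (expw kappa) (v 0) ->
  forall t, wderiv (expw kappa) u (flow_rhs s u v t) t.
Proof.
move=> k0 s1 s1' fu fv du dv u0 v0 t.
have uE := L2norm_conserved fu fv du; have vE := L2norm_conserved fv fu dv.
pose X := expw kappa; have to := tame_expw k0 : tame_weight kappa X.
have wu r : wspace X (u r) by have [] := exp_growth k0 s1 fu fv du vE r u0.
have wv r : wspace X (v r) by have [] := exp_growth k0 s1' fv fu dv uE r v0.
have [B1 B10 H1] := exp_lipschitz k0 s1 fu fv du vE t u0.
have [B2 B20 H2] := exp_lipschitz k0 s1' fv fu dv uE t v0.
have n0 := wnorm_ge0 X; have K0 := tri_cst_gt0 kappa.
pose B := B1 + B2.
pose M := wnorm X (u t) + wnorm X (v t) + B + 1.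
have M0 : 0 < M by rewrite /M /B; have := n0 (u t); have := n0 (v t); lra.
have wf r : wspace X (flow_rhs s u v r) by apply: wsZ; apply: (tri_W k0 to).
have lip r : `|r - t| <= 1 -> wnorm X (fun z => flow_rhs s u v r z - flow_rhs s u v t z) <=
    3 * (tri_cst kappa * (M * M * (B * `|r - t|))).
  move=> rt.
  have -> : (fun z => flow_rhs s u v r z - flow_rhs s u v t z) =
      (fun z => 'i%C * s%:C%C * (tri (v r) (v r) (u r) z - tri (v t) (v t) (u t) z)).
    by apply/funext => z; rewrite /flow_rhs mulrBr.
  rewrite wnZ ?normc_is ?s1 ?mul1r; last by apply: wsB; exact: (tri_W k0 to).
  have Er : t + (r - t) = r by rewrite addrC subrK.
  have hu := H1 _ rt; have hv := H2 _ rt; rewrite Er in hu hv.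
  have rt0 := normr_ge0 (r - t).
  have hu' : wnorm X (fun z => u r z - u t z) <= B * `|r - t|.
    by apply: le_trans hu _; rewrite ler_wpM2r// /B; lra.
  have hv' : wnorm X (fun z => v r z - v t z) <= B * `|r - t|.
    by apply: le_trans hv _; rewrite ler_wpM2r// /B; lra.
  have B0 : 0 <= B by rewrite addr_ge0.
  have Brt : B * `|r - t| <= B by rewrite ler_piMr.
  have nu : wnorm X (u r) <= M.
    have := wnD (wu t) (wsB (wu r) (wu t)); rewrite (_ : (fun z => u t z + (u r z - u t z)) = u r).
      by rewrite /M; have := n0 (v t); lra.
    by apply/funext => z; rewrite addrC subrK.
  have nv : wnorm X (v r) <= M.
    have := wnD (wv t) (wsB (wv r) (wv t)); rewrite (_ : (fun z => v t z + (v r z - v t z)) = v r).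
      by rewrite /M; have := n0 (u t); lra.
    by apply/funext => z; rewrite addrC subrK.
  have nvt : wnorm X (v t) <= M by rewrite /M; have := n0 (u t); lra.
  exact: (tri_diff_le k0 to (wv t) (wv t) (wu t) (wv r) (wv r) (wu r) nvt nvt nv nu hv' hv' hu').
move=> e e0; have q0 : 0 <= 3 * (tri_cst kappa * (M * M * B)).
  apply: mulr_ge0 => //; apply: mulr_ge0; first exact: ltW.
  by apply: mulr_ge0; [apply: mulr_ge0; exact: ltW|exact: addr_ge0].
have q1 : 0 < 3 * (tri_cst kappa * (M * M * B)) + 1 by lra.
exists (Num.min 1 (e / (3 * (tri_cst kappa * (M * M * B)) + 1))).
  by rewrite lt_min ltr01 divr_gt0.
move=> h; rewrite lt_min ltr_pdivlMr// => /andP[h1 h2].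
have fr r : fock (flow_rhs s u v r) by exact: wspace_fock (wf r).
have [] // := @wnorm_trunc_limit R kappa (fun z => u (t + h) z - u t z - h%:C%C * flow_rhs s u v t z) (`|h| * e) k0.
- by rewrite mulr_ge0// ltW.
- by apply: fockB; [exact: fockB|exact: fockZ].
move=> n; have tn := tame_truncw n k0.
have wn r : wspace (truncw kappa n) (u r) := wspace_truncw k0 fu n r.
have wfn r : wspace (truncw kappa n) (flow_rhs s u v r) by have [] := wspace_trunc n k0 (fr r).
rewrite mulrC; apply: (wnorm_mean_value wn wfn (wfn t) (wderiv_trunc k0 fu fv du n)) => r rt.
apply: le_trans (wnorm_trunc_le n k0 (wsB (wf r) (wf t))) _.
apply: le_trans (lip r _) _; first by apply: le_trans rt _; exact: ltW.
have -> : 3 * (tri_cst kappa * (M * M * (B * `|r - t|))) = 3 * (tri_cst kappa * (M * M * B)) * `|r - t| by ring.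
apply: le_trans (ler_wpM2l q0 rt) _.
by have := normr_ge0 h; lra.
Qed.

(* The time derivatives of a solution are polynomial expressions in the
   solution; these are their formal counterparts. *)
Inductive flow_term :=
| FVar of bool
| FAdd of flow_term & flow_term
| FScale of C & flow_term
| FTri of flow_term & flow_term & flow_term.

Fixpoint flow_eval (x : bool -> R -> C -> C) (T : flow_term) (t : R) : C -> C :=
  match T with
  | FVar i => x i t
  | FAdd T1 T2 => fun z => flow_eval x T1 t z + flow_eval x T2 t z
  | FScale k T1 => fun z => k * flow_eval x T1 t z
  | FTri T1 T2 T3 => tri (flow_eval x T1 t) (flow_eval x T2 t) (flow_eval x T3 t)
  end.

(** A variable is differentiated by means of the equation, where [~~] exchanges the two components;
    products follow the Leibniz rule. *)
Fixpoint flow_diff (s : bool -> R) (T : flow_term) : flow_term :=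
  match T with
  | FVar i => FScale ('i%C * (s i)%:C%C) (FTri (FVar (~~ i)) (FVar (~~ i)) (FVar i))
  | FAdd T1 T2 => FAdd (flow_diff s T1) (flow_diff s T2)
  | FScale k T1 => FScale k (flow_diff s T1)
  | FTri T1 T2 T3 => FAdd (FAdd (FTri (flow_diff s T1) T2 T3) (FTri T1 (flow_diff s T2) T3))
      (FTri T1 T2 (flow_diff s T3))
  end.

Lemma flow_smooth kappa om s x i : 0 <= kappa -> tame_weight kappa om ->
  (forall j t, wspace om (x j t)) ->
  (forall j t, wderiv om (x j) (flow_rhs (s j) (x j) (x (~~ j)) t) t) ->
  smooth_curve (wspace om) (wnorm om) (x i).
Proof.
move=> k0 to wx dx.
have wT T t : wspace om (flow_eval x T t).
  elim: T => [j|T1 H1 T2 H2|k T1 H1|T1 H1 T2 H2 T3 H3] /=.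
  - exact: wx.
  - exact: wsD.
  - exact: wsZ.
  - exact: (tri_W k0 to).
have dT T t : wderiv om (flow_eval x T) (flow_eval x (flow_diff s T) t) t.
  elim: T => /= [j|T1 H1 T2 H2|k T1 H1|T1 H1 T2 H2 T3 H3].
  - exact: dx.
  - exact: wderivD.
  - exact: wderivZ.
  - exact: (wderiv_tri k0 to).
exists (fun n => flow_eval x (iter n (flow_diff s) (FVar i))) => // n.
by apply/curve_derivativeP => t.
Qed.

End Regularity.

(** * Stability with respect to the initial data *)

Section Stability.
Variables (R : realType) (kappa s s' : R) (om : R[i] -> R).
Local Notation C := (R[i]).
Local Notation L := (@L2norm R).
Hypotheses (kappa_ge0 : 0 <= kappa) (om_tame : tame_weight kappa om) (s1 : `|s| = 1) (s1' : `|s'| = 1).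

Local Notation N := (wnorm om).
Local Notation W := (wspace om).
Local Notation K := (tri_cst kappa).

(** In each telescoped term the weight falls on the difference, so the other factors enter only
    through L^2 norms, which are conserved. This is why the final exponent contains no weighted
    norm. *)
Lemma flow_rhs_diff (q : R) (u v u' v' : R -> C -> C) (t : R) : `|q| = 1 ->
  W (u t) -> W (v t) -> W (u' t) -> W (v' t) ->
  N (fun z => flow_rhs q u v t z - flow_rhs q u' v' t z) <=
  K * (L (v' t) ^+ 2 * N (fun z => u t z - u' t z) +
    (L (v t) + L (v' t)) * L (u t) * N (fun z => v t z - v' t z)).
Proof.
move=> q1 wu wv wu' wv'; have [dU dV] := conj (wsB wu wu') (wsB wv wv').
have [[_ fu] [_ fv]] := conj wu wv; have [[_ fu'] [_ fv']] := conj wu' wv'.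
have -> : (fun z => flow_rhs q u v t z - flow_rhs q u' v' t z) =
    (fun z => 'i%C * q%:C%C * (tri (v t) (v t) (u t) z - tri (v' t) (v' t) (u' t) z)).
  by apply/funext => z; rewrite /flow_rhs mulrBr.
rewrite wnZ ?normc_is ?q1 ?mul1r; last by apply: wsB; exact: (tri_W kappa_ge0 om_tame).
have -> : (fun z => tri (v t) (v t) (u t) z - tri (v' t) (v' t) (u' t) z) =
    (fun z => tri (fun z => v t z - v' t z) (v t) (u t) z + tri (v' t) (fun z => v t z - v' t z) (u t) z +
      tri (v' t) (v' t) (fun z => u t z - u' t z) z).
  by apply/funext => z; exact: (tri_telescope kappa_ge0 om_tame).
have [_ w1 n1] := tri1 kappa_ge0 om_tame dV fv fu.
have [_ w2 n2] := tri2 kappa_ge0 om_tame fv' dV fu.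
have [_ w3 n3] := tri3 kappa_ge0 om_tame fv' fv' dU.
apply: le_trans (wnD (wsD w1 w2) w3) _.
apply: le_trans (lerD (le_trans (wnD w1 w2) (lerD n1 n2)) n3) _.
rewrite le_eqVlt; apply/orP; left; apply/eqP; ring.
Qed.

(** The chain rule for the square of a norm, in terms of increments; the squared increment is of
    second order in [h]. *)
Lemma sqr_step (f : R -> R) (t a : R) : (forall r, 0 <= f r) -> 0 <= a ->
  (forall e, 0 < e -> exists2 d, 0 < d & forall h, `|h| < d -> `|f (t + h) - f t| <= `|h| * (a + e)) ->
  forall e, 0 < e -> exists2 d, 0 < d & forall h, `|h| < d ->
    `|f (t + h) ^+ 2 - f t ^+ 2| <= `|h| * (2 * f t * a + e).
Proof.
move=> f0 a0 H e e0.
pose e1 := Num.min 1 (e / 2 / (2 * f t + 1)).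
have q : 0 < 2 * f t + 1 by have := f0 t; lra.
have e10 : 0 < e1 by rewrite lt_min ltr01 !divr_gt0.
have e11 : e1 <= 1 by rewrite ge_min lexx.
have e12 : e1 * (2 * f t + 1) <= e / 2 by rewrite -ler_pdivlMr// ge_min lexx orbT.
have p : 0 < (a + 1) ^+ 2 + 1 by rewrite ltr_wpDl ?sqr_ge0.
have [d d0 {}H] := H _ e10; exists (Num.min d (e / 2 / ((a + 1) ^+ 2 + 1))).
  by rewrite lt_min d0 !divr_gt0.
move=> h; rewrite lt_min ltr_pdivlMr// => /andP[/H hd h2].
have h0 := normr_ge0 h; have ft := f0 t.
have -> : f (t + h) ^+ 2 - f t ^+ 2 = (f (t + h) - f t) * (2 * f t) + (f (t + h) - f t) ^+ 2 by ring.
apply: le_trans (ler_normD _ _) _; rewrite normrM (@ger0_norm _ (2 * f t)) ?mulr_ge0// normrX.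
have B1 : `|f (t + h) - f t| * (2 * f t) <= `|h| * (2 * f t * a + e / 2).
  apply: le_trans (ler_wpM2r _ hd) _; first by rewrite mulr_ge0.
  have -> : `|h| * (a + e1) * (2 * f t) = `|h| * (2 * f t * a + e1 * (2 * f t)) by ring.
  by rewrite ler_wpM2l// lerD2l; apply: le_trans e12; rewrite ler_wpM2l ?(ltW e10)//; lra.
have B2 : `|f (t + h) - f t| ^+ 2 <= `|h| * (e / 2).
  apply: (@le_trans _ _ ((`|h| * (a + 1)) ^+ 2)).
    rewrite lerXn2r ?nnegrE ?mulr_ge0//; first by lra.
    by apply: le_trans hd _; rewrite ler_wpM2l//; lra.
  have -> : (`|h| * (a + 1)) ^+ 2 = `|h| * (`|h| * (a + 1) ^+ 2) by ring.
  rewrite ler_wpM2l//; have := sqr_ge0 (a + 1); nra.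
lra.
Qed.

(** Gronwall's inequality for the sum of the squared norms of the differences; its exponent doubles
    the rate [4 * K * S] found in [key], whence the 8. *)
Lemma flow_stability (u v u' v' : R -> C -> C) :
  (forall t, W (u t)) -> (forall t, W (v t)) -> (forall t, W (u' t)) -> (forall t, W (v' t)) ->
  (forall t, wderiv om u (flow_rhs s u v t) t) -> (forall t, wderiv om v (flow_rhs s' v u t) t) ->
  (forall t, wderiv om u' (flow_rhs s u' v' t) t) -> (forall t, wderiv om v' (flow_rhs s' v' u' t) t) ->
  (forall t, L (u t) = L (u 0)) -> (forall t, L (v t) = L (v 0)) ->
  (forall t, L (u' t) = L (u' 0)) -> (forall t, L (v' t) = L (v' 0)) ->
  forall t, N (fun z => u t z - u' t z) ^+ 2 + N (fun z => v t z - v' t z) ^+ 2 <=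
    (N (fun z => u 0 z - u' 0 z) ^+ 2 + N (fun z => v 0 z - v' 0 z) ^+ 2) *
    expR (8 * K * (L (u 0) ^+ 2 + L (u' 0) ^+ 2 + L (v 0) ^+ 2 + L (v' 0) ^+ 2) * `|t|).
Proof.
move=> wu wv wu' wv' du dv du' dv' uE vE uE' vE' t.
pose U r z := u r z - u' r z; pose V r z := v r z - v' r z.
have wU r : W (U r) by exact: wsB.
have wV r : W (V r) by exact: wsB.
have K0 := tri_cst_gt0 kappa.
have n0 := wnorm_ge0 om; have l0 := L2norm_ge0.
set S := L (u 0) ^+ 2 + _ + _ + _.
have S0 : 0 <= S by rewrite !addr_ge0 ?sqr_ge0.
have -> : 8 * K * S * `|t| = 2 * (4 * K * S) * `|t| by ring.
have KS0 : 0 <= 4 * K * S by apply: mulr_ge0 => //; apply: mulr_ge0 => //; exact: ltW.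
apply: (@gronwall R (fun r => N (U r) ^+ 2 + N (V r) ^+ 2) _ t KS0) => [r|r e e0].
  by rewrite addr_ge0 ?sqr_ge0.
have e2 : 0 < e / 2 by rewrite divr_gt0.
have wf (q : R) (f g : R -> C -> C) : W (f r) -> W (g r) -> W (flow_rhs q f g r).
  by move=> wf' wg; apply: wsZ; apply: (tri_W kappa_ge0 om_tame).
have wdU := wsB (wf s _ _ (wu r) (wv r)) (wf s _ _ (wu' r) (wv' r)).
have wdV := wsB (wf s' _ _ (wv r) (wu r)) (wf s' _ _ (wv' r) (wu' r)).
have dU := wderivB wu wu' (wf s _ _ (wu r) (wv r)) (wf s _ _ (wu' r) (wv' r)) (du r) (du' r).
have dV := wderivB wv wv' (wf s' _ _ (wv r) (wu r)) (wf s' _ _ (wv' r) (wu' r)) (dv r) (dv' r).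
have [d1 d10 H1] := sqr_step (fun x => n0 (U x)) (n0 _) (wderiv_norm wU wdU dU) e2.
have [d2 d20 H2] := sqr_step (fun x => n0 (V x)) (n0 _) (wderiv_norm wV wdV dV) e2.
exists (Num.min d1 d2); first by rewrite lt_min d10.
move=> h; rewrite lt_min => /andP[/H1 h1 /H2 h2] {H1 H2}.
have bU := flow_rhs_diff s1 (wu r) (wv r) (wu' r) (wv' r).
have bV := flow_rhs_diff s1' (wv r) (wu r) (wv' r) (wu' r).
rewrite !(uE, vE, uE', vE') -/(U r) -/(V r) in bU bV.
set x := N (U r) in h1 bU bV *; set y := N (V r) in h2 bU bV *.
set aU := N (fun z => flow_rhs s u v r z - flow_rhs s u' v' r z) in h1 bU.
set aV := N (fun z => flow_rhs s' v u r z - flow_rhs s' v' u' r z) in h2 bV.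
have x0 : 0 <= x := n0 _; have y0 : 0 <= y := n0 _.
set p := L (u 0) in bU bV S S0 KS0 *; set p' := L (u' 0) in bU bV S S0 KS0 *.
set q := L (v 0) in bU bV S S0 KS0 *; set q' := L (v' 0) in bU bV S S0 KS0 *.
(* The diagonal terms are at most [2 * S * (x ^+ 2 + y ^+ 2)]. So are the mixed ones, since
   [2 * x * y <= x ^+ 2 + y ^+ 2] and their coefficient is at most [2 * S]. *)
have key : 2 * x * aU + 2 * y * aV <= 4 * K * S * (x ^+ 2 + y ^+ 2).
  apply: (@le_trans _ _ (2 * x * (K * (q' ^+ 2 * x + (q + q') * p * y)) +
      2 * y * (K * (p' ^+ 2 * y + (p + p') * q * x)))).
    by apply: lerD; apply: ler_wpM2l => //; rewrite mulr_ge0.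
  have -> : 2 * x * (K * (q' ^+ 2 * x + (q + q') * p * y)) +
      2 * y * (K * (p' ^+ 2 * y + (p + p') * q * x)) =
    K * (2 * q' ^+ 2 * x ^+ 2 + 2 * p' ^+ 2 * y ^+ 2 + 2 * x * y * ((q + q') * p + (p + p') * q)) by ring.
  have -> : 4 * K * S * (x ^+ 2 + y ^+ 2) = K * (4 * S * (x ^+ 2 + y ^+ 2)) by ring.
  apply: ler_wpM2l; first exact: ltW.
  have xy : 2 * x * y <= x ^+ 2 + y ^+ 2 by have := sqr_ge0 (x - y); lra.
  have sq (a b : R) : 2 * (a * b) <= a ^+ 2 + b ^+ 2 by have := sqr_ge0 (a - b); lra.
  have B : (q + q') * p + (p + p') * q <= 2 * S.
    have := sq p q; have := sq q' p; have := sq p' q; have := sqr_ge0 p'; have := sqr_ge0 q'.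
    by have := sqr_ge0 p; have := sqr_ge0 q; rewrite /S; lra.
  have B0 : 0 <= (q + q') * p + (p + p') * q by rewrite !(addr_ge0, mulr_ge0) ?l0.
  have xy0 : 0 <= 2 * x * y by rewrite !mulr_ge0.
  have T : 2 * x * y * ((q + q') * p + (p + p') * q) <= (x ^+ 2 + y ^+ 2) * (2 * S) by exact: ler_pM.
  have q'S : q' ^+ 2 <= S by rewrite /S; have := sqr_ge0 p; have := sqr_ge0 q; have := sqr_ge0 p'; lra.
  have p'S : p' ^+ 2 <= S by rewrite /S; have := sqr_ge0 p; have := sqr_ge0 q; have := sqr_ge0 q'; lra.
  have := ler_wpM2r (sqr_ge0 x) q'S; have := ler_wpM2r (sqr_ge0 y) p'S; lra.
have -> : N (U (r + h)) ^+ 2 + N (V (r + h)) ^+ 2 - (x ^+ 2 + y ^+ 2) =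
  (N (U (r + h)) ^+ 2 - x ^+ 2) + (N (V (r + h)) ^+ 2 - y ^+ 2) by ring.
apply: le_trans (ler_normD _ _) _; apply: le_trans (lerD h1 h2) _.
rewrite -mulrDr ler_wpM2l//; lra.
Qed.

End Stability.

(** Multiplication by [- 'i] solves the equations for the time derivatives, and the constant weight
    1 turns the Fock space into a weighted space. *)
Lemma fock_solutionP (R : realType) (u0 v0 : R[i] -> R[i]) (u v : R -> R[i] -> R[i]) :
  fock_solution u0 v0 u v ->
  [/\ forall t, fock (u t), forall t, fock (v t),
    forall t, wderiv (fun=> 1) u (flow_rhs (-1) u v t) t &
    forall t, wderiv (fun=> 1) v (flow_rhs 1 v u t) t] /\ (u 0 = u0 /\ v 0 = v0).
Proof.
have to_w (f df : R -> R[i] -> R[i]) : curve_derivative (@fock R) (@L2norm R) f df ->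
    forall t, [/\ fock (f t), fock (df t) & wderiv (fun=> 1) f (df t) t].
  have -> : @fock R = wspace (fun=> 1) by apply/funext => w; rewrite wspace1.
  have -> : @L2norm R = wnorm (fun=> 1) by apply/funext => w; rewrite wnorm1.
  by move/curve_derivativeP.
have ii : 'i%C * 'i%C = -1 :> R[i] by rewrite -expr2 sqr_i.
move=> [_ [du /to_w du1 du2] [dv /to_w dv1 dv2] <- <-]; split => //.
split=> t; [by have [] := du1 t|by have [] := dv1 t| |].
  have [_ _] := du1 t; congr wderiv; apply/funext => z.
  rewrite /flow_rhs tri_sqmod -du2.
  transitivity (- ('i%C * 'i%C) * du t z); first by rewrite ii opprK mul1r.
  by rewrite rmorphN /=; ring.
have [_ _] := dv1 t; congr wderiv; apply/funext => z.
rewrite /flow_rhs tri_sqmod -[fockproj _ _]opprK -dv2.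
transitivity (- ('i%C * 'i%C) * dv t z); first by rewrite ii opprK mul1r.
ring.
Qed.

Theorem proposition1p2 (R : realType) (kappa : R) (kappa_ge0 : 0 <= kappa) :
  (exists c : R,
    [/\ 0 < kappa -> 0 < c,
        kappa = 0 -> c = 0 &
        forall (u0 v0 : R[i] -> R[i]) (u v : R -> R[i] -> R[i]),
          Xfock kappa u0 -> Xfock kappa v0 -> fock_solution u0 v0 u v ->
          smooth_pair (Xfock kappa) (Xnorm kappa) u v /\
          forall t : R,
            Xnorm kappa (u t) <=
              Xnorm kappa u0 * expR (c * L2norm v0 ^+ 2 * `|t|) /\
            Xnorm kappa (v t) <=
              Xnorm kappa v0 * expR (c * L2norm u0 ^+ 2 * `|t|)]) /\
  (exists2 c : R, 0 < c &
    forall (u0 v0 u0' v0' : R[i] -> R[i]) (u v u' v' : R -> R[i] -> R[i]),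
      smooth_pair (Xfock kappa) (Xnorm kappa) u v ->
      smooth_pair (Xfock kappa) (Xnorm kappa) u' v' ->
      fock_solution u0 v0 u v -> fock_solution u0' v0' u' v' ->
      forall t : R,
        Xnorm kappa (fun z => u t z - u' t z) ^+ 2 +
        Xnorm kappa (fun z => v t z - v' t z) ^+ 2 <=
        (Xnorm kappa (fun z => u0 z - u0' z) ^+ 2 +
         Xnorm kappa (fun z => v0 z - v0' z) ^+ 2) *
        expR (c * (L2norm u0 ^+ 2 + L2norm u0' ^+ 2 +
                   L2norm v0 ^+ 2 + L2norm v0' ^+ 2) * `|t|)).
Proof.
have n1 : `|-1| = 1 :> R by rewrite normrN normr1.
have n1' : `|1| = 1 :> R by rewrite normr1.
have K0 := tri_cst_gt0 kappa.
have to := tame_expw kappa_ge0.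
split; last first.
  exists (8 * tri_cst kappa); first by rewrite mulr_gt0.
  move=> u0 v0 u0' v0' u v u' v' [[D D0 HD] [E E0 HE]] [[D' D0' HD'] [E' E0' HE']].
  move=> /fock_solutionP[[fu fv du dv] [<- <-]] /fock_solutionP[[fu' fv' du' dv'] [<- <-]] t.
  have wu : Xfock kappa (u 0) by have [+ _ _] := HD 0%N 0; rewrite D0.
  have wv : Xfock kappa (v 0) by have [+ _ _] := HE 0%N 0; rewrite E0.
  have wu' : Xfock kappa (u' 0) by have [+ _ _] := HD' 0%N 0; rewrite D0'.
  have wv' : Xfock kappa (v' 0) by have [+ _ _] := HE' 0%N 0; rewrite E0'.
  have uE := L2norm_conserved fu fv du; have vE := L2norm_conserved fv fu dv.
  have uE' := L2norm_conserved fu' fv' du'; have vE' := L2norm_conserved fv' fu' dv'.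
  apply: (flow_stability kappa_ge0 to n1 n1').
  - by move=> r; have [] := exp_growth kappa_ge0 n1 fu fv du vE r wu.
  - by move=> r; have [] := exp_growth kappa_ge0 n1' fv fu dv uE r wv.
  - by move=> r; have [] := exp_growth kappa_ge0 n1 fu' fv' du' vE' r wu'.
  - by move=> r; have [] := exp_growth kappa_ge0 n1' fv' fu' dv' uE' r wv'.
  - exact: (wderiv_exp kappa_ge0 n1 n1' fu fv du dv wu wv).
  - exact: (wderiv_exp kappa_ge0 n1' n1 fv fu dv du wv wu).
  - exact: (wderiv_exp kappa_ge0 n1 n1' fu' fv' du' dv' wu' wv').
  - exact: (wderiv_exp kappa_ge0 n1' n1 fv' fu' dv' du' wv' wu').
  - exact: uE.
  - exact: vE.
  - exact: uE'.
  - exact: vE'.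
(* [tri_cst 0] is positive, so the value [0] at [kappa = 0] is chosen separately; there the estimate
   is conservation of the L^2 norm. Otherwise the 2 comes from Gronwall's inequality. *)
exists (if kappa == 0 then 0 else 2 * tri_cst kappa); split.
- by move=> k; rewrite gt_eqF// mulr_gt0.
- by move=> ->; rewrite eqxx.
move=> u0 v0 u v wu0 wv0 /fock_solutionP[[fu fv du dv] [uu vv]].
rewrite -{}uu in wu0 *; rewrite -{}vv in wv0 *.
have uE := L2norm_conserved fu fv du; have vE := L2norm_conserved fv fu dv.
have gu := exp_growth kappa_ge0 n1 fu fv du vE; have gv := exp_growth kappa_ge0 n1' fv fu dv uE.
split.
  pose x (j : bool) := if j then u else v; pose s (j : bool) : R := if j then -1 else 1.
  have wx j t : wspace (expw kappa) (x j t) by case: j; [have [] := gu t wu0|have [] := gv t wv0].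
  have dx j t : wderiv (expw kappa) (x j) (flow_rhs (s j) (x j) (x (~~ j)) t) t.
    case: j; [exact: (wderiv_exp kappa_ge0 n1 n1' fu fv du dv wu0 wv0)|].
    exact: (wderiv_exp kappa_ge0 n1' n1 fv fu dv du wv0 wu0).
  by split; [exact: (flow_smooth true kappa_ge0 to wx dx)|exact: (flow_smooth false kappa_ge0 to wx dx)].
move=> t; case: eqP => [k0|_].
  have E (w : R[i] -> R[i]) : Xnorm kappa w = L2norm w.
    by rewrite /Xnorm; congr L2norm; apply/funext => z; rewrite /expweight k0 mul0r expR0 mul1r.
  by rewrite !mul0r expR0 !mulr1 !E uE vE.
have [_ hu] := gu t wu0; have [_ hv] := gv t wv0.
by rewrite -!mulrA; rewrite -!mulrA in hu hv; split.
Qed.
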